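(* Let $\mathbb{F}_q$ be a finite field of characteristic at least $5$ and let $A\in\mathbb{F}_q[x]$ with $\deg(A)=n_1>0$. Assume that either (a) $n_1$ is odd, or (b) $n_1$ is even and the leading coefficient of $A$ is not a square in $\mathbb{F}_q$. Let $B=a(a^2-A)+\kappa$ for some non-zero $a\in\mathbb{F}_q[x]$ with $\deg(a)<n_1/2$ and some $\kappa\in\mathbb{F}_q^*$. Set $D=4A^3-27B^2$ and suppose that the squarefree factorization of $D$ is $D=D_1D_2^2$ and that $D_2\mid B$. Let $\mathcal{F}=\mathbb{F}_q(x,y)$ with $y^3=Ay-B$ and suppose that $T^3-AT+B$ is irreducible over $\mathbb{F}_q(x)$. Then in both cases (a) and (b), $\mathcal{F}$ has unit rank $1$ and $\epsilon=a+y$ is a fundamental unit. Moreover, the regulator $R$ of $\mathcal{F}/\mathbb{F}_q(x)$ equals $n_1$ in case (a) and $n_1/2$ in case (b).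
   Context: $\mathbb{F}_q$ is assumed to be algebraically closed in $\mathcal{F}$. ''The squarefree factorization of $D$ is $D=D_1D_2^2$'' means $D_1,D_2\in\mathbb{F}_q[x]$ are squarefree and coprime. $\mathcal{O}$ is the integral closure of $\mathbb{F}_q[x]$ in $\mathcal{F}$; $\mathcal{O}^*=\mathbb{F}_q^*\times\mathcal{E}$ with $\mathcal{E}$ free abelian of finite rank, this rank being the unit rank; a system of fundamental units is a set of independent units generating $\mathcal{O}^*$ modulo $\mathbb{F}_q^*$ (for unit rank $1$: a fundamental unit). Let $\mathcal{U}^0$ be the group of degree-$0$ divisors of $\mathcal{F}$ supported on the infinite places (the places above the infinite place of $\mathbb{F}_q(x)$) and $\mathcal{P}$ the group of principal divisors; the regulator is the index $R=[\mathcal{U}^0:\mathcal{P}\cap\mathcal{U}^0]$. *)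

(* Defs.v *)
From HB Require Import structures.
From mathcomp Require Import all_boot all_order all_algebra all_field.
From mathcomp Require Import fraction.
From mathcomp Require Import boolp classical_sets functions cardinality.
From mathcomp Require Import finmap.
(* The notation << _ >> of freeg clashes with spans and adjunctions. *)
From mathcomp.multinomials Require Import -(notations) freeg.

Set Implicit Arguments.
Unset Strict Implicit.
Unset Printing Implicit Defensive.

Import GRing.Theory.

Local Open Scope classical_set_scope.
Local Open Scope ring_scope.

(* For p = 0 take d = 0: so squarefree polynomials are non-zero. *)
Definition squarefree_poly (k : fieldType) (p : {poly k}) : Prop :=
  forall d : {poly k}, d ^+ 2 %| p -> size d = 1%N.

(* The index [G : H] of a subgroup H of G, as the number of cosets g + H with
   g in G; it is 0 by convention when there are infinitely many cosets. *)
Definition group_index (V : zmodType) (G H : set V) : nat :=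
  #|` fset_set [set [set g + h | h in H] | g in G]|.

Section FunctionField.

Variables (Fq : finFieldType) (F : fieldExtType {fraction {poly Fq}}).

Definition ratl (f : {fraction {poly Fq}}) : F := in_alg F f.
Definition pol (f : {poly Fq}) : F := ratl (tofrac f).
Definition cst (c : Fq) : F := pol c%:P.

Definition constants_closed : Prop :=
  forall z : F, algebraicOver cst z -> exists c : Fq, z = cst c.

(* Membership in the maximal order. *)
Definition Oint (z : F) : Prop := integralOver pol z.

Definition Ounit (u : F) : Prop := [/\ u != 0, Oint u & Oint u^-1].

(* O^* = Fq^* x E with E freely generated by e_0, ..., e_(n-1). *)
Definition has_unit_rank (n : nat) : Prop :=
  exists e : 'I_n -> F, (forall i, Ounit (e i)) /\
    forall u, Ounit u -> exists! ck : Fq * {ffun 'I_n -> int},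
      ck.1 != 0 /\ u = cst ck.1 * \prod_(i < n) e i ^ ck.2 i.

Definition independent_units (n : nat) (e : 'I_n -> F) : Prop :=
  (forall i, Ounit (e i)) /\
  forall k : 'I_n -> int, \prod_(i < n) e i ^ k i = 1 -> forall i, k i = 0.

Definition fundamental_units (n : nat) (e : 'I_n -> F) : Prop :=
  independent_units e /\
  forall u, Ounit u -> exists (c : Fq) (k : 'I_n -> int),
    c != 0 /\ u = cst c * \prod_(i < n) e i ^ k i.

Definition fundamental_unit (e : F) : Prop :=
  fundamental_units (fun _ : 'I_1 => e).

(* A place is identified with its normalized discrete valuation. The value at 0
   (really +oo) is set to 0, so that a place is determined by this function. *)
Record place : Type := Place {
  pval :> F -> int;
  pval0 : pval 0 = 0;
  pval_cst : forall c : Fq, c != 0 -> pval (cst c) = 0;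
  pvalM : forall f g : F, f != 0 -> g != 0 -> pval (f * g) = pval f + pval g;
  pvalD : forall f g : F, f != 0 -> g != 0 -> f + g != 0 ->
    Num.min (pval f) (pval g) <= pval (f + g);
  pval_surj : exists t : F, t != 0 /\ pval t = 1
}.

HB.instance Definition _ := gen_eqMixin place.
HB.instance Definition _ := gen_choiceMixin place.

(* The valuation ring and its maximal ideal; recall that P 0 = 0. *)
Definition regular_at (P : place) (z : F) : Prop := 0 <= P z.
Definition vanishes_at (P : place) (z : F) : Prop := z = 0 \/ 0 < P z.

Definition residue_basis (P : place) (d : nat) (b : 'I_d -> F) : Prop :=
  (forall i, regular_at P (b i)) /\
  forall z, regular_at P z -> exists! c : {ffun 'I_d -> Fq},
    vanishes_at P (z - \sum_(i < d) cst (c i) * b i).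

(* The dimension over Fq of the residue field. *)
Definition pdeg (P : place) : nat :=
  xget 0%N [set d : nat | exists b : 'I_d -> F, residue_basis P b].

(* P lies above the place of Fq(x) whose maximal ideal consists of the
   fractions f / g with deg f < deg g. *)
Definition infinite_place (P : place) : Prop :=
  forall f g : {poly Fq}, (size f < size g)%N ->
    vanishes_at P (ratl (tofrac f / tofrac g)).

Definition divisor : zmodType := FreegDefs.type_of (Phant int) (Phant place).

Definition mult (P : place) (D : divisor) : int := coeff P D.

Definition divdeg (D : divisor) : int :=
  fglift (fun P : place => (pdeg P)%:Z : int^o) D.

Definition U0 : set divisor :=
  [set D | divdeg D = 0 /\ forall P, mult P D != 0 -> infinite_place P].

Definition principal : set divisor :=
  [set D | exists2 f : F, f != 0 & forall P, mult P D = P f].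

Definition regulator : nat := group_index U0 (principal `&` U0).

End FunctionField.

Arguments ratl {Fq} F f.
Arguments pol {Fq} F f.
Arguments cst {Fq} F c.

(* Main.v *)
Require Import Defs.
From HB Require Import structures.
From mathcomp Require Import all_boot all_order all_algebra all_field.
From mathcomp Require Import fraction generic_quotient qpoly.
From mathcomp Require Import boolp classical_sets cardinality finmap.
From mathcomp.multinomials Require Import -(notations) freeg.
From mathcomp Require Import zify ring.

Set Implicit Arguments.
Unset Strict Implicit.
Unset Printing Implicit Defensive.

Import Order.TTheory GRing.Theory Num.Theory.

Local Open Scope ring_scope.

(** Write eps = a + y. Since B = a (a^2 - A) + kappa, the norm of eps is - kappa,
    so eps is a unit, and it satisfies
      eps^3 - 3a eps^2 + (3a^2 - A) eps + kappa = 0.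
    As deg a < n1/2, the Newton polygon of this cubic at infinity has one root of
    degree - n1 and two roots of degree n1/2. So there are two infinite places:
    P1, where eps has a zero, and P2, where it has a pole. P1 is unramified of
    degree 1 with P1(eps) = n1. If n1 is odd, the slope n1/2 forces P2 to be
    ramified, of degree 1; if n1 is even, the residual polynomial at P2 is
    T^2 - lc(A), which is irreducible because lc(A) is not a square, so P2 is
    inert, of degree 2. This is [infinite_places]. That the places are no more
    numerous, and their degrees, come from a general fact on curves
    ([regular_point_place]): at a regular point all functions are powers of one
    uniformizer times quotients of units, so a single place is centred there and its
    residue field is that of the point.

    The heart of the matter is that eps is not a proper power up to constants.
    First, the maximal order is Fq[x][y] ([Oint_coordinates]): a prime p whose square
    does not divide D is excluded from the index by a discriminant argument; if p^2
    divides D, then p divides D2, hence B and A, and exactly once B, so that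
    T^3 - AT + B is an Eisenstein polynomial at p. Next, for u = f + g y + h y^2 the
    discriminant of the characteristic polynomial is N(g - h y)^2 D
    ([disc3_index_form]), and deg D = 3 n1. If u is a unit with P1(u) = k > 0, the
    product formula gives its conjugates the degrees - k, k/2 and k/2 at infinity, so
    that this discriminant has degree at most 3k. As u is not constant, the index
    N(g - h y) is a non-zero polynomial, whence 3 n1 <= 3k
    ([unit_degree_lower_bound]). So P1 maps the units onto n1 Z; its kernel consists
    of constants, since a function without poles is constant. Hence every unit is
    c eps^k ([unit_decomposition]), which gives the unit rank and the fundamental unit.

    For the regulator, U^0 is infinite cyclic, generated by deg(P2) P1 - P2, and
    div(eps) is N times this generator where n1 = deg(P2) N. A function whose divisor
    is supported at infinity is a unit of the maximal order, because a function
    without poles at the finite places is integral ([integral_of_regular]): a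
    non-integral z has a pole at some place, given by a valuation ring that avoids z,
    which exists by Zorn's lemma and is discrete because F is finite over Fq(x). So
    the principal divisors in U^0 are the multiples of div(eps), and the index is N,
    that is n1 or n1/2. *)

(** * Valuation rings avoiding a non-integral element *)

Definition is_subring (F : fieldType) (R : set F) : Prop :=
  [/\ R 1, forall a b, R a -> R b -> R (a - b)
    & forall a b, R a -> R b -> R (a * b)].

Definition integral_in (F : fieldType) (R : set F) (z : F) : Prop :=
  exists p : {poly F}, [/\ p \is monic, forall i, R p`_i & root p z].

Section Subring.
Variables (F : fieldType) (R : set F).
Hypothesis ringR : is_subring R.

Lemma subring1 : R 1. Proof. by case: ringR. Qed.
Lemma subringB a b : R a -> R b -> R (a - b).
Proof. by case: ringR => _ h _; apply: h. Qed.
Lemma subringM a b : R a -> R b -> R (a * b).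
Proof. by case: ringR => _ _ h; apply: h. Qed.
Lemma subring0 : R 0. Proof. by rewrite -(subrr 1); apply: subringB; apply: subring1. Qed.
Lemma subringN a : R a -> R (- a).
Proof. by move=> Ra; rewrite -sub0r; apply: subringB => //; apply: subring0. Qed.
Lemma subringD a b : R a -> R b -> R (a + b).
Proof. by move=> Ra Rb; rewrite -[b]opprK; apply: subringB => //; apply: subringN. Qed.
Lemma subringX a n : R a -> R (a ^+ n).
Proof.
move=> Ra; elim: n => [|n IHn]; first exact: subring1.
by rewrite exprS; apply: subringM.
Qed.
Lemma subring_sum (I : Type) (r : seq I) (P : pred I) (f : I -> F) :
  (forall i, P i -> R (f i)) -> R (\sum_(i <- r | P i) f i).
Proof. by move=> Rf; apply: big_ind => //; [apply: subring0 | apply: subringD]. Qed.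
Lemma subring_nat n : R n%:R.
Proof.
elim: n => [|n IHn]; first exact: subring0.
by rewrite -natr1; apply: subringD => //; apply: subring1.
Qed.

End Subring.

(** Take t = 1/z: multiplying a relation 1 = q(t) t by a power of z turns it into an
    integral equation for z, so the hypothesis on t holds when z is not integral over
    R. *)
Section ZornValuationRing.

Variables (F : fieldType) (R : set F) (t : F).
Hypotheses (ringR : is_subring R) (t0 : t != 0).
Hypothesis t_nint : forall q : {poly F}, (forall i, R q`_i) -> q.[t] * t != 1.

(** Candidates for the maximal ideal of a valuation ring: R-modules without 1, closed
    under products. No ring is mentioned, since it is recovered as the set of
    multipliers of M. The empty set is let in so that the union of the empty chain is
    a candidate too. *)
Let good (M : set F) : Prop :=
  [/\ forall a b, M a -> M b -> M (a + b), forall a b, M a -> M b -> M (a * b),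
      forall a b, R a -> M b -> M (a * b), ~ M 1 & forall a, M a -> M t].

Lemma maximal_good : exists M, [/\ good M, M t &
  forall N, good N -> (M `<=` N)%classic -> N = M].
Proof.
have [C CP totC|M [gM maxM]] := @Zorn_bigcup F good.
  split.
  - move=> a b [X CX Xa] [Y CY Yb].
    have [XY|YX] := totC _ _ CX CY.
      exists Y => //; case: (CP _ CY) => h _ _ _ _; apply: h => //; exact: XY.
    exists X => //; case: (CP _ CX) => h _ _ _ _; apply: h => //; exact: YX.
  - move=> a b [X CX Xa] [Y CY Yb].
    have [XY|YX] := totC _ _ CX CY.
      exists Y => //; case: (CP _ CY) => _ h _ _ _; apply: h => //; exact: XY.
    exists X => //; case: (CP _ CX) => _ h _ _ _; apply: h => //; exact: YX.
  - by move=> a b Ra [X CX Xb]; exists X => //; case: (CP _ CX) => _ _ h _ _; apply: h.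
  - by move=> [X CX X1]; case: (CP _ CX).
  - by move=> a [X CX Xa]; exists X => //; case: (CP _ CX) => _ _ _ _ h; apply: h Xa.
have maxE N : good N -> (M `<=` N)%classic -> N = M.
  move=> gN MN; apply: contrapT => NM; apply: (maxM N) => //.
  by split=> // NM'; apply: NM; apply/seteqP.
exists M; split=> //.
pose N : set F := fun z => exists2 q : {poly F}, forall i, R q`_i & z = q.[t] * t.
have Nt : N t.
  by exists 1; rewrite ?hornerC ?mul1r // => i; rewrite coef1; apply: subring_nat.
have gN : good N.
  split=> //.
  - move=> a b [p Rp ->] [q Rq ->]; exists (p + q); last by rewrite hornerD mulrDl.
    by move=> i; rewrite coefD; apply: subringD.
  - move=> a b [p Rp ->] [q Rq ->]; exists (p * q * 'X).
      move=> i; rewrite coefMX; case: eqP => _; first exact: subring0.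
      by rewrite coefM; apply: subring_sum => // j _; apply: subringM.
    by rewrite hornerMX hornerM; ring.
  - move=> a b Ra [q Rq ->]; exists (a *: q); last by rewrite hornerZ mulrA.
    by move=> i; rewrite coefZ; apply: subringM.
  - by move=> [q Rq]; apply/eqP; rewrite eq_sym; apply: t_nint.
have [[x Mx]|M0] := pselect (exists x, M x); first by case: gM => _ _ _ _ h; apply: h Mx.
suff NM : N = M by rewrite -NM.
by apply: maxE => // x Mx; case: M0; exists x.
Qed.

(** The multipliers S of a maximal candidate M form a valuation ring with maximal ideal
    M. If z is not in S, then M[z] cannot be a candidate, so it contains 1. If neither
    z nor 1/z were in S, the two resulting relations 1 = q(z) = q'(1/z) could be used to
    lower each other's degree for ever. *)
Lemma valuation_ring_of_pole : exists S : set F,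
  [/\ is_subring S, (R `<=` S)%classic, ~ S t^-1
    & forall z, S z \/ S z^-1].
Proof.
have [M [[MD MM MR M1 _] Mt maxM]] := maximal_good.
pose S : set F := fun z => forall m, M m -> M (z * m).
have MN a : M a -> M (- a).
  move=> Ma; rewrite -mulN1r; apply: MR => //.
  by apply: subringN => //; apply: subring1.
have M0 : M 0 by rewrite -(subrr t); apply: MD => //; apply: MN.
have ringS : is_subring S.
  split=> [m|a b Sa Sb m Mm|a b Sa Sb m Mm]; first by rewrite mul1r.
    by rewrite mulrBl; apply: MD; [apply: Sa | apply/MN/Sb].
  by rewrite -mulrA; apply/Sa/Sb.
have MS m : M m -> S m by move=> Mm x Mx; apply: MM.
have Msum (I : Type) (r : seq I) (f : I -> F) :
    (forall i, M (f i)) -> M (\sum_(i <- r) f i).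
  by move=> Mf; apply: big_ind.
(* for z outside S, the module M[z] contains 1, by maximality of M *)
have notS z : ~ S z -> exists2 q : {poly F}, forall i, M q`_i & q.[z] = 1.
  move=> nSz; apply: contrapT => nq; apply: nSz.
  pose N : set F := fun u => exists2 q : {poly F}, forall i, M q`_i & u = q.[z].
  have MN' : (M `<=` N)%classic.
    move=> m Mm; exists m%:P; last by rewrite hornerC.
    by move=> i; rewrite coefC; case: eqP.
  suff gN : good N.
    have NM := maxM _ gN MN'; move=> m; rewrite -NM => -[q Mq ->].
    exists (q * 'X); last by rewrite hornerMX mulrC.
    by move=> i; rewrite coefMX; case: eqP.
  split.
  - move=> a b [p Mp ->] [q Mq ->]; exists (p + q); last by rewrite hornerD.
    by move=> i; rewrite coefD; apply: MD.
  - move=> a b [p Mp ->] [q Mq ->]; exists (p * q); last by rewrite hornerM.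
    by move=> i; rewrite coefM; apply: Msum => j; apply: MM.
  - move=> a b Ra [q Mq ->]; exists (a *: q); last by rewrite hornerZ.
    by move=> i; rewrite coefZ; apply: MR.
  - by move=> [q Mq q1]; apply: nq; exists q.
  - by move=> _ _; apply: MN'.
have M1X m n : M m -> M (1 - (1 - m) ^+ n).
  move=> Mm; elim: n => [|n IHn]; first by rewrite expr0 subrr.
  have -> : 1 - (1 - m) ^+ n.+1 = (1 - (1 - m) ^+ n) + m - m * (1 - (1 - m) ^+ n).
    by rewrite exprS; ring.
  by apply: (MD); [apply: MD | apply/MN/MM].
(* M lies in the Jacobson radical of S *)
have unitS m : M m -> 1 - m != 0 /\ S (1 - m)^-1.
  move=> Mm; have nz : 1 - m != 0.
    by apply/eqP => h; apply: M1; move/subr0_eq: h => ->.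
  split=> //; apply: contrapT => /notS [q Mq q1].
  apply: M1; set u := 1 - m in nz q1 *.
  have Mq' : M (q.[u^-1] * u ^+ (size q)).
    rewrite horner_coef mulr_suml; apply: big_ind => // i _.
    have -> : q`_i * u^-1 ^+ i * u ^+ size q = u ^+ (size q - i) * q`_i.
      have -> : u ^+ size q = u ^+ (size q - i) * u ^+ i.
        by rewrite -exprD subnK // ltnW.
      by rewrite exprVn; field; rewrite expf_neq0.
    have Su : S u := subringB ringS (subring1 ringS) (MS _ Mm).
    have SX := subringX ringS (size q - i) Su.
    exact: SX.
  rewrite q1 mul1r in Mq'.
  by rewrite -(subrK (u ^+ size q) 1); apply: MD => //; apply: M1X.
have key N : forall z (q q' : {poly F}), (size q + size q' <= N)%N ->
    (forall i, M q`_i) -> (forall i, M q'`_i) -> z != 0 ->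
    q.[z] = 1 -> q'.[z^-1] = 1 -> False.
  elim: N => [|N IHN] z q q' sz Mq Mq' z0 qz qz'.
    have /eqP : size q = 0 by lia.
    rewrite size_poly_eq0 => /eqP q0; move: qz; rewrite q0 horner0 => /esym/eqP.
    by rewrite oner_eq0.
  wlog le : z q q' sz Mq Mq' z0 qz qz' / (size q' <= size q)%N.
    move=> W; have [le|/ltnW le] := leqP (size q') (size q); first exact: (W z q q').
    apply: (W z^-1 q' q) => //; rewrite ?invr_eq0 ?invrK //; lia.
  have q_nz : q != 0.
    by apply/eqP=> q0; move: qz; rewrite q0 horner0 => /esym/eqP; rewrite oner_eq0.
  have [n sq] : exists n, size q = n.+1.
    by exists (size q).-1; rewrite prednK // lt0n size_poly_eq0.
  have [u0 Su] := unitS _ (Mq' 0).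
  set u := 1 - q'`_0 in u0 Su.
  (* the top term q_n z^n is rewritten through 1 = sum_(j >= 1) (q'_j / u) z^-j *)
  pose r := \poly_(i < n) (q`_i + q`_n * (u^-1 * q'`_(n - i))).
  apply: (IHN z r q') => //.
  - have := size_poly n (fun i => q`_i + q`_n * (u^-1 * q'`_(n - i))).
    rewrite -/r; lia.
  - move=> i; rewrite coef_poly; case: ifP => // _.
    by apply: MD => //; apply: MM => //; apply: Su.
  rewrite /r horner_poly.
  have e1 : u = \sum_(i < n) q'`_(n - i) * z ^- (n - i).
    rewrite /u -qz' (@horner_coef_wide _ n.+1); last by lia.
    rewrite big_ord_recl /= expr0 mulr1 addrC addKr.
    rewrite [LHS](reindex_inj rev_ord_inj) /=.
    apply: eq_bigr => i _; rewrite /bump /= exprVn.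
    by have -> : (1 + (n - i.+1) = n - i)%N by have := ltn_ord i; lia.
  have e2 : q`_n * z ^+ n = \sum_(i < n) q`_n * (u^-1 * q'`_(n - i)) * z ^+ i.
    rewrite -[LHS]mulr1 -(mulVf u0) {2}e1 !mulr_sumr.
    apply: eq_bigr => i _.
    have -> : z ^+ n = z ^+ (n - i) * z ^+ i by rewrite -exprD subnK // ltnW.
    by field; rewrite u0 expf_neq0.
  rewrite -qz [RHS](@horner_coef_wide _ n.+1) ?sq // big_ord_recr /= e2 -big_split /=.
  by apply: eq_bigr => i _; rewrite mulrDl.
exists S; split=> //.
- by move=> a Ra m Mm; apply: MR.
- by move=> /(_ _ Mt); rewrite mulVf.
- move=> z; have [->|z0] := eqVneq z 0; first by left; apply: subring0.
  have [Sz|nSz] := pselect (S z); first by left.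
  right; apply: contrapT => nSz'.
  have [q Mq q1] := notS _ nSz; have [q' Mq' q1'] := notS _ nSz'.
  exact: (key _ z q q' (leqnn _)).
Qed.

End ZornValuationRing.

(** * Units and maximal ideal of a valuation ring *)

Section ValuationRing.

Variables (F : fieldType) (S : set F).
Hypotheses (ringS : is_subring S) (valS : forall z, S z \/ S z^-1).

Definition vunit (z : F) : Prop := [/\ z != 0, S z & S z^-1].

Lemma vunit1 : vunit 1.
Proof. by split; rewrite ?oner_eq0 ?invr1 //; apply: subring1. Qed.

Lemma vunitM a b : vunit a -> vunit b -> vunit (a * b).
Proof.
move=> [a0 Sa Sa'] [b0 Sb Sb']; split; rewrite ?mulf_neq0 //.
  exact: subringM.
by rewrite invfM; apply: subringM.
Qed.

Lemma vunitV a : vunit a -> vunit a^-1.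
Proof. by move=> [a0 Sa Sa']; split; rewrite ?invr_eq0 ?invrK. Qed.

Lemma vunitX a n : vunit a -> vunit (a ^+ n).
Proof.
by move=> ua; elim: n => [|n IHn]; [apply: vunit1 | rewrite exprS; apply: vunitM].
Qed.

Lemma vunitN a : vunit a -> vunit (- a).
Proof. by move=> [a0 Sa Sa']; split; rewrite ?oppr_eq0 ?invrN //; apply: subringN. Qed.

Lemma vring_root a n : S (a ^+ n.+1) -> S a.
Proof.
move=> San; have [//|Sa'] := valS a.
have [->|a0] := eqVneq a 0; first exact: subring0.
have -> : a = a ^+ n.+1 * a^-1 ^+ n by rewrite exprS exprVn mulfK // expf_neq0.
by apply: subringM => //; apply: subringX.
Qed.

Definition vmax (z : F) : Prop := S z /\ ~ vunit z.

Lemma vmax0 : vmax 0.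
Proof. by split; [apply: subring0 | case; rewrite eqxx]. Qed.

Lemma vmaxM a b : S a -> vmax b -> vmax (a * b).
Proof.
move=> Sa [Sb ub]; split; first exact: subringM.
move=> [ab0 _ Sab']; apply: ub; move: ab0; rewrite mulf_eq0 negb_or => /andP[a0 b0].
by split=> //; rewrite -(mulKf a0 b) invfM invrK; apply: subringM.
Qed.

Lemma vunitD1 a : vmax a -> vunit (1 + a).
Proof.
move=> [Sa ua].
have S1a : S (1 + a) by apply: subringD => //; apply: subring1.
have nz : 1 + a != 0.
  apply/eqP => h; apply: ua; have -> : a = -1 by apply/eqP; rewrite -addr_eq0 addrC h.
  exact/vunitN/vunit1.
split=> //; have [a0|a0] := eqVneq a 0; first by rewrite a0 addr0 invr1; apply: subring1.
have [h|] := valS ((1 + a) / a); last first.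
  rewrite invf_div => h; have -> : (1 + a)^-1 = 1 - a / (1 + a) by field.
  by apply: subringB => //; apply: subring1.
case: ua; split=> //; have -> : a^-1 = (1 + a) / a - 1 by field.
by apply: subringB => //; apply: subring1.
Qed.

Lemma vunitD a b : vunit a -> vmax b -> vunit (a + b).
Proof.
move=> ua mb; have [a0 _ Sa'] := ua.
have -> : a + b = a * (1 + a^-1 * b) by field.
by apply: vunitM => //; apply/vunitD1/vmaxM.
Qed.

Lemma vmaxD a b : vmax a -> vmax b -> vmax (a + b).
Proof.
move=> ma mb; split; first by case: ma mb => Sa _ [Sb _]; apply: subringD.
move=> uab; case: (ma) => _; apply; rewrite -(addrK b a); apply: vunitD => //.
by rewrite -mulN1r; apply: vmaxM => //; apply: subringN => //; apply: subring1.
Qed.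

Lemma vmax_sum (I : Type) (r : seq I) (P : pred I) (f : I -> F) :
  (forall i, P i -> vmax (f i)) -> vmax (\sum_(i <- r | P i) f i).
Proof. by move=> mf; apply: big_ind => //; [apply: vmax0 | apply: vmaxD]. Qed.

(** Terms of distinct value cannot cancel: their sum has the value of the larger one.
    Values are compared here without a valuation, up to units. *)
Lemma dominant_term a b : a != 0 -> b != 0 -> ~ vunit (a / b) ->
  vunit ((a + b) / a) \/ vunit ((a + b) / b).
Proof.
move=> a0 b0 nu; have [Sab|Sba] := valS (a / b).
  by right; rewrite mulrDl divff // addrC; apply: vunitD1.
left; rewrite mulrDl divff //; apply: vunitD1; split; first by rewrite -invf_div.
by move=> /vunitV; rewrite invf_div.
Qed.

End ValuationRing.

Lemma fracP (R : idomainType) (h : {fraction R}) :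
  exists f g : R, g != 0 /\ h = tofrac f / tofrac g.
Proof.
elim/quotW: h => r; exists r.1, r.2; have r2 := denom_ratioP r; split=> //.
have r2' : tofrac r.2 != 0 by rewrite tofrac_eq0.
apply: (canRL (mulfK r2')).
rewrite -[X in _ * X]/(FracField.tofrac _) -[RHS]/(FracField.tofrac _).
rewrite -[LHS]/(FracField.mul _ _) !piE.
apply/eqP; rewrite piE /FracField.equivf /FracField.mulf.
by rewrite !numden_Ratio ?mulf_neq0 ?oner_neq0 // !mulr1 mulrC.
Qed.

Section Morphisms.
Variables (Fq : finFieldType) (F : fieldExtType {fraction {poly Fq}}).

HB.instance Definition _ := GRing.RMorphism.copy (ratl F) (in_alg F).
HB.instance Definition _ := GRing.RMorphism.copy (pol F) (ratl F \o @tofrac {poly Fq}).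
HB.instance Definition _ := GRing.RMorphism.copy (cst F) (pol F \o @polyC Fq).

Lemma ratl_eq0 h : (ratl F h == 0) = (h == 0). Proof. exact: fmorph_eq0. Qed.
Lemma pol_eq0 f : (pol F f == 0) = (f == 0).
Proof. by rewrite ratl_eq0 tofrac_eq0. Qed.
Lemma cst_eq0 c : (cst F c == 0) = (c == 0). Proof. exact: fmorph_eq0. Qed.


Lemma polE f : pol F f = (map_poly (cst F) f).[pol F 'X].
Proof.
elim/poly_ind: f => [|f c IHf]; first by rewrite !rmorph0 horner0.
rewrite rmorphD rmorphM /= IHf [X in _ = X.[_]]rmorphD rmorphM /= map_polyX map_polyC.
by rewrite hornerD hornerMX hornerC.
Qed.

Lemma ratlP (h : {fraction {poly Fq}}) :
  exists f g : {poly Fq}, g != 0 /\ ratl F h = pol F f / pol F g.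
Proof.
have [f [g [g0 hE]]] := fracP h; exists f, g; split=> //.
by rewrite hE; apply: fmorph_div.
Qed.


End Morphisms.

(** * Valuation rings of a function field *)

Lemma expf_mulV (F : fieldType) (z : F) (i n : nat) : z != 0 -> (i <= n)%N ->
  z ^+ i * z^-1 ^+ n = z^-1 ^+ (n - i).
Proof.
move=> z0 le; rewrite -{1}(subnKC le) exprD mulrA !exprVn divff ?mul1r //.
by rewrite expf_neq0.
Qed.

(** If z were not in S, dividing an integral equation by z^(n-1) would write z as a
    polynomial in 1/z with coefficients in S, and 1/z is in S. *)
Lemma vring_integral (F : fieldType) (S : set F) z : is_subring S ->
  (forall z, S z \/ S z^-1) -> integral_in S z -> S z.
Proof.
move=> ringS valS [p [mon_p Sp /rootP pz]].
have [//|Sz'] := valS z.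
have [->|z0] := eqVneq z 0; first exact: subring0.
have [n sp] : exists n, size p = n.+1.
  by exists (size p).-1; rewrite prednK // lt0n size_poly_eq0 monic_neq0.
case: n sp => [|n] sp.
  move/eqP: pz; rewrite (size1_polyC (eq_leq sp)) hornerC.
  have := monicP mon_p; rewrite /lead_coef sp => -> /eqP h.
  by move: (oner_neq0 F); rewrite h eqxx.
move: pz; rewrite horner_coef sp big_ord_recr /=.
have -> : p`_n.+1 = 1 by have := monicP mon_p; rewrite /lead_coef sp.
rewrite mul1r => /eqP; rewrite addrC addr_eq0 => /eqP zn.
have -> : z = z ^+ n.+1 * z^-1 ^+ n by rewrite exprS exprVn mulfK // expf_neq0.
rewrite zn mulNr; apply: subringN => //; rewrite mulr_suml.
apply: subring_sum => // i _; rewrite -mulrA; apply: subringM => //.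
rewrite expf_mulV //; last by rewrite -ltnS.
exact: subringX.
Qed.

Section PlaceOfValuationRing.

Variables (Fq : finFieldType) (F : fieldExtType {fraction {poly Fq}}).
Implicit Types (z : F) (h : {fraction {poly Fq}}).

Lemma minimal_polynomial z : exists p : {poly {fraction {poly Fq}}},
  [/\ p \is monic, (size p <= (\dim {:F}).+1)%N & root (map_poly (ratl F) p) z].
Proof.
have /polyOver1P [p pE] := minPolyOver 1%AS z.
exists p; split.
- by have := monic_minPoly 1%AS z; rewrite pE map_monic.
- have -> : size p = size (minPoly 1 z) by rewrite pE size_map_poly.
  rewrite size_minPoly ltnS /adjoin_degree dimv1 divn1.
  by rewrite prednK ?adim_gt0 // dimvS ?subvf.
- by have := root_minPoly 1%AS z; rewrite pE.
Qed.

Variable (S : set F).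
Hypotheses (ringS : is_subring S) (valS : forall z, S z \/ S z^-1).
Hypotheses (cstS : forall c, S (cst F c)) (properS : exists z, ~ S z).

(** A valuation ring of F that contains all rational functions contains all that is
    integral over them, which is F. *)
Lemma rational_pole : exists h, ~ S (ratl F h).
Proof.
apply: contrapT => nh; case: properS => z; apply.
have [p [mon_p _ rp]] := minimal_polynomial z.
apply: vring_integral => //; exists (map_poly (ratl F) p); split=> //.
  by rewrite map_monic.
by move=> i; rewrite coef_map; apply: contrapT => h; apply: nh; exists p`_i.
Qed.

Lemma cst_vunit c : c != 0 -> vunit S (cst F c).
Proof.
by move=> c0; split; [rewrite cst_eq0 | apply: cstS | rewrite -fmorphV; apply: cstS].
Qed.

(** The classification of the valuations of Fq(x). If x is in S, a polynomial of least
    degree among the non-units divides all the non-units; otherwise 1/x is a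
    uniformizer, since f(x) / x^deg(f) is a unit plus a multiple of 1/x. *)
Lemma uniformizer_of_rational_functions : exists pi,
  [/\ pi != 0, vmax S (ratl F pi)
    & forall h, h != 0 -> exists k : int, vunit S (ratl F h * ratl F pi ^ k)].
Proof.
suff [pi [pi0 mpi upi]] : exists pi, [/\ pi != 0, vmax S (ratl F pi)
    & forall f : {poly Fq}, f != 0 ->
      exists k : int, vunit S (pol F f * ratl F pi ^ k)].
  have w0 : ratl F pi != 0 by rewrite ratl_eq0.
  exists pi; split=> // h h0; have [f [g [g0 hE]]] := ratlP F h.
  have f0 : f != 0 by apply: contraNneq h0 => f0; rewrite -(ratl_eq0 F h) hE f0 rmorph0 mul0r.
  have [k uk] := upi f f0; have [l ul] := upi g g0.
  exists (k - l); have := vunitM ringS uk (vunitV ul).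
  rewrite hE (expfzDr _ _ w0).
  congr (vunit S _); rewrite invfM -invr_expz; field.
  by rewrite pol_eq0 g0 (expfz_neq0 _ w0).
have [Sx|nSx] := pselect (S (pol F 'X)).
  have Spol f : S (pol F f).
    rewrite polE horner_coef; apply: subring_sum => // i _.
    by rewrite coef_map; apply: subringM; [ | apply: cstS | apply: subringX].
  have [f0 [f00 nu0]] : exists f, f != 0 /\ ~ vunit S (pol F f).
    apply: contrapT => nf; have [h nSh] := rational_pole; apply: nSh.
    have [f [g [g0 ->]]] := ratlP F h.
    apply: (subringM ringS); first exact: Spol.
    suff [] : vunit S (pol F g) by [].
    by apply: contrapT => nu; apply: nf; exists g.
  have [f [f1 nuf min]] : exists f, [/\ f != 0, ~ vunit S (pol F f) &
      forall g, g != 0 -> ~ vunit S (pol F g) -> (size f <= size g)%N].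
    pose Q n := `[< exists f : {poly Fq}, [/\ f != 0, ~ vunit S (pol F f) & size f = n] >].
    have exQ : exists n, Q n by exists (size f0); apply/asboolP; exists f0.
    case: (ex_minnP exQ) => n /asboolP[f [f1 nuf sf]] min.
    exists f; split=> // g g0 nug; rewrite sf; apply: min; apply/asboolP.
    by exists g.
  exists (tofrac f); split; rewrite ?tofrac_eq0 //.
    by split; [apply: Spol | apply: nuf].
  move=> g; have [n] := ubnP (size g); elim: n g => // n IHn g sg g0.
  have [u|nu] := pselect (vunit S (pol F g)).
    by exists 0; rewrite expr0z mulr1.
  have r0 : g %% f = 0.
    apply: contrapT => /eqP r0; have := ltn_modp g f; rewrite f1 ltnNge min //.
    have -> : g %% f = g - (g %/ f) * f by rewrite {2}(divp_eq g f) addrAC subrr add0r.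
    move=> u; apply: nu; rewrite -(subrK (g %/ f * f) g) rmorphD.
    have m : vmax S (pol F (g %/ f * f)).
      rewrite rmorphM; apply: (vmaxM ringS); first exact: Spol.
      by split; [apply: Spol | apply: nuf].
    exact: vunitD.
  have gE : g = g %/ f * f by rewrite {1}(divp_eq g f) r0 addr0.
  have q0 : g %/ f != 0 by apply: contraNneq g0 => q0; rewrite gE q0 mul0r.
  have sf : (1 < size f)%N.
    rewrite ltn_neqAle eq_sym lt0n size_poly_eq0 f1 andbT; apply/eqP => /eqP/size_poly1P [c c0 fc].
    by apply: nuf; rewrite fc; apply: (cst_vunit c0).
  have [|k uk] := IHn (g %/ f) _ q0.
    have -> : size (g %/ f) = (size g - (size f).-1)%N := size_divp g f1.
    have : size g != 0%N by rewrite size_poly_eq0.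
    by move: sg sf; lia.
  exists (k - 1); move: uk; rewrite {2}gE rmorphM expfzDr ?ratl_eq0 ?tofrac_eq0 //.
  rewrite -/(pol F f) => uk.
  suff -> : pol F (g %/ f) * pol F f * (pol F f ^ k * pol F f ^ (-1)) =
    pol F (g %/ f) * pol F f ^ k by [].
  by rewrite exprN1; field; rewrite pol_eq0.
have x0 : pol F 'X != 0 by rewrite pol_eq0 polyX_eq0.
have Sx' : S (pol F 'X)^-1 by case: (valS (pol F 'X)).
have mx : vmax S (pol F 'X)^-1 by split=> //; move/vunitV; rewrite invrK => -[_ /nSx].
exists (tofrac 'X)^-1; split.
- by rewrite invr_eq0 tofrac_eq0 polyX_eq0.
- by rewrite fmorphV.
move=> f f0; exists (size f).-1; rewrite fmorphV.
have [n sf] : exists n, size f = n.+1.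
  by exists (size f).-1; rewrite prednK // lt0n size_poly_eq0.
rewrite sf polE horner_coef size_map_poly sf big_ord_recr /= mulrDl -mulrA -/(pol F 'X).
rewrite -!exprnP addrC; apply: vunitD => //.
  rewrite coef_map /= expf_mulV // subnn expr0 mulr1.
  by apply: cst_vunit; have := lead_coef_eq0 f; rewrite /lead_coef sf /= => ->.
rewrite mulr_suml; apply: vmax_sum => // i _.
rewrite -mulrA expf_mulV //; last exact: ltnW.
have -> : (n - i = (n - i.+1).+1)%N by rewrite -subSn.
rewrite exprSr mulrA; apply: vmaxM => //; apply: (subringM ringS); last exact: subringX.
by rewrite coef_map; apply: cstS.
Qed.

End PlaceOfValuationRing.

(** * Discreteness and the existence of places *)

Section Discreteness.

Variables (Fq : finFieldType) (F : fieldExtType {fraction {poly Fq}}).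
Variable (S : set F).
Hypotheses (ringS : is_subring S) (valS : forall z, S z \/ S z^-1).
Hypotheses (cstS : forall c, S (cst F c)) (properS : exists z, ~ S z).

Variable (w : F).
Hypotheses (w0 : w != 0) (mw : vmax S w).
Hypothesis uniform : forall h, h != 0 -> exists k : int, vunit S (ratl F h * w ^ k).

Let rational_value (z : F) := exists k : int, vunit S (z * w ^ k).

(** The value group of F has finite index over that of Fq(x): the minimal polynomial of
    z is a vanishing sum of terms q_i z^i, and these would have distinct values if no
    z^j with 0 < j <= [F : Fq(x)] had the value of a rational function. *)
Lemma power_of_rational_value (z : F) : z != 0 ->
  exists2 j : nat, (0 < j <= \dim {:F})%N & rational_value (z ^+ j).
Proof.
move=> z0; apply: contrapT => nz.
have [p [mon_p sp /rootP pz]] := minimal_polynomial z.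
suff H : forall q : {poly {fraction {poly Fq}}}, q != 0 ->
    (size q <= (\dim {:F}).+1)%N -> exists2 i : nat, (i < size q)%N & q`_i != 0 /\
    vunit S ((map_poly (ratl F) q).[z] / (ratl F q`_i * z ^+ i)).
  have [i _ [_ [/eqP []]]] := H p (monic_neq0 mon_p) sp.
  by rewrite pz mul0r.
move=> q; have [m] := ubnP (size q); elim: m q => // m IHm q sq q0 sqF.
have [n sn] : exists n, size q = n.+1.
  by exists (size q).-1; rewrite prednK // lt0n size_poly_eq0.
have lq : q`_n != 0 by have := lead_coef_eq0 q; rewrite /lead_coef sn /= => ->.
have qE : q = take_poly n q + q`_n *: 'X^n.
  apply/polyP => i; rewrite coefD coef_take_poly coefZ coefXn.
  case: ltngtP => [_|lt|->]; rewrite ?mulr0 ?addr0 ?add0r ?mulr1 //.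
  by rewrite nth_default // sn.
have hE : (map_poly (ratl F) q).[z] =
    (map_poly (ratl F) (take_poly n q)).[z] + ratl F q`_n * z ^+ n.
  by rewrite {1}qE rmorphD /= hornerD map_polyZ hornerZ map_polyXn hornerXn.
have top0 : ratl F q`_n * z ^+ n != 0 by rewrite mulf_neq0 ?ratl_eq0 ?lq ?expf_neq0.
have [t0|t0] := eqVneq (take_poly n q) 0.
  exists n; rewrite ?sn //; split=> //.
  by rewrite hE t0 rmorph0 horner0 add0r divff //; apply: vunit1.
have st : (size (take_poly n q) <= n)%N := size_take_poly n q.
have nm : (n < m)%N by rewrite -ltnS -sn.
have nF : (n <= \dim {:F})%N by rewrite -ltnS -sn.
have [||i lti [qi uq]] := IHm (take_poly n q) _ t0.
- exact: leq_ltn_trans st nm.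
- exact: leq_trans st (leqW nF).
have ltin : (i < n)%N := leq_trans lti st.
rewrite coef_take_poly ltin in qi uq.
have low0 : ratl F q`_i * z ^+ i != 0 by rewrite mulf_neq0 ?ratl_eq0 ?qi ?expf_neq0.
set a := (map_poly (ratl F) (take_poly n q)).[z] in hE uq.
have a0 : a != 0 by case: uq; rewrite mulf_eq0 negb_or => /andP[].
have [|ua|ub] := @dominant_term _ _ ringS valS a (ratl F q`_n * z ^+ n) a0 top0.
- move=> uab; apply: nz; exists (n - i)%N.
    by rewrite subn_gt0 ltin (leq_trans (leq_subr _ _) nF).
  have [k uk] := uniform (h := q`_n / q`_i) (mulf_neq0 lq (invr_neq0 qi)).
  exists (- k).
  have zni : z ^+ n = z ^+ (n - i) * z ^+ i by rewrite -exprD subnK // ltnW.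
  have := vunitM ringS (vunitM ringS uq (vunitV uab)) (vunitV uk).
  rewrite fmorph_div /= -invr_expz zni; congr (vunit S _).
  have qi0 : ratl F q`_i != 0 by rewrite ratl_eq0 qi.
  have qn0 : ratl F q`_n != 0 by rewrite ratl_eq0 lq.
  have zi0 : z ^+ i != 0 by rewrite expf_neq0.
  have zni0 : z ^+ (n - i) != 0 by rewrite expf_neq0.
  have wk0 : w ^ k != 0 by rewrite expfz_neq0.
  move: (ratl F q`_i) (ratl F q`_n) (z ^+ i) (z ^+ (n - i)) (w ^ k) qi0 qn0 zi0 zni0 wk0.
  move=> c d e f g c0 d0 e0 f0 g0; field.
  by rewrite c0 d0 e0 f0 g0 a0.
- exists i; first by rewrite sn ltnS ltnW.
  split=> //; rewrite hE; have := vunitM ringS ua uq; congr (vunit S _).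
  by field; rewrite a0 ?ratl_eq0 qi expf_neq0.
- by exists n; rewrite ?sn //; split=> //; rewrite hE.
Qed.

Lemma common_power_of_rational_value : exists2 N : nat, (0 < N)%N &
  forall z : F, exists k : int, z != 0 -> vunit S (z ^+ N / w ^ k).
Proof.
exists (\dim {:F})`!; first exact: fact_gt0.
move=> z; have [->|z0] := eqVneq z 0; first by exists 0.
have [j /andP[j0 jn] [k uk]] := power_of_rational_value z0.
have /dvdnP [m ->] : (j %| (\dim {:F})`!)%N by apply: dvdn_fact; rewrite j0.
exists (- (k * m%:Z)) => _; rewrite invr_expz opprK mulnC exprM.
rewrite -exprz_exp -exprnP -exprMn; exact: vunitX.
Qed.

(** With a common exponent N, the value of z is the exponent of w in z^N. This is a
    homomorphism to the integers; dividing by the generator of its image normalizes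
    it. *)
Lemma place_of_uniformizer : exists P : place F, forall z, S z <-> 0 <= P z.
Proof.
have [N N0 /choice [v vP]] := common_power_of_rational_value.
have wX (k : int) : S (w ^ k) <-> 0 <= k.
  have Sw : S w by case: mw.
  case: k => n; first by split=> // _; apply: subringX.
  split=> //; rewrite NegzE -exprnN => Swn; case: mw => _; case; split=> //.
  by apply: (@vring_root _ _ ringS valS _ n); rewrite exprVn.
have uX (k : int) : vunit S (w ^ k) -> k = 0.
  move=> [_ /wX Sk]; rewrite invr_expz => /wX; lia.
have vE z (k : int) : z != 0 -> vunit S (z ^+ N / w ^ k) -> v z = k.
  move=> z0 uk; suff : k - v z = 0 by lia.
  apply: uX; have := vunitM ringS (vP _ z0) (vunitV uk).
  rewrite expfzDr // -invr_expz; congr (vunit S _).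
  by field; rewrite !expfz_neq0 // expf_neq0.
have vM a b : a != 0 -> b != 0 -> v (a * b) = v a + v b.
  move=> a0 b0; apply: vE; first by rewrite mulf_neq0.
  have := vunitM ringS (vP _ a0) (vP _ b0); rewrite expfzDr // exprMn.
  by congr (vunit S _); field; rewrite !expfz_neq0.
have vS z : z != 0 -> S z <-> 0 <= v z.
  move=> z0; rewrite -wX; have [_ h1 h2] := vP _ z0; split=> Sz.
    have -> : w ^ v z = z ^+ N * (z ^+ N / w ^ v z)^-1.
      by field; rewrite expf_neq0 // expfz_neq0.
    by apply: subringM => //; apply: subringX.
  rewrite -(prednK N0) in h1; apply: (@vring_root _ _ ringS valS _ N.-1).
  rewrite -(mulfVK (expfz_neq0 (v z) w0) (z ^+ N.-1.+1)).
  exact: subringM.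
have v1 : v 1 = 0.
  by apply: vE; rewrite ?oner_eq0 // expr1n expr0z divr1; apply: vunit1.
have vV a : a != 0 -> v a^-1 = - v a.
  move=> a0; have := vM _ _ a0 (invr_neq0 a0); rewrite divff // v1; lia.
have vX a (k : int) : a != 0 -> v (a ^ k) = k * v a.
  move=> a0; have H n : v (a ^+ n) = n%:Z * v a.
    elim: n => [|n IHn]; first by rewrite v1 mul0r.
    by rewrite exprS vM ?expf_neq0 // IHn; lia.
  case: k => n; first exact: H.
  by rewrite NegzE -exprnN vV ?expf_neq0 // H mulNr.
have vw : v w = N.
  by apply: vE => //; rewrite -exprnP divff ?expf_neq0 //; apply: vunit1.
(* the least positive value is taken as the unit *)
pose Q n := `[< (0 < n)%N /\ exists t : F, t != 0 /\ v t = n >].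
have exQ : exists n, Q n by exists N; apply/asboolP; split=> //; exists w.
case: (ex_minnP exQ) => g /asboolP[g0 [t [t0 vt]]] ming.
have gz : g%:Z != 0 by lia.
have gdvd z : z != 0 -> v z = (v z %/ g)%Z * g.
  move=> z0; have rE := divz_eq (v z) g.
  suff r0 : (v z %% g)%Z = 0 by lia.
  have r_ge0 := modz_ge0 (v z) gz; have r_lt := ltz_mod (v z) gz.
  apply: contrapT => nz.
  have : Q `|(v z %% g)%Z|%N.
    apply/asboolP; split; first by lia.
    exists (z / t ^ (v z %/ g)%Z); split.
      by rewrite mulf_neq0 // invr_eq0 expfz_neq0.
    by rewrite vM ?vV ?vX ?invr_eq0 ?expfz_neq0 // vt; lia.
  by move=> /ming; lia.
have [P [P0 PE]] : exists P : F -> int,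
    P 0 = 0 /\ forall z, z != 0 -> v z = P z * g.
  exists (fun z => if z == 0 then 0 else (v z %/ g)%Z); rewrite eqxx; split=> //.
  by move=> z z0; rewrite (negPf z0) -gdvd.
have gpos : 0 < g%:Z by lia.
have PS z : z != 0 -> S z <-> 0 <= P z.
  by move=> z0; rewrite vS // (PE _ z0) pmulr_lge0.
have ginj (a b : int) : a * g = b * g -> a = b by move=> /(mulIf gz).
have PM a b : a != 0 -> b != 0 -> P (a * b) = P a + P b.
  move=> a0 b0; apply: ginj; rewrite mulrDl -!PE // ?mulf_neq0 //; exact: vM.
have PV a : a != 0 -> P a^-1 = - P a.
  by move=> a0; apply: ginj; rewrite mulNr -!PE ?invr_eq0 // vV.
have Pcst c : c != 0 -> P (cst F c) = 0.
  move=> c0; have cF : cst F c != 0 by rewrite cst_eq0.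
  have h1 := proj1 (PS _ cF) (cstS c).
  have : S (cst F c)^-1 by rewrite -fmorphV; apply: cstS.
  by move=> /(proj1 (PS _ (invr_neq0 cF))); rewrite PV //; lia.
have PD a b : a != 0 -> b != 0 -> a + b != 0 -> Num.min (P a) (P b) <= P (a + b).
  move=> a0 b0 ab0.
  wlog le : a b a0 b0 ab0 / P a <= P b.
    move=> W; have /orP[le|le] := le_total (P a) (P b); first exact: W.
    by rewrite minC addrC; apply: W => //; rewrite addrC.
  rewrite min_l //.
  have q0 : (a + b) / a != 0 by rewrite mulf_neq0 ?invr_eq0.
  have : S ((a + b) / a).
    rewrite mulrDl divff //; apply: subringD => //; first exact: subring1.
    by apply/PS; rewrite ?mulf_neq0 ?invr_eq0 // PM ?invr_eq0 // PV //; lia.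
  by move=> /(proj1 (PS _ q0)); rewrite PM ?invr_eq0 // PV //; lia.
have Psurj : exists t : F, t != 0 /\ P t = 1.
  by exists t; split=> //; apply: ginj; rewrite -PE // vt mul1r.
exists (Place P0 Pcst PM PD Psurj) => z /=.
have [->|z0] := eqVneq z 0; last exact: PS.
by rewrite P0; split=> // _; apply: subring0.
Qed.

End Discreteness.

(** The integral closure of R is cut out by the places of F that are regular on R. A
    non-integral z is a pole of one of them: apply the construction above to
    t = 1/z. *)
Lemma integral_of_regular (Fq : finFieldType) (F : fieldExtType {fraction {poly Fq}})
    (R : set F) (z : F) : is_subring R -> (forall c, R (cst F c)) ->
  (forall P : place F, (forall r, R r -> regular_at P r) -> regular_at P z) ->
  integral_in R z.
Proof.
move=> ringR cstR regz; apply: contrapT => nint.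
have z0 : z != 0.
  apply/eqP => z0; apply: nint; exists 'X; rewrite z0 monicX /root hornerX; split=> // i.
  by rewrite coefX; apply: subring_nat.
have [||S [ringS RS nSz valS]] := @valuation_ring_of_pole _ R z^-1 ringR.
- by rewrite invr_eq0.
- move=> q Rq; apply/eqP => qz; apply: nint.
  exists ('X^(size q) - \poly_(i < size q) q`_(size q - i.+1)); split.
  + by rewrite monicE lead_coefDl ?lead_coefXn // size_polyN size_polyXn ltnS size_poly.
  + move=> i; rewrite coefB coefXn coef_poly; apply: subringB => //.
      exact: subring_nat.
    by case: ifP => _ //; apply: subring0.
  rewrite /root hornerD hornerN hornerXn horner_poly subr_eq0; apply/eqP.
  rewrite -[LHS]mul1r -qz horner_coef !mulr_suml.
  rewrite [RHS](reindex_inj rev_ord_inj) /=; apply: eq_bigr => i _.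
  have -> : (size q - (size q - i.+1).+1 = i)%N.
    by have lt : (i < size q)%N := ltn_ord i; rewrite -subSn // subSS subKn // ltnW.
  rewrite -!mulrA [z^-1 ^+ i * _]mulrA -exprSr -[X in _ * (_ * X ^+ size q)]invrK.
  by rewrite expf_mulV ?invr_eq0 // invrK.
rewrite invrK in nSz; have cstS c : S (cst F c) := RS _ (cstR c).
have [h [h0 mh uh]] := uniformizer_of_rational_functions ringS valS cstS (ex_intro _ z nSz).
have w0 : ratl F h != 0 by rewrite ratl_eq0.
have [P PS] := place_of_uniformizer ringS valS cstS w0 mh uh.
by apply/nSz/PS/regz => r /RS /PS.
Qed.

(** * Cubic forms and characteristic polynomials *)

Lemma common_denominator (K : fieldType) (R : set K) (a b c : K) : is_subring R ->
  (forall h, exists2 g, R g /\ g != 0 & R (g * h)) ->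
  exists2 g, R g /\ g != 0 & [/\ R (g * a), R (g * b) & R (g * c)].
Proof.
move=> ringR fracR; have [x [Rx x0] Rxa] := fracR a; have [y [Ry y0] Ryb] := fracR b.
have [z [Rz z0] Rzc] := fracR c.
exists (x * y * z); first by rewrite !mulf_neq0 //; split=> //; do 2 apply: subringM => //.
split.
- have -> : x * y * z * a = y * z * (x * a) by ring.
  by do 2 apply: subringM => //.
- have -> : x * y * z * b = x * z * (y * b) by ring.
  by do 2 apply: subringM => //.
- have -> : x * y * z * c = x * y * (z * c) by ring.
  by do 2 apply: subringM => //.
Qed.

Section CubicForms.

Variables (K : comNzRingType) (A B : K).

(** Trace, second symmetric function and norm of u + v y + w y^2, where y^3 = Ay - B;
    that is, the coefficients of the characteristic polynomial of the matrix of
    multiplication by this element in the basis 1, y, y^2,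
      |   u       v        w     |
      |  -wB    u + wA     v     |
      |  -vB   vA - wB   u + wA  |. *)
Definition tr3 (u w : K) : K := 3%:R * u + 2%:R * A * w.

Definition sm3 (u v w : K) : K :=
  2%:R * (u * (u + w * A) + v * w * B) + ((u + w * A) ^+ 2 - v * (v * A - w * B)).

Definition nm3 (u v w : K) : K :=
  u * ((u + w * A) ^+ 2 - v * (v * A - w * B))
  - v * (v * B * v - w * B * (u + w * A))
  + w * (v * B * (u + w * A) - w * B * (v * A - w * B)).

(** The discriminant of T^3 - s1 T^2 + s2 T - s3. *)
Definition disc3 (s1 s2 s3 : K) : K :=
  s1 ^+ 2 * s2 ^+ 2 - 4%:R * s2 ^+ 3 - 4%:R * s1 ^+ 3 * s3
  + 18%:R * s1 * s2 * s3 - 27%:R * s3 ^+ 2.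

(** The conjugates satisfy z_i - z_j = (y_i - y_j) (v - w y_k) for {i, j, k} = {1, 2, 3},
    so the discriminants of z and y differ by the square of N(v - w y), the
    index of the order generated by z in the order generated by y. *)
Lemma disc3_index_form u v w :
  disc3 (tr3 u w) (sm3 u v w) (nm3 u v w) =
  nm3 v (- w) 0 ^+ 2 * (4%:R * A ^+ 3 - 27%:R * B ^+ 2).
Proof. rewrite /disc3 /tr3 /sm3 /nm3; ring. Qed.

Lemma nm3_shift c u v w :
  nm3 (u + c) v w = c ^+ 3 + tr3 u w * c ^+ 2 + sm3 u v w * c + nm3 u v w.
Proof. rewrite /tr3 /sm3 /nm3; ring. Qed.

(** The norm is multiplicative: the left-hand side holds the coordinates of a
    product. *)
Lemma nm3M u v w u' v' w' :
  nm3 (u * u' - B * (v * w' + w * v'))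
      (u * v' + v * u' + A * (v * w' + w * v') - B * (w * w'))
      (u * w' + v * v' + w * u' + A * (w * w')) =
  nm3 u v w * nm3 u' v' w'.
Proof. rewrite /nm3; ring. Qed.

Lemma nm3Z c u v w : nm3 (c * u) (c * v) (c * w) = c ^+ 3 * nm3 u v w.
Proof. rewrite /nm3; ring. Qed.

Lemma sm3Z c u v w : sm3 (c * u) (c * v) (c * w) = c ^+ 2 * sm3 u v w.
Proof. rewrite /sm3; ring. Qed.

Lemma tr3Z c u w : tr3 (c * u) (c * w) = c * tr3 u w.
Proof. rewrite /tr3; ring. Qed.

Lemma disc3Z c s1 s2 s3 :
  disc3 (c * s1) (c ^+ 2 * s2) (c ^+ 3 * s3) = c ^+ 6 * disc3 s1 s2 s3.
Proof. rewrite /disc3; ring. Qed.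

End CubicForms.

Lemma subring_disc3 (K : fieldType) (R : set K) s1 s2 s3 : is_subring R ->
  R s1 -> R s2 -> R s3 -> R (disc3 s1 s2 s3).
Proof.
move=> ringR R1 R2 R3; have Rn n : R n%:R := subring_nat ringR n.
by rewrite /disc3; repeat first [exact: R1 | exact: R2 | exact: R3 | apply: (Rn)
  | apply: subringX | apply: subringM | apply: subringB | apply: subringD].
Qed.

Section CubicField.

Variables (K F : fieldType) (iota : {rmorphism K -> F}) (A B : K) (y : F).
Hypothesis y_root : y ^+ 3 = iota A * y - iota B.

Definition cub (u v w : K) : F := iota u + iota v * y + iota w * y ^+ 2.

Hypothesis cubP : forall z, exists u v w, z = cub u v w.
Hypothesis cub_inj : forall u v w u' v' w',
  cub u v w = cub u' v' w' -> [/\ u = u', v = v' & w = w'].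

Lemma cubD u v w u' v' w' : cub u v w + cub u' v' w' = cub (u + u') (v + v') (w + w').
Proof. by rewrite /cub !rmorphD; ring. Qed.

Lemma cubZ c u v w : iota c * cub u v w = cub (c * u) (c * v) (c * w).
Proof. by rewrite /cub !rmorphM; ring. Qed.

Lemma cubM u v w u' v' w' : cub u v w * cub u' v' w' =
  cub (u * u' - B * (v * w' + w * v'))
      (u * v' + v * u' + A * (v * w' + w * v') - B * (w * w'))
      (u * w' + v * v' + w * u' + A * (w * w')).
Proof.
rewrite /cub !(rmorphD, rmorphB, rmorphM, rmorphN) /=.
have y4 : y ^+ 4 = iota A * y ^+ 2 - iota B * y by rewrite exprS y_root; ring.
move: (iota u) (iota v) (iota w) (iota u') (iota v') (iota w') => a b c a' b' c'.
transitivity (a * a' + (a * b' + b * a') * y + (a * c' + b * b' + c * a') * y ^+ 2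
  + (b * c' + c * b') * y ^+ 3 + c * c' * y ^+ 4); first by ring.
by rewrite y4 y_root; ring.
Qed.

Lemma cub_root u v w (z := cub u v w) :
  z ^+ 3 - iota (tr3 A u w) * z ^+ 2 + iota (sm3 A B u v w) * z - iota (nm3 A B u v w) = 0.
Proof.
rewrite exprS expr2 /z !cubM /cub /tr3 /sm3 /nm3.
ring.
Qed.

(** The characteristic polynomial of an integral element has its coefficients in R. This
    avoids conjugates: the powers of z lie in a finitely generated R-module, so they have
    a common denominator g; then the powers of N(z) have a common denominator as well,
    and R is completely integrally closed. The other coefficients follow from the norms
    of z + 1 and z - 1, as 2 is invertible. *)
Section BoundedPowers.

Variable R : set K.
Hypotheses (ringR : is_subring R) (two0 : (2%:R : K) != 0) (R2 : R 2%:R^-1).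
Hypothesis fracR : forall h, exists2 g, R g /\ g != 0 & R (g * h).
Hypothesis closedR : forall g h, R g -> g != 0 -> (forall n, R (g * h ^+ n)) -> R h.

Let lattice (g : K) : set F :=
  fun z => exists u v w, [/\ z = cub u v w, R (g * u), R (g * v) & R (g * w)].

Let bounded (z : F) := exists2 g, R g /\ g != 0 & forall n, lattice g (z ^+ n).

Let latticeD g a b : lattice g a -> lattice g b -> lattice g (a + b).
Proof.
move=> [u [v [w [-> Ru Rv Rw]]]] [u' [v' [w' [-> Ru' Rv' Rw']]]].
exists (u + u'), (v + v'), (w + w').
by rewrite cubD !mulrDr; split=> //; apply: subringD.
Qed.

Let latticeZ g c a : R c -> lattice g a -> lattice g (iota c * a).
Proof.
move=> Rc [u [v [w [-> Ru Rv Rw]]]]; exists (c * u), (c * v), (c * w).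
by rewrite cubZ !(mulrCA g); split=> //; apply: subringM.
Qed.

Let lattice0 g : lattice g 0.
Proof.
exists 0, 0, 0; rewrite mulr0 /cub !rmorph0 !mul0r !addr0.
by split=> //; apply: subring0.
Qed.

Let lattice_sum g (I : Type) (r : seq I) (f : I -> F) :
  (forall i, lattice g (f i)) -> lattice g (\sum_(i <- r) f i).
Proof. by move=> Lf; apply: big_ind => // a b; apply: latticeD. Qed.

Let bounded_family (f : nat -> F) n : exists2 g, R g /\ g != 0 &
  forall i, (i < n)%N -> lattice g (f i).
Proof.
elim: n => [|n [g [Rg g0] Lg]].
  by exists 1 => //; split; [apply: subring1 | apply: oner_neq0].
have [u [v [w fE]]] := cubP (f n).
have [d [Rd d0] [Ru Rv Rw]] := common_denominator u v w ringR fracR.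
exists (d * g); first by split; [apply: subringM | rewrite mulf_neq0].
move=> i; rewrite ltnS leq_eqVlt => /orP[/eqP-> {i}|/Lg [u' [v' [w' [-> Ru' Rv' Rw']]]]].
  exists u, v, w; rewrite ![d * g]mulrC -!mulrA.
  by split=> //; apply: subringM.
by exists u', v', w'; rewrite -!mulrA; split=> //; apply: subringM.
Qed.

Let integral_bounded z : integral_in (iota @` R)%classic z -> bounded z.
Proof.
move=> [p [mon_p Rp /rootP pz]].
have [m sp] : exists m, size p = m.+1.
  by exists (size p).-1; rewrite prednK // lt0n size_poly_eq0 monic_neq0.
have [g Rg Lg] := bounded_family (fun i => z ^+ i) m.
exists g => // n; elim/ltn_ind: n => n IHn.
have [/Lg //|le] := ltnP n m.
have zm : z ^+ m = - \sum_(i < m) p`_i * z ^+ i.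
  apply/eqP; rewrite -addr_eq0; move: pz; rewrite horner_coef sp big_ord_recr /= addrC.
  by have := monicP mon_p; rewrite /lead_coef sp /= => ->; rewrite mul1r => ->.
rewrite -(subnK le) exprD zm mulrN -mulNr mulr_sumr; apply: lattice_sum => i.
have [r Rr rE] := Rp i.
have -> : - z ^+ (n - m) * (p`_i * z ^+ i) = iota (- r) * z ^+ (n - m + i).
  by rewrite -rE rmorphN exprD; ring.
apply: latticeZ; first exact: subringN.
by apply: IHn; rewrite -{2}(subnK le) ltn_add2l.
Qed.

Let bounded_shift z c : R c -> bounded z -> bounded (z + iota c).
Proof.
move=> Rc [g Rg Lg]; exists g => // n; rewrite exprDn; apply: lattice_sum => i.
have -> : z ^+ (n - i) * iota c ^+ i *+ 'C(n, i) =
  iota (c ^+ i * 'C(n, i)%:R) * z ^+ (n - i).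
  by rewrite rmorphM rmorphXn rmorph_nat -mulr_natr; ring.
apply: latticeZ => //; apply: subringM => //; first exact: subringX.
exact: subring_nat.
Qed.

Let bounded_norm u v w : bounded (cub u v w) -> R (nm3 A B u v w).
Proof.
move=> [g [Rg g0] Lg]; have [a [Ra a0] RaA] := fracR A; have [b [Rb b0] RbB] := fracR B.
pose h := a * b; have Rh : R h by apply: subringM.
have RhA : R (h * A) by rewrite /h mulrAC [_ * b]mulrC; apply: subringM.
have RhB : R (h * B) by rewrite /h -mulrA; apply: subringM.
apply: (@closedR (h ^+ 2 * g ^+ 3)).
- by apply: subringM => //; apply: subringX.
- by rewrite mulf_neq0 ?expf_neq0 ?mulf_neq0.
move=> n; have [u' [v' [w' [zE Ru Rv Rw]]]] := Lg n.
have -> : nm3 A B u v w ^+ n = nm3 A B u' v' w'.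
  elim: n u' v' w' zE {Ru Rv Rw} => [|n IHn] u' v' w'.
    have -> : cub u v w ^+ 0 = cub 1 0 0 by rewrite /cub rmorph1 rmorph0 !mul0r !addr0.
    by move=> /cub_inj[<- <- <-]; rewrite /nm3; ring.
  have [u1 [v1 [w1 zE]]] := cubP (cub u v w ^+ n).
  by rewrite !exprS zE cubM (IHn _ _ _ zE) -nm3M => /cub_inj[-> -> ->].
rewrite -mulrA -nm3Z; move: (g * u') (g * v') (g * w') Ru Rv Rw => p q r Rp Rq Rr.
have -> : h ^+ 2 * nm3 A B p q r =
  p * ((h * p + r * (h * A)) ^+ 2 - q * (q * (h * A) - r * (h * B)) * h)
  - q * (q * (h * B) * q * h - r * (h * B) * (h * p + r * (h * A)))
  + r * (q * (h * B) * (h * p + r * (h * A)) - r * (h * B) * (q * (h * A) - r * (h * B))).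
  by rewrite /nm3; ring.
by repeat first [exact: Rp | exact: Rq | exact: Rr | exact: Rh | exact: RhA | exact: RhB
  | apply: subringX | apply: subringM | apply: subringB | apply: subringD].
Qed.

Lemma integral_charpoly u v w : integral_in (iota @` R)%classic (cub u v w) ->
  [/\ R (tr3 A u w), R (sm3 A B u v w) & R (nm3 A B u v w)].
Proof.
move=> /integral_bounded zb.
have shift c : R c -> R (nm3 A B (u + c) v w).
  move=> Rc; apply: bounded_norm; have := bounded_shift Rc zb.
  by have -> : cub u v w + iota c = cub (u + c) v w by rewrite /cub rmorphD; ring.
have R1 := subring1 ringR.
have Np := shift 1 R1; have Nm := shift (- 1) (subringN ringR R1).
have N0 := shift 0 (subring0 ringR); rewrite addr0 in N0.
rewrite !nm3_shift in Np Nm; set s1 := tr3 _ _ _ in Np Nm *.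
set s2 := sm3 _ _ _ _ _ in Np Nm *; set s3 := nm3 _ _ _ _ _ in Np Nm N0 *.
have R1' : R s1.
  set f := (X in R X) in Np; set f' := (X in R X) in Nm.
  have -> : s1 = 2%:R^-1 * ((f + f') - (s3 + s3)) by rewrite /f /f'; field.
  by repeat first [exact: R2 | exact: Np | exact: Nm | exact: N0 | apply: subringM
     | apply: subringB | apply: subringD].
split=> //; set f := (X in R X) in Np.
have -> : s2 = f - s3 - s1 - 1 by rewrite /f; ring.
by repeat first [exact: R1 | exact: R1' | exact: Np | exact: N0 | apply: subringB].
Qed.

End BoundedPowers.

End CubicField.

(** * Rational functions and their degree *)

Section RationalFunctions.

Variable k : fieldType.
Implicit Types (f g : {poly k}) (h : {fraction {poly k}}).

Definition polyfrac : set {fraction {poly k}} := fun h => exists f, h = tofrac f.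

Lemma polyfrac_ring : is_subring polyfrac.
Proof.
split; first by exists 1; rewrite tofrac1.
  by move=> a b [f ->] [g ->]; exists (f - g); rewrite tofracB.
by move=> a b [f ->] [g ->]; exists (f * g); rewrite tofracM.
Qed.

Lemma polyfrac_denominator h : exists2 g, polyfrac g /\ g != 0 & polyfrac (g * h).
Proof.
have [f [g [g0 ->]]] := fracP h.
have tg0 : tofrac g != 0 by rewrite tofrac_eq0.
exists (tofrac g); first by split; [exists g | exact: tg0].
by exists f; rewrite mulrC divfK.
Qed.

Lemma coprime_fracP h : exists f g, [/\ g != 0, coprimep f g & h = tofrac f / tofrac g].
Proof.
have [f [g [g0 ->]]] := fracP h.
have c0 : gcdp f g != 0 by rewrite gcdp_eq0 (negPf g0) andbF.
have fE := divpK (dvdp_gcdl f g); have gE := divpK (dvdp_gcdr f g).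
have q0 : g %/ gcdp f g != 0 by apply: contraNneq g0 => g1; rewrite -gE g1 mul0r.
exists (f %/ gcdp f g), (g %/ gcdp f g); split; first exact: q0.
  by apply: coprimep_div_gcd; rewrite (negPf g0) orbT.
apply/eqP; rewrite eqr_div; [|by rewrite tofrac_eq0 g0|by rewrite tofrac_eq0 q0].
rewrite -!tofracM tofrac_eq; apply/eqP.
transitivity (f %/ gcdp f g * gcdp f g * (g %/ gcdp f g)); first by rewrite fE.
by rewrite mulrAC -mulrA gE.
Qed.

(** In lowest terms f/d, bounded denominators of all powers mean that every d^n divides
    one fixed polynomial, so d is constant. *)
Lemma polyfrac_closed h' h : polyfrac h' -> h' != 0 ->
  (forall n, polyfrac (h' * h ^+ n)) -> polyfrac h.
Proof.
move=> [p ->]; rewrite tofrac_eq0 => p0 bh.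
have [f [d [d0 cfd hE]]] := coprime_fracP h.
have dp n : d ^+ n %| p.
  have [r rE] := bh n; rewrite -(Gauss_dvdpl _ (_ : coprimep (d ^+ n) (f ^+ n))).
    have d0' : tofrac d ^+ n != 0 by apply: expf_neq0; rewrite tofrac_eq0.
    apply/dvdpP; exists r; apply/eqP; rewrite -tofrac_eq !tofracM -rE hE !tofracXn.
    by apply/eqP; rewrite expr_div_n -[RHS]mulrA (divfK d0').
  by apply/coprimep_expl/coprimep_expr; rewrite coprimep_sym.
have d1 : size d = 1%N.
  apply: contrapT => /eqP d1; have := dvdp_leq p0 (dp (size p)).
  have d_gt0 : (0 < size d)%N by rewrite lt0n size_poly_eq0.
  have d_gt1 : (0 < (size d).-1)%N by move: d1 d_gt0; case: (size d) => [|[|m]].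
  have := size_exp d (size p); move: (size (d ^+ size p)) => s sE sp.
  have := leq_pmull (size p) d_gt1; rewrite -sE => le.
  have sp0 : (0 < size p)%N by rewrite lt0n size_poly_eq0.
  case: s sE sp le => [|s] /= sE sp le; last by move: (leq_trans sp le); rewrite ltnn.
  by move: le; rewrite leqn0 => /eqP h0; rewrite h0 in sp0.
have /size_poly1P [c c0 dE] : size d == 1%N by rewrite d1.
exists (c^-1 *: f); rewrite hE dE -mul_polyC tofracM mulrC; congr (_ * _).
have cF : tofrac c%:P != 0 :> {fraction {poly k}} by rewrite tofrac_eq0 polyC_eq0.
by apply: (mulfI cF); rewrite divff // -tofracM -polyCM divff // tofrac1.
Qed.

Definition fdeg h : int := xget 0 [set d : int | exists f g,
  [/\ f != 0, g != 0, h = tofrac f / tofrac g & d = (size f)%:Z - (size g)%:Z]]%classic.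

Lemma fdeg_frac f g : f != 0 -> g != 0 ->
  fdeg (tofrac f / tofrac g) = (size f)%:Z - (size g)%:Z.
Proof.
move=> f0 g0; apply: xget_unique; first by exists f, g.
move=> d [f' [g' [f0' g0' E ->]]].
have tg : tofrac g != 0 by rewrite tofrac_eq0.
have tg' : tofrac g' != 0 by rewrite tofrac_eq0.
move/eqP: E; rewrite (eqr_div _ _ tg tg') -!tofracM tofrac_eq.
move=> /eqP/(congr1 (fun p : {poly k} => size p)); rewrite !size_mul //.
have := size_poly_eq0 f; have := size_poly_eq0 g.
have := size_poly_eq0 f'; have := size_poly_eq0 g'.
rewrite (negPf f0) (negPf f0') (negPf g0) (negPf g0').
move: (size f) (size f') (size g) (size g') => a b c d'; lia.
Qed.

Lemma fdeg_tofrac f : f != 0 -> fdeg (tofrac f) = (size f)%:Z - 1.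
Proof.
by move=> f0; have := fdeg_frac f0 (oner_neq0 _); rewrite tofrac1 divr1 size_poly1.
Qed.

Let frac_nz h : h != 0 -> exists f g, [/\ f != 0, g != 0 & h = tofrac f / tofrac g].
Proof.
have [f [g [g0 ->]]] := fracP h => h0; exists f, g; split=> //.
by apply: contraNneq h0 => ->; rewrite tofrac0 mul0r.
Qed.

Lemma fdegM h1 h2 : h1 != 0 -> h2 != 0 -> fdeg (h1 * h2) = fdeg h1 + fdeg h2.
Proof.
move=> /frac_nz[f [g [f0 g0 ->]]] /frac_nz[f' [g' [f0' g0' ->]]].
rewrite mulf_div -!tofracM.
rewrite !fdeg_frac ?mulf_neq0 // !size_mul //.
have := size_poly_eq0 f; have := size_poly_eq0 g.
have := size_poly_eq0 f'; have := size_poly_eq0 g'.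
rewrite (negPf f0) (negPf f0') (negPf g0) (negPf g0').
move: (size f) (size f') (size g) (size g') => a b c d'; lia.
Qed.

Lemma fdeg1 : fdeg 1 = 0.
Proof. by rewrite -tofrac1 fdeg_tofrac ?oner_eq0 // size_poly1 subrr. Qed.

Lemma fdegX h n : h != 0 -> fdeg (h ^+ n) = n%:Z * fdeg h.
Proof.
move=> h0; elim: n => [|n IHn]; first by rewrite expr0 fdeg1 mul0r.
by rewrite exprS fdegM ?expf_neq0 // IHn; lia.
Qed.

Lemma fdegD h1 h2 d : h1 != 0 -> h2 != 0 -> h1 + h2 != 0 ->
  fdeg h1 <= d -> fdeg h2 <= d -> fdeg (h1 + h2) <= d.
Proof.
move=> /frac_nz[f [g [f0 g0 ->]]] /frac_nz[f' [g' [f0' g0' ->]]].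
have tg : tofrac g != 0 by rewrite tofrac_eq0.
have tg' : tofrac g' != 0 by rewrite tofrac_eq0.
rewrite (addf_div _ _ tg tg') -!tofracM -tofracD.
move=> s0; have {s0} s0 : f * g' + f' * g != 0.
  by apply: contraNneq s0 => ->; rewrite tofrac0 mul0r.
rewrite !fdeg_frac ?mulf_neq0 //.
have := size_polyD (f * g') (f' * g); rewrite !size_mul //.
have := size_poly_eq0 f; have := size_poly_eq0 g.
have := size_poly_eq0 f'; have := size_poly_eq0 g'.
rewrite (negPf f0) (negPf f0') (negPf g0) (negPf g0').
move: (size f) (size f') (size g) (size g') (size (f * g' + f' * g)) => a b c d' e; lia.
Qed.

(** The valuation ring of the infinite place of the rational function field. *)
Definition proper_frac : set {fraction {poly k}} := fun h => h = 0 \/ fdeg h <= 0.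

Lemma proper_frac_ring : is_subring proper_frac.
Proof.
have N h : proper_frac h -> proper_frac (- h).
  have [-> _|h0] := eqVneq h 0; first by left; rewrite oppr0.
  move=> [/eqP|hd]; first by rewrite (negPf h0).
  have N1 : fdeg (- 1) = 0.
    by rewrite -tofrac1 -tofracN fdeg_tofrac ?oppr_eq0 ?oner_eq0 // size_polyN size_poly1.
  by right; rewrite -mulN1r fdegM ?oppr_eq0 ?oner_eq0 // N1 add0r.
have AA a b : proper_frac a -> proper_frac b -> proper_frac (a + b).
  have [-> _|a0] := eqVneq a 0; first by rewrite add0r.
  have [->|b0] := eqVneq b 0; first by rewrite addr0.
  move=> [/eqP|da]; first by rewrite (negPf a0).
  move=> [/eqP|db]; first by rewrite (negPf b0).
  have [->|s0] := eqVneq (a + b) 0; first by left.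
  by right; apply: (fdegD a0 b0 s0 da db).
split; first by right; rewrite fdeg1.
  by move=> a b Ra Rb; apply/AA/N.
move=> a b [-> _|da]; first by left; rewrite mul0r.
move=> [->|db]; first by left; rewrite mulr0.
have [->|a0] := eqVneq a 0; first by left; rewrite mul0r.
have [->|b0] := eqVneq b 0; first by left; rewrite mulr0.
by right; rewrite (fdegM a0 b0) -[0]addr0 lerD.
Qed.

Lemma fdegXz (d : int) : fdeg (tofrac 'X ^ d) = d.
Proof.
have x0 : tofrac 'X != 0 :> {fraction {poly k}} by rewrite tofrac_eq0 polyX_eq0.
have dx : fdeg (tofrac 'X) = 1 by rewrite fdeg_tofrac ?polyX_eq0 // size_polyX.
case: d => n; first by rewrite -exprnP (fdegX _ x0) dx mulr1.
have xn0 := expf_neq0 n.+1 x0; have := fdegM xn0 (invr_neq0 xn0).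
rewrite (divff xn0) fdeg1 NegzE -exprnN (fdegX _ x0) dx.
by move: (fdeg _) => d; lia.
Qed.

Lemma proper_frac_denominator h :
  exists2 g, proper_frac g /\ g != 0 & proper_frac (g * h).
Proof.
have [->|h0] := eqVneq h 0.
  exists 1; last by left; rewrite mulr0.
  by split; [right; rewrite fdeg1 | rewrite oner_eq0].
have x0 : tofrac 'X != 0 :> {fraction {poly k}} by rewrite tofrac_eq0 polyX_eq0.
exists (tofrac 'X ^ (- `|fdeg h|%:Z)); first split.
- by right; rewrite fdegXz; move: (fdeg h) => d; lia.
- exact: expfz_neq0.
right; rewrite (fdegM (expfz_neq0 _ x0) h0) fdegXz; move: (fdeg h) => d; lia.
Qed.

Lemma proper_frac_closed h' h : proper_frac h' -> h' != 0 ->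
  (forall n, proper_frac (h' * h ^+ n)) -> proper_frac h.
Proof.
move=> _ g0 bh; have [->|h0] := eqVneq h 0; first by left.
right; have [/eqP|] := bh `|fdeg h'|.+1%N.
  by rewrite mulf_eq0 (negPf g0) expf_eq0 (negPf h0).
rewrite (fdegM g0 (expf_neq0 _ h0)) (fdegX _ h0); move: (fdeg h') (fdeg h) => a b; nia.
Qed.

End RationalFunctions.

(** * Irreducible polynomials and cubic extensions *)

Section PolynomialIrreducible.

Variable k : fieldType.
Implicit Types p q f g : {poly k}.

Lemma irreducible_dvdM p f g : irreducible_poly p -> p %| f * g -> p %| f \/ p %| g.
Proof.
move=> irr; have [pf|npf] := boolP (p %| f); first by left.
by rewrite Gauss_dvdpr ?irreducible_poly_coprime //; right.
Qed.

Lemma irreducible_dvdX p f n : irreducible_poly p -> p %| f ^+ n -> p %| f.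
Proof.
move=> irr; elim: n => [|n IHn]; last by rewrite exprS => /(irreducible_dvdM irr)[].
by rewrite expr0 dvdp1 => /eqP s1; case: irr; rewrite s1.
Qed.

Lemma irreducible_factor g : (1 < size g)%N -> exists2 p, irreducible_poly p & p %| g.
Proof.
move=> sg; pose Q n := `[< exists p, [/\ (1 < size p)%N, p %| g & size p = n] >].
have exQ : exists n, Q n by exists (size g); apply/asboolP; exists g.
case: (ex_minnP exQ) => n /asboolP[p [sp pg spn]] minp.
exists p => //; split=> // q q1 qp; rewrite -dvdp_size_eqp // eqn_leq dvdp_leq //=; last first.
  by rewrite -size_poly_gt0 ltnW.
rewrite spn; apply: minp; apply/asboolP; exists q; split=> //; last exact: dvdp_trans pg.
have : size q != 0%N.
  rewrite size_poly_eq0; apply/eqP => q0; move: qp; rewrite q0 dvd0p => /eqP p0.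
  by move: sp; rewrite p0 size_poly0.
by move: q1; case: (size q) => [|[]].
Qed.

End PolynomialIrreducible.

Section CubicExtension.

Variables (K : fieldType) (F : fieldExtType K) (A B : K) (y : F).
Hypothesis T_irr : irreducible_poly ('X^3 - A%:P * 'X + B%:P).
Hypothesis y_root : y ^+ 3 = in_alg F A * y - in_alg F B.

Let T : {poly K} := 'X^3 - A%:P * 'X + B%:P.

Let T_root : (map_poly (in_alg F) T).[y] = 0.
Proof.
rewrite /T rmorphD rmorphB !rmorphM /= map_polyX !map_polyC /=.
rewrite !(hornerD, hornerN, hornerM, hornerX, hornerC).
have -> : y * (y * y) = y ^+ 3 by rewrite !exprS mulr1.
by rewrite y_root /=; ring.
Qed.

Let T_size : size T = 4%N.
Proof.
rewrite /T -addrA size_polyDl size_polyXn //; apply: leq_ltn_trans (size_polyD _ _) _.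
rewrite gtn_max size_polyN; apply/andP; split; last exact: leq_ltn_trans (size_polyC_leq1 _) _.
by rewrite mul_polyC; apply: leq_ltn_trans (size_scale_leq _ _) _; rewrite size_polyX.
Qed.

Let quad (u v w : K) := u%:P + v *: 'X + w *: 'X^2.

Let quad_eval u v w : (map_poly (in_alg F) (quad u v w)).[y] = cub (in_alg F) y u v w.
Proof.
rewrite /quad !rmorphD /= !map_polyZ map_polyC map_polyX map_polyXn.
by rewrite !hornerD hornerC !hornerZ hornerX hornerXn.
Qed.

Lemma coordinates_exist : <<1%VS; y>>%VS = fullv ->
  forall z, exists u v w, z = cub (in_alg F) y u v w.
Proof.
move=> F_gen z; have : z \in <<1%VS; y>>%VS by rewrite F_gen memvf.
move=> /Fadjoin1_polyP [p ->].
have -> : (map_poly (in_alg F) p).[y] = (map_poly (in_alg F) (p %% T)).[y].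
  by rewrite {1}(divp_eq p T) rmorphD rmorphM /= hornerD hornerM T_root mulr0 add0r.
have sr : (size (p %% T)%R <= 3)%N.
  by rewrite -ltnS -T_size ltn_modp -size_poly_eq0 T_size.
move: (p %% T)%R sr => r sr; exists r`_0, r`_1, r`_2; rewrite -quad_eval.
congr (_.[_]); congr (map_poly _ _); apply/polyP => i.
rewrite /quad !coefD coefC !coefZ coefX coefXn.
case: i => [|[|[|i]]]; rewrite /= ?mulr0 ?mulr1 ?addr0 ?add0r //.
by rewrite nth_default // (leq_trans sr).
Qed.

Lemma coordinates_unique u v w u' v' w' :
  cub (in_alg F) y u v w = cub (in_alg F) y u' v' w' -> [/\ u = u', v = v' & w = w'].
Proof.
move=> E; have : (map_poly (in_alg F) (quad (u - u') (v - v') (w - w'))).[y] = 0.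
  apply/eqP; rewrite quad_eval; move/eqP: E; rewrite -subr_eq0 => /eqP <-; apply/eqP.
  by rewrite /cub !rmorphB; ring.
set r := quad _ _ _ => ry.
have sr : (size r <= 3)%N.
  apply/leq_sizeP => j j3; rewrite /r /quad !coefD coefC !coefZ coefX coefXn.
  by case: j j3 => [|[|[|j]]] //= _; rewrite !mulr0 !addr0.
have r0 : r = 0.
  apply: contrapT => /eqP r0.
  have nTr : ~~ (T %| r).
    by apply/negP => /(dvdp_leq r0); rewrite T_size leqNgt ltnS sr.
  have /Bezout_eq1_coprimepP [[a b] /= /(congr1 (fun p => (map_poly (in_alg F) p).[y]))] :=
    etrans (irreducible_poly_coprime r T_irr) nTr.
  rewrite rmorphD !rmorphM rmorph1 /= hornerD !hornerM T_root ry !mulr0 addr0 hornerC.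
  by move/eqP; rewrite eq_sym oner_eq0.
have c i : r`_i = 0 by rewrite r0 coef0.
have := (c 0%N, c 1%N, c 2%N); rewrite /r /quad !coefD !coefC !coefZ !coefX !coefXn /=.
rewrite !mulr0 !mulr1 !addr0 !add0r => -[[/subr0_eq -> /subr0_eq ->] /subr0_eq ->].
by [].
Qed.

End CubicExtension.

(** * The maximal order of a cubic field *)

Section MaximalOrder.

Variables (k : fieldType) (A B : {poly k}).
Hypotheses (two0 : (2%:R : k) != 0) (three0 : (3%:R : k) != 0).
Implicit Types p u v w : {poly k}.

Let D := 4%:R * A ^+ 3 - 27%:R * B ^+ 2.

Lemma dvdp_natl n p u : (n%:R : k) != 0 -> (p %| n%:R * u) = (p %| u).
Proof. by move=> n0; rewrite -polyC_natr mul_polyC dvdpZr. Qed.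

Lemma square_part p N n : irreducible_poly p -> ~~ (p ^+ 2 %| D) ->
  p ^+ (n + n) %| N ^+ 2 * D -> p ^+ n %| N.
Proof.
move=> irr nD; have p0 : p != 0 by case: irr => sp _; rewrite -size_poly_gt0 ltnW.
elim: n N => [|n IHn] N; first by move=> _; rewrite expr0 dvd1p.
rewrite addSn addnS => h.
have /dvdpP [N' NE] : p %| N.
  apply: contraNT nD => npN.
  have h2 : p ^+ 2 %| N ^+ 2 * D.
    by apply: dvdp_trans h; rewrite -[(n + n).+2]addn2 exprD dvdp_mull.
  have /coprimep_expl cop : coprimep p (N ^+ 2).
    rewrite irreducible_poly_coprime //; apply: contraNN npN; exact: irreducible_dvdX.
  by rewrite -(Gauss_dvdpr _ (cop 2%N)).
rewrite NE exprSr dvdp_mul2r // IHn //.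
move: h; rewrite NE exprMn mulrAC -[(n + n).+2]addn2 exprD dvdp_mul2r //.
exact: expf_neq0.
Qed.

(** If z = (u + v y + w y^2) / p is integral, then so are z + y and z - y, and the
    discriminants of all three make p^3 divide the form h(v) = v^3 - A v w^2 + B w^3 at
    v, v + p and v - p. Differences then yield p | h''(v) = 6v and p | h'(v). If p did not
    divide w, it would divide A and B, and p^2 would divide D. *)
Lemma index_divisibility p v w : irreducible_poly p -> ~~ (p ^+ 2 %| D) ->
  p ^+ 3 %| nm3 A B v (- w) 0 -> p ^+ 3 %| nm3 A B (v + p) (- w) 0 ->
  p ^+ 3 %| nm3 A B (v - p) (- w) 0 -> p %| v /\ p %| w.
Proof.
move=> irr nD; have p0 : p != 0 by case: irr => sp _; rewrite -size_poly_gt0 ltnW.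
set f := (X in _ %| X -> _) => h0; set g := (X in _ %| X -> _) => hp.
set h := (X in _ %| X -> _) => hm.
have pv : p %| v.
  have : p ^+ 3 %| p ^+ 2 * (2%:R * (3%:R * v)).
    have -> : p ^+ 2 * (2%:R * (3%:R * v)) = g + h - 2%:R * f.
      by rewrite /f /g /h /nm3; ring.
    by apply: dvdp_sub; [apply: dvdp_add | apply: dvdp_mull].
  by rewrite [p ^+ 3]exprSr dvdp_mul2l ?expf_neq0 // !dvdp_natl.
have pd : p %| A * w ^+ 2.
  have : p ^+ 3 %| p * (2%:R * (3%:R * v ^+ 2 - A * w ^+ 2 + p ^+ 2)).
    have -> : p * (2%:R * (3%:R * v ^+ 2 - A * w ^+ 2 + p ^+ 2)) = g - h.
      by rewrite /g /h /nm3; ring.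
    exact: dvdp_sub.
  rewrite exprS dvdp_mul2l // dvdp_natl // => /(dvdp_trans (dvdp_mulr p (dvdpp p))).
  move=> pe; have -> : A * w ^+ 2 = (3%:R * v ^+ 2 + p ^+ 2)
      - (3%:R * v ^+ 2 - A * w ^+ 2 + p ^+ 2) by ring.
  apply: dvdp_sub => //; apply: dvdp_add; last by rewrite exprS dvdp_mulr.
  by rewrite dvdp_mull // exprS dvdp_mulr.
split=> //; apply: contraT => npw.
have pw n : p %| w ^+ n -> p %| w by apply: irreducible_dvdX.
have pA : p %| A by case: (irreducible_dvdM irr pd) => // /pw; rewrite (negPf npw).
have : p %| B * w ^+ 3.
  have -> : B * w ^+ 3 = f - v * (v ^+ 2 - w ^+ 2 * A) by rewrite /f /nm3; ring.
  apply: dvdp_sub; last exact: dvdp_mulr.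
  by apply: dvdp_trans h0; rewrite exprS dvdp_mulr.
case/(irreducible_dvdM irr) => [pB|/pw]; last by rewrite (negPf npw).
case/negP: nD; rewrite /D; apply: dvdp_sub.
  by rewrite dvdp_mull // [A ^+ 3]exprSr dvdp_mulr // dvdp_exp2r.
by rewrite dvdp_mull // dvdp_exp2r.
Qed.

(** For p totally ramified: the norm of u + v y + w y^2 is u^3 mod p; once u = 0, it is
    B times a form congruent to - v^3 mod p; once v = 0 too, it is B^2 w^3. *)
Lemma Eisenstein_divisibility p u v w : irreducible_poly p ->
  p %| A -> p %| B -> ~~ (p ^+ 2 %| B) ->
  [/\ p ^+ 3 %| nm3 A B u v w -> p %| u,
      p ^+ 3 %| nm3 A B 0 v w -> p %| v
    & p ^+ 3 %| nm3 A B 0 0 w -> p %| w].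
Proof.
move=> irr /dvdpP [A' AE] /dvdpP [B' BE].
have p0 : p != 0 by case: irr => sp _; rewrite -size_poly_gt0 ltnW.
rewrite BE [p ^+ 2]expr2 dvdp_mul2r // AE => nB'.
have drop3 n f : p ^+ n.+1 %| f -> p %| f by apply: dvdp_trans; rewrite exprS dvdp_mulr.
have p3 : p ^+ 3 = p ^+ 2 * p by rewrite exprSr.
have cancel n f : p ^+ n.+2 %| p * (B' * f) -> p %| f.
  rewrite exprS dvdp_mul2l // => /drop3 /(irreducible_dvdM irr)[]//.
  by rewrite (negPf nB').
split.
- move=> /drop3 h; apply: (irreducible_dvdX (n := 3) irr).
  set f := nm3 _ _ _ _ _ in h.
  have -> : u ^+ 3 = f - p * (u * (2%:R * u * w * A' + w ^+ 2 * p * A' ^+ 2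
      - v * (v * A' - w * B')) - v * (v * B' * v - w * B' * (u + w * (A' * p)))
      + w * (v * B' * (u + w * (A' * p)) - w * B' * p * (v * A' - w * B'))).
    by rewrite /f /nm3; ring.
  by apply: dvdp_sub => //; apply: dvdp_mulr.
- move=> h; apply: (irreducible_dvdX (n := 3) irr).
  have {h} : p %| - v ^+ 3 + p * (v * w ^+ 2 * A' + w ^+ 3 * B').
    apply: (cancel 1%N); set f := (X in _ %| X); suff -> : f = nm3 (A' * p) (B' * p) 0 v w by [].
    by rewrite /f /nm3; ring.
  move=> h; have -> : v ^+ 3 = p * (v * w ^+ 2 * A' + w ^+ 3 * B')
    - (- v ^+ 3 + p * (v * w ^+ 2 * A' + w ^+ 3 * B')) by ring.
  by apply: dvdp_sub => //; apply: dvdp_mulr.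
- move=> h; apply: (irreducible_dvdX (n := 3) irr).
  have : p ^+ 3 %| p ^+ 2 * (B' * (B' * w ^+ 3)).
    set f := (X in _ %| X); suff -> : f = nm3 (A' * p) (B' * p) 0 0 w by [].
    by rewrite /f /nm3; ring.
  rewrite p3 dvdp_mul2l ?expf_neq0 // => /(irreducible_dvdM irr)[|/(irreducible_dvdM irr)[]//];
    by rewrite (negPf nB').
Qed.

(** The integral elements enter only through their coordinates: they form a module over
    the polynomials that contains 1 and y, and their characteristic polynomials have
    polynomial coefficients. *)
Variable Int : {fraction {poly k}} -> {fraction {poly k}} -> {fraction {poly k}} -> Prop.
Hypothesis IntD : forall a b c a' b' c', Int a b c -> Int a' b' c' ->
  Int (a + a') (b + b') (c + c').
Hypothesis IntZ : forall f a b c, Int a b c ->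
  Int (tofrac f * a) (tofrac f * b) (tofrac f * c).
Hypotheses (Int1 : Int 1 0 0) (Inty : Int 0 1 0).
Hypothesis Int_charpoly : forall a b c, Int a b c ->
  [/\ polyfrac (tr3 (tofrac A) a c), polyfrac (sm3 (tofrac A) (tofrac B) a b c)
    & polyfrac (nm3 (tofrac A) (tofrac B) a b c)].

Let tofrac_nm3 u v w :
  nm3 (tofrac A) (tofrac B) (tofrac u) (tofrac v) (tofrac w) = tofrac (nm3 A B u v w).
Proof. by rewrite /nm3 !(tofracD, tofracB, tofracM, tofracN, tofracXn). Qed.

Let polyfrac_dvd p f : p != 0 -> polyfrac ((tofrac p)^-1 * tofrac f) -> p %| f.
Proof.
move=> p0 [r rE]; have tp : tofrac p != 0 by rewrite tofrac_eq0.
apply/dvdpP; exists r; apply/eqP; rewrite -tofrac_eq tofracM -rE mulrAC mulVf //.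
by rewrite mul1r.
Qed.

Let norm_dvd p u v w (q := (tofrac p)^-1) : p != 0 ->
  Int (q * tofrac u) (q * tofrac v) (q * tofrac w) -> p ^+ 3 %| nm3 A B u v w.
Proof.
move=> p0 /Int_charpoly[_ _]; rewrite nm3Z tofrac_nm3 /q exprVn -tofracXn.
by apply: polyfrac_dvd; apply: expf_neq0.
Qed.

Let disc_dvd p u v w (q := (tofrac p)^-1) : p != 0 ->
  Int (q * tofrac u) (q * tofrac v) (q * tofrac w) ->
  p ^+ 6 %| nm3 A B v (- w) 0 ^+ 2 * D.
Proof.
move=> p0 /Int_charpoly[R1 R2 R3]; set s1 := tr3 _ _ _ in R1; set s2 := sm3 _ _ _ _ _ in R2.
set s3 := nm3 _ _ _ _ _ in R3.
have := subring_disc3 (polyfrac_ring k) R1 R2 R3.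
rewrite /s1 /s2 /s3 disc3_index_form -mulrN -(mulr0 q) nm3Z -tofracN -tofrac0 tofrac_nm3.
rewrite exprMn -exprM -mulrA; set d := (X in _ * (_ * X)).
have -> : d = tofrac D.
  by rewrite /d /D tofracB (tofracM 4%:R) (tofracM 27%:R) !tofracXn !rmorph_nat.
by rewrite -tofracXn -tofracM /q exprVn -tofracXn; apply: polyfrac_dvd; apply: expf_neq0.
Qed.

Lemma integral_coordinates_local p u v w (q := (tofrac p)^-1) : irreducible_poly p ->
  ~~ (p ^+ 2 %| D) \/ [/\ p %| A, p %| B & ~~ (p ^+ 2 %| B)] ->
  Int (q * tofrac u) (q * tofrac v) (q * tofrac w) -> [/\ p %| u, p %| v & p %| w].
Proof.
move=> irr cond I.
have p0 : p != 0 by case: irr => sp _; rewrite -size_poly_gt0 ltnW.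
have tp : tofrac p != 0 by rewrite tofrac_eq0.
case: cond => [nD|[pA pB nB]].
  have shift c : p ^+ 3 %| nm3 A B (v + c * p) (- w) 0.
    apply: (square_part irr nD); apply: (disc_dvd (u := u) p0).
    have := IntD I (IntZ c Inty); rewrite mulr0 !addr0 mulr1.
    by rewrite tofracD tofracM mulrDr [_^-1 * (_ * _)]mulrCA mulVf // mulr1.
  have := index_divisibility (v := v) (w := w) irr nD.
  have := (shift 0, shift 1, shift (-1)); rewrite mul0r addr0 mul1r mulN1r.
  move=> [[h0 h1] h2] /(_ h0 h1 h2) [pv pw]; split=> //.
  have [R1 _ _] := Int_charpoly I.
  have : p %| 3%:R * u + 2%:R * A * w.
    apply: polyfrac_dvd => //; move: R1; rewrite tr3Z /tr3 tofracD !tofracM.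
    by rewrite !rmorph_nat.
  by rewrite dvdp_addl; [rewrite dvdp_natl | apply: dvdp_mull].
have mulq f : q * tofrac (f * p) = tofrac f.
  by rewrite /q tofracM mulrCA mulVf // mulr1.
have q0 : q * tofrac 0 = 0 by rewrite tofrac0 mulr0.
have [hu hv hw] := Eisenstein_divisibility u v w irr pA pB nB.
have /dvdpP [u' uE] : p %| u := hu (norm_dvd p0 I).
have I2 : Int (q * tofrac 0) (q * tofrac v) (q * tofrac w).
  have := IntD I (IntZ (- u') Int1).
  by rewrite uE mulq !mulr0 !addr0 mulr1 tofracN subrr ?q0.
have /dvdpP [v' vE] : p %| v := hv (norm_dvd p0 I2).
have I3 : Int (q * tofrac 0) (q * tofrac 0) (q * tofrac w).
  have := IntD I2 (IntZ (- v') Inty).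
  by rewrite vE mulq !mulr0 !addr0 mulr1 tofracN subrr ?q0.
by rewrite uE vE !dvdp_mull // hw // (norm_dvd p0 I3).
Qed.

Hypothesis local_cond : forall p, irreducible_poly p ->
  ~~ (p ^+ 2 %| D) \/ [/\ p %| A, p %| B & ~~ (p ^+ 2 %| B)].

(** A common denominator of the coordinates is stripped of its irreducible factors one
    by one. *)
Lemma integral_coordinates a b c : Int a b c -> [/\ polyfrac a, polyfrac b & polyfrac c].
Proof.
move=> I; have [_ [[g ->] tg0] [Ra Rb Rc]] :=
  common_denominator a b c (polyfrac_ring k) (@polyfrac_denominator k).
have g0 : g != 0 by rewrite -tofrac_eq0.
have [n] := ubnP (size g); elim: n g g0 {tg0} Ra Rb Rc => // n IHn g g0 [u uE] [v vE] [w wE] sg.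
have tg : tofrac g != 0 by rewrite tofrac_eq0.
have [s1|s1] := leqP (size g) 1.
  have /size_poly1P [e e0 gE] : size g == 1%N by rewrite eqn_leq s1 size_poly_gt0.
  have inv x f : tofrac g * x = tofrac f -> polyfrac x.
    move=> E; exists (e^-1 *: f); apply: (mulfI tg); rewrite E gE -tofracM.
    by rewrite mul_polyC scalerA divff // scale1r.
  by split; apply: inv; [apply: uE | apply: vE | apply: wE].
have [p irr /dvdpP [g' gE]] := irreducible_factor s1.
have p0 : p != 0 by case: irr => sp _; rewrite -size_poly_gt0 ltnW.
have tp : tofrac p != 0 by rewrite tofrac_eq0.
have g'0 : g' != 0 by apply: contraNneq g0 => g'0; rewrite gE g'0 mul0r.
have coord x f : tofrac g * x = tofrac f -> tofrac g' * x = (tofrac p)^-1 * tofrac f.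
  by move=> <-; rewrite gE tofracM [_ * tofrac p]mulrC -mulrA (mulKf tp).
have I' := IntZ g' I; rewrite (coord _ _ uE) (coord _ _ vE) (coord _ _ wE) in I'.
have [pu pv pw] := integral_coordinates_local irr (local_cond irr) I'.
have polyfracV f : p %| f -> polyfrac ((tofrac p)^-1 * tofrac f).
  by move=> /dvdpP [r ->]; exists r; rewrite tofracM mulrCA mulVf // mulr1.
apply: (IHn g' g'0).
- by rewrite (coord _ _ uE); apply: polyfracV.
- by rewrite (coord _ _ vE); apply: polyfracV.
- by rewrite (coord _ _ wE); apply: polyfracV.
- have : size g = (size g' + size p).-1 by rewrite gE size_mul.
  have [sp _] := irr; have := size_poly_gt0 g'; rewrite g'0; move: sg sp.
  by move: (size g) (size g') (size p) => i j l; clear; lia.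
Qed.

End MaximalOrder.

(** * Places of a function field *)

Section Places.

Variables (Fq : finFieldType) (F : fieldExtType {fraction {poly Fq}}).
Implicit Types (P : place F) (z a b c d : F) (f g : {poly Fq}) (h : {fraction {poly Fq}}).

Lemma place1 P : P 1 = 0.
Proof.
have h : P 1 = P 1 + P 1 by rewrite -{1}(mulr1 1) pvalM ?oner_neq0.
by apply: (addrI (P 1)); rewrite -h addr0.
Qed.

Lemma placeV P z : z != 0 -> P z^-1 = - P z.
Proof.
by move=> z0; have := pvalM P z0 (invr_neq0 z0); rewrite divff // place1; lia.
Qed.

Lemma placeX P z n : z != 0 -> P (z ^+ n) = n%:Z * P z.
Proof.
move=> z0; elim: n => [|n IHn]; first by rewrite expr0 place1 mul0r.
by rewrite exprS pvalM ?expf_neq0 // IHn; lia.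
Qed.

Lemma placeXz P z (k : int) : z != 0 -> P (z ^ k) = k * P z.
Proof.
move=> z0; case: k => n; first exact: placeX.
by rewrite NegzE -exprnN placeV ?expf_neq0 // placeX // mulNr.
Qed.

Lemma placeN P z : P (- z) = P z.
Proof.
have [->|z0] := eqVneq z 0; first by rewrite oppr0.
have N0 : (-1 : F) != 0 by rewrite oppr_eq0 oner_eq0.
rewrite -mulN1r pvalM //; have := pvalM P N0 N0; rewrite mulrNN mulr1 place1; lia.
Qed.

(** Values at least m, where 0 has value +oo in spite of P 0 = 0. *)
Definition value_ge P (m : int) z : Prop := z = 0 \/ m <= P z.

Lemma value_geD P m a b : value_ge P m a -> value_ge P m b -> value_ge P m (a + b).
Proof.
move=> [->|ma]; first by rewrite add0r.
move=> [->|mb]; first by rewrite addr0; right.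
have [->|a0] := eqVneq a 0; first by rewrite add0r; right.
have [->|b0] := eqVneq b 0; first by rewrite addr0; right.
have [->|ab0] := eqVneq (a + b) 0; first by left.
by right; have := pvalD P a0 b0 ab0; lia.
Qed.

Lemma value_geN P m a : value_ge P m a -> value_ge P m (- a).
Proof. by move=> [->|ma]; [left; rewrite oppr0 | right; rewrite placeN]. Qed.

Lemma value_geM P m n a b : value_ge P m a -> value_ge P n b -> value_ge P (m + n) (a * b).
Proof.
move=> [->|ma]; first by left; rewrite mul0r.
move=> [->|mb]; first by left; rewrite mulr0.
have [->|a0] := eqVneq a 0; first by left; rewrite mul0r.
have [->|b0] := eqVneq b 0; first by left; rewrite mulr0.
by right; rewrite pvalM //; lia.
Qed.

Lemma value_gt_add P a b : a != 0 -> value_ge P (P a + 1) b ->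
  a + b != 0 /\ P (a + b) = P a.
Proof.
move=> a0 hb; have [b0|b0] := eqVneq b 0; first by rewrite b0 addr0.
have {}hb : P a < P b by case: hb => [/eqP|]; [rewrite (negPf b0) | lia].
have ab0 : a + b != 0.
  rewrite addr_eq0; apply: contraTneq hb => ->; rewrite placeN; lia.
split=> //; have := pvalD P a0 b0 ab0.
have Nb0 : - b != 0 by rewrite oppr_eq0.
by have := pvalD P ab0 Nb0; rewrite addrK placeN => /(_ a0); lia.
Qed.

Lemma four_terms P a b c d : a != 0 -> b != 0 -> c != 0 -> d != 0 -> a + b + c + d = 0 ->
  [\/ P b <= P a, P c <= P a | P d <= P a].
Proof.
move=> a0 b0 c0 d0 s0; apply: contrapT => H.
have : value_ge P (P a + 1) (b + c + d).
  have [lb lc ld] : [/\ P a < P b, P a < P c & P a < P d].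
    by split; rewrite ltNge; apply/negP => le; apply: H; [apply: Or31 | apply: Or32 | apply: Or33].
  by apply: value_geD; first apply: value_geD; right; lia.
by move=> /(value_gt_add a0)[]; rewrite !addrA s0 eqxx.
Qed.

Lemma regular_value P z : regular_at P z <-> value_ge P 0 z.
Proof. by split=> [h|[->|//]]; [right | rewrite /regular_at pval0]. Qed.

Lemma vanishes_value P z : vanishes_at P z <-> value_ge P 1 z.
Proof. by split=> -[->|h]; first [by left | right; lia]. Qed.

Lemma regular_ring P : is_subring (regular_at P).
Proof.
split; first by rewrite /regular_at place1.
  by move=> a b /regular_value ha /regular_value hb; apply/regular_value/value_geD/value_geN.
by move=> a b /regular_value ha /regular_value hb; apply/regular_value/(value_geM ha hb).
Qed.

Lemma regular_valuation P z : regular_at P z \/ regular_at P z^-1.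
Proof.
have [->|z0] := eqVneq z 0; first by left; rewrite /regular_at pval0.
by rewrite /regular_at placeV //; lia.
Qed.

Lemma regular_cst P (c : Fq) : regular_at P (cst F c).
Proof.
have [->|c0] := eqVneq c 0; first by rewrite rmorph0 /regular_at pval0.
by rewrite /regular_at pval_cst.
Qed.

Lemma vanishes_regular P z : vanishes_at P z -> regular_at P z.
Proof. by move=> [->|h]; rewrite /regular_at ?pval0 // ltW. Qed.

Lemma vanishesD P a b : vanishes_at P a -> vanishes_at P b -> vanishes_at P (a + b).
Proof. by move=> /vanishes_value ha /vanishes_value hb; apply/vanishes_value/value_geD. Qed.

Lemma vanishesN P a : vanishes_at P a -> vanishes_at P (- a).
Proof. by move=> /vanishes_value ha; apply/vanishes_value/value_geN. Qed.

Lemma vanishesB P a b : vanishes_at P a -> vanishes_at P b -> vanishes_at P (a - b).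
Proof. by move=> va vb; apply: vanishesD => //; apply: vanishesN. Qed.

Lemma vanishesMl P a b : regular_at P a -> vanishes_at P b -> vanishes_at P (a * b).
Proof.
move=> /regular_value ha /vanishes_value hb; apply/vanishes_value.
by have := value_geM ha hb; rewrite add0r.
Qed.

Lemma vanishesMr P a b : vanishes_at P a -> regular_at P b -> vanishes_at P (a * b).
Proof. by move=> va rb; rewrite mulrC; apply: vanishesMl. Qed.

Lemma unit_add_vanishes P a b : a != 0 -> P a = 0 -> vanishes_at P b ->
  a + b != 0 /\ P (a + b) = 0.
Proof.
move=> a0 Pa /vanishes_value hb.
by have := @value_gt_add P a b a0; rewrite Pa add0r => /(_ hb).
Qed.

Lemma place_pol P f : P (pol F 'X) < 0 -> f != 0 ->
  P (pol F f) = ((size f)%:Z - 1) * P (pol F 'X).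
Proof.
move=> Px; elim/poly_ind: f => [|q c IHq]; first by rewrite eqxx.
have X0 : pol F 'X != 0 by rewrite pol_eq0 polyX_eq0.
have [->|q0 _] := eqVneq q 0.
  rewrite mul0r add0r polyC_eq0 => c0; rewrite size_polyC c0 subrr mul0r.
  exact: (pval_cst P c0).
have pq0 : pol F q != 0 by rewrite pol_eq0.
have qX0 : pol F q * pol F 'X != 0 by rewrite mulf_neq0.
have sz : (size q > 0)%N by rewrite size_poly_gt0.
rewrite size_MXaddC (negPf q0) /= rmorphD rmorphM /= -/(cst F c).
have [|_ ->] := @value_gt_add P _ (cst F c) qX0; last first.
  by rewrite pvalM // IHq // -[(size q).+1]addn1 PoszD; ring.
have [->|c0] := eqVneq c 0; first by left; rewrite rmorph0.
right; rewrite pval_cst // pvalM // IHq //.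
by move: (P _) (size q) Px sz => x n; clear; nia.
Qed.

Lemma place_ratl P h : P (pol F 'X) < 0 -> h != 0 ->
  P (ratl F h) = fdeg h * P (pol F 'X).
Proof.
move=> Px h0; have [f [g [g0 hE]]] := fracP h.
have f0 : f != 0 by apply: contraNneq h0 => f0; rewrite hE f0 tofrac0 mul0r.
have -> : ratl F h = pol F f / pol F g by rewrite hE; apply: fmorph_div.
have pf0 : pol F f != 0 by rewrite pol_eq0.
have pg0 : pol F g != 0 by rewrite pol_eq0.
have dE : fdeg h = (size f)%:Z - (size g)%:Z by rewrite hE; apply: fdeg_frac.
rewrite (pvalM P pf0 (invr_neq0 pg0)) (placeV P pg0) (place_pol Px f0) (place_pol Px g0) dE.
by move: (size f) (size g) (P _) => a b x; ring.
Qed.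

Lemma infinite_placeP P : infinite_place P <-> P (pol F 'X) < 0.
Proof.
have X0 : pol F 'X != 0 by rewrite pol_eq0 polyX_eq0.
split=> [h|Px f g sfg].
  have : vanishes_at P (pol F 'X)^-1.
    have := h 1 'X; rewrite size_poly1 size_polyX => /(_ isT).
    by rewrite tofrac1 div1r fmorphV.
  by case=> [/eqP|]; rewrite ?invr_eq0 ?(negPf X0) // placeV //; lia.
have [->|f0] := eqVneq f 0; first by left; rewrite tofrac0 mul0r rmorph0.
have g0 : g != 0 by rewrite -size_poly_gt0; apply: leq_trans sfg.
have h0 : tofrac f / tofrac g != 0.
  by apply: mulf_neq0; rewrite ?invr_eq0 tofrac_eq0 ?f0 ?g0.
right; rewrite (place_ratl Px h0) (fdeg_frac f0 g0).
by move: (P _) (size f) (size g) Px sfg => x a b; clear; nia.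
Qed.

Lemma finite_place_pol P f : ~ infinite_place P -> regular_at P (pol F f).
Proof.
move=> /infinite_placeP; rewrite ltNge => /negP; rewrite negbK => Px.
rewrite polE horner_coef; apply: (subring_sum (regular_ring P)) => i _.
apply: (subringM (regular_ring P)); last by apply: (subringX (regular_ring P)); apply: Px.
by rewrite coef_map; apply: regular_cst.
Qed.

Lemma Oint_regular P z : Oint z -> ~ infinite_place P -> regular_at P z.
Proof.
move=> [p mon_p pz] fP.
apply: (vring_integral (regular_ring P)); first exact: regular_valuation.
exists (map_poly (pol F) p); split=> //; first exact: monic_map.
by move=> i; rewrite coef_map; apply: finite_place_pol.
Qed.

Lemma Oint_of_regular z :
  (forall P, ~ infinite_place P -> regular_at P z) -> Oint z.
Proof.
move=> regz; pose R : set F := (range (pol F))%classic.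
have ringR : is_subring R.
  split; first by exists 1; rewrite ?rmorph1.
    by move=> _ _ [f _ <-] [g _ <-]; exists (f - g); rewrite ?rmorphB.
  by move=> _ _ [f _ <-] [g _ <-]; exists (f * g); rewrite ?rmorphM.
have [||p [mon_p Rp pz]] := @integral_of_regular _ F R z ringR.
- by move=> c; exists c%:P.
- move=> P regR; apply: regz => /infinite_placeP.
  by have := regR (pol F 'X) (ex_intro2 _ _ 'X I erefl); rewrite /regular_at; lia.
have /choice [c cE] : forall i, exists f, pol F f = p`_i.
  by move=> i; have [f _ <-] := Rp i; exists f.
pose q := \poly_(i < size p) c i.
have qE : map_poly (pol F) q = p.
  apply/polyP => i; rewrite coef_map coef_poly /=; case: ltnP => [_|le]; first exact: cE.
  by rewrite rmorph0 nth_default.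
exists q; last by rewrite qE.
have pol_inj : injective (pol F).
  by move=> f g /eqP; rewrite -subr_eq0 -rmorphB pol_eq0 subr_eq0 => /eqP.
have := monicP mon_p; rewrite -{1}qE lead_coef_map_inj ?rmorph0 //.
by rewrite -(rmorph1 (pol F)) => /pol_inj /monicP.
Qed.

(** A place that is regular on all proper fractions lies above the infinite place:
    otherwise it would be trivial on the rational functions, which [rational_pole]
    forbids. *)
Lemma infinite_integral z :
  (forall P, infinite_place P -> regular_at P z) ->
  integral_in (ratl F @` @proper_frac Fq)%classic z.
Proof.
move=> regz; apply: integral_of_regular.
- have [h1 hB hM] := proper_frac_ring Fq; split; first by exists 1; rewrite ?rmorph1.
    by move=> _ _ [f Rf <-] [g Rg <-]; exists (f - g); rewrite ?rmorphB //; apply: hB.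
  by move=> _ _ [f Rf <-] [g Rg <-]; exists (f * g); rewrite ?rmorphM //; apply: hM.
- move=> c; exists (tofrac c%:P) => //.
  have [->|c0] := eqVneq c 0; first by left; rewrite polyC0 tofrac0.
  by right; rewrite fdeg_tofrac ?polyC_eq0 // size_polyC c0.
move=> P regR; apply: regz; apply/infinite_placeP.
have X0 : pol F 'X != 0 by rewrite pol_eq0 polyX_eq0.
have dX (k : int) : fdeg (tofrac 'X ^ k : {fraction {poly Fq}}) = k := fdegXz Fq k.
have tX0 : tofrac 'X != 0 :> {fraction {poly Fq}} by rewrite tofrac_eq0 polyX_eq0.
have ratlX (k : int) : ratl F (tofrac 'X ^ k) = pol F 'X ^ k by rewrite fmorphXz.
have Pxle : P (pol F 'X) <= 0.
  have : regular_at P (ratl F (tofrac 'X ^ (-1))).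
    by apply: regR; exists (tofrac 'X ^ (-1)) => //; right; rewrite dX.
  by rewrite /regular_at ratlX placeXz //; lia.
suff : P (pol F 'X) != 0 by lia.
apply/eqP => Px.
have [|h nh] := @rational_pole _ F _ (regular_ring P) (regular_valuation P).
  have [t [t0 Pt]] := pval_surj P; exists t^-1.
  by rewrite /regular_at placeV // Pt.
have h0 : h != 0.
  by apply/eqP => h0; apply: nh; rewrite h0 rmorph0; apply: (subring0 (regular_ring P)).
apply: nh; have : regular_at P (ratl F (h * tofrac 'X ^ (- fdeg h))).
  apply: regR; exists (h * tofrac 'X ^ (- fdeg h)) => //; right.
  by rewrite (fdegM h0 (expfz_neq0 _ tX0)) dX subrr.
rewrite rmorphM /= ratlX /regular_at pvalM ?ratl_eq0 ?expfz_neq0 // placeXz // Px.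
by rewrite mulr0 addr0.
Qed.

End Places.

(** * Places centred at a regular point *)

Section ResidueDegree.

Variables (Fq : finFieldType) (F : fieldExtType {fraction {poly Fq}}).
Implicit Types (P : place F).

Lemma place_ext P P' : (forall z, P z = P' z) -> P = P'.
Proof.
case: P P' => [v a b c d e] [v' a' b' c' d' e'] /= /funext vv.
by subst v'; congr Place; apply: Prop_irrelevance.
Qed.

(** Coordinates of residues in the second basis embed Fq^d into Fq^d'. *)
Lemma residue_basis_size_le P d d' (b : 'I_d -> F) (b' : 'I_d' -> F) :
  residue_basis P b -> residue_basis P b' -> (d <= d')%N.
Proof.
move=> [rb hb] [rb' hb'].
have reg (c : {ffun 'I_d -> Fq}) : regular_at P (\sum_(i < d) cst F (c i) * b i).
  apply: (subring_sum (regular_ring P)) => i _.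
  exact: (subringM (regular_ring P) (regular_cst P _) (rb i)).
have /choice [f fP] : forall c : {ffun 'I_d -> Fq}, exists c' : {ffun 'I_d' -> Fq},
    vanishes_at P (\sum_(i < d) cst F (c i) * b i - \sum_(i < d') cst F (c' i) * b' i).
  by move=> c; have [c' [h _]] := hb' _ (reg c); exists c'.
have inj_f : injective f.
  move=> c1 c2 E; have [c [_ uc]] := hb _ (reg c1).
  rewrite -(uc c1); last by rewrite subrr; left.
  apply: uc; have := vanishesB (fP c1) (fP c2); rewrite E.
  by rewrite opprB addrA subrK.
have := leq_card f inj_f; rewrite !card_ffun !card_ord leq_exp2l //.
by apply/card_gt1P; exists 0, 1; rewrite ?inE // eq_sym oner_neq0.
Qed.

Lemma pdeg_residue_basis P d (b : 'I_d -> F) : residue_basis P b -> pdeg P = d.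
Proof.
move=> hb; apply: xget_unique; first by exists b.
move=> d' [b' hb']; apply/eqP; rewrite eqn_leq.
by rewrite (residue_basis_size_le hb hb') (residue_basis_size_le hb' hb).
Qed.

End ResidueDegree.

Section RegularPoint.

Variables (Fq : finFieldType) (F : fieldExtType {fraction {poly Fq}}).
Implicit Types (P : place F) (z : F) (q : {poly Fq}).

Let pi : F := (pol F 'X)^-1.

(** The ring Fq[1/x, theta], the coordinate ring of an affine curve around the points
    at infinity. *)
Inductive generated (theta : F) : F -> Prop :=
  | generated_cst c : generated theta (cst F c)
  | generated_inf : generated theta pi
  | generated_gen : generated theta theta
  | generated_add a b : generated theta a -> generated theta b -> generated theta (a + b)
  | generated_mul a b : generated theta a -> generated theta b -> generated theta (a * b).

Lemma generated_ring theta : is_subring (generated theta).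
Proof.
split; first by have := generated_cst theta 1; rewrite rmorph1.
  move=> a b Ra Rb; apply: generated_add => //; rewrite -mulN1r.
  by apply: generated_mul => //; have := generated_cst theta (-1); rewrite rmorphN rmorph1.
by move=> a b Ra Rb; apply: generated_mul.
Qed.

Let ev theta q := (map_poly (cst F) q).[theta].

Lemma generated_poly theta q : generated theta (ev theta q).
Proof.
rewrite /ev horner_coef; apply: (subring_sum (generated_ring theta)) => i _.
rewrite coef_map; apply: generated_mul; first exact: generated_cst.
by apply: (subringX (generated_ring theta)); apply: generated_gen.
Qed.

Let evD theta q q' : ev theta (q + q') = ev theta q + ev theta q'.
Proof. by rewrite /ev rmorphD hornerD. Qed.
Let evB theta q q' : ev theta (q - q') = ev theta q - ev theta q'.
Proof. by rewrite /ev rmorphB hornerD hornerN. Qed.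
Let evM theta q q' : ev theta (q * q') = ev theta q * ev theta q'.
Proof. by rewrite /ev rmorphM hornerM. Qed.
Let ev1 theta : ev theta 1 = 1. Proof. by rewrite /ev rmorph1 hornerC. Qed.
Let ev0 theta : ev theta 0 = 0. Proof. by rewrite /ev rmorph0 horner0. Qed.

(** The places of Q are centred at the point 1/x = 0, G(theta) = 0 of the curve. The two
    equations say that t generates the maximal ideal of the local ring of this
    point: it divides 1/x and G(theta) up to the unit be. *)
Variables (Q : place F -> Prop) (G : {poly Fq}) (theta t al1 al2 be : F).
Hypothesis G_irr : irreducible_poly G.
Hypothesis fracF : forall z,
  exists r s, [/\ generated theta r, generated theta s, s != 0 & z = r / s].
Hypotheses (gen1 : generated theta al1) (gen2 : generated theta al2)
  (genb : generated theta be).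
Hypotheses (be0 : be != 0) (t0 : t != 0).
Hypothesis eq1 : pi * be = t * al1.
Hypothesis eq2 : (map_poly (cst F) G).[theta] * be = t * al2.
Hypothesis Qpi : forall P, Q P -> vanishes_at P pi.
Hypothesis Qtheta : forall P, Q P -> regular_at P theta.
Hypothesis Qt : forall P, Q P -> vanishes_at P t.
Hypothesis Qbe : forall P, Q P -> P be = 0.

Let evT := ev theta.

Let sG : (1 < size G)%N. Proof. by case: G_irr. Qed.
Let s0G : (size (0%R : {poly Fq}) < size G)%N. Proof. by rewrite size_poly0 ltnW. Qed.
Let G0 : G != 0. Proof. by rewrite -size_poly_gt0 ltnW. Qed.

Let gen_regular P r : Q P -> generated theta r -> regular_at P r.
Proof.
move=> QP; elim=> {r} [c| | |a b _ ha _ hb|a b _ ha _ hb].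
- exact: regular_cst.
- exact/vanishes_regular/Qpi.
- exact: Qtheta.
- exact: (subringD (regular_ring P)).
- exact: (subringM (regular_ring P)).
Qed.

Let QG P : Q P -> vanishes_at P (evT G).
Proof.
move=> QP; have -> : evT G = t * (al2 * be^-1).
  by apply: (mulIf be0); rewrite mulrA (mulfVK be0).
apply: vanishesMr; first exact: Qt.
apply: (subringM (regular_ring P)); first exact: gen_regular.
by rewrite /regular_at placeV // Qbe.
Qed.

Let residue_class (r : F) q :=
  exists s1 s2, [/\ generated theta s1, generated theta s2 & r = evT q + pi * s1 + evT G * s2].

Let gen_residue r : generated theta r ->
  exists2 q : {poly Fq}, (size q < size G)%N & residue_class r q.
Proof.
have g0 : generated theta 0 by apply: (subring0 (generated_ring theta)).
have reduce r0 q : residue_class r0 q ->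
    exists2 q' : {poly Fq}, (size q' < size G)%N & residue_class r0 q'.
  move=> [s1 [s2 [h1 h2 ->]]]; exists (q %% G); first by rewrite ltn_modp.
  exists s1, (s2 + evT (q %/ G)); split=> //.
    by apply: generated_add => //; apply: generated_poly.
  by rewrite {1}(divp_eq q G) /evT evD evM; ring.
elim=> {r} [c| | |a b _ [q1 _ [s1 [s2 [h1 h2 ->]]]] _ [q2 _ [s3 [s4 [h3 h4 ->]]]]
  |a b ga [q1 _ [s1 [s2 [h1 h2 aE]]]] gb [q2 _ [s3 [s4 [h3 h4 bE]]]]].
- apply: (reduce _ c%:P); exists 0, 0; split=> //.
  by rewrite /evT /ev map_polyC hornerC /=; ring.
- apply: (reduce _ 0); exists 1, 0; split=> //; first exact: (subring1 (generated_ring theta)).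
  by rewrite /evT ev0; ring.
- apply: (reduce _ 'X); exists 0, 0; split=> //.
  by rewrite /evT /ev map_polyX hornerX /=; ring.
- apply: (reduce _ (q1 + q2)); exists (s1 + s3), (s2 + s4).
  split; try exact: generated_add.
  by rewrite /evT evD; ring.
- apply: (reduce _ (q1 * q2)); exists (evT q1 * s3 + s1 * b), (evT q1 * s4 + s2 * b).
  have gq : generated theta (evT q1) := generated_poly theta q1.
  split; try by apply: generated_add; apply: generated_mul.
  rewrite /evT evM -/evT.
  transitivity (evT q1 * b + pi * (s1 * b) + evT G * (s2 * b)); first by rewrite aE; ring.
  by rewrite {1}bE; ring.
Qed.

Let gen_residue_vanishes P r q : Q P -> residue_class r q -> vanishes_at P (r - evT q).
Proof.
move=> QP [s1 [s2 [h1 h2 ->]]].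
have -> : evT q + pi * s1 + evT G * s2 - evT q = pi * s1 + evT G * s2 by ring.
apply: vanishesD; apply: vanishesMr; try exact: gen_regular.
  exact: Qpi.
exact: QG.
Qed.

Let bezout q : q != 0 -> (size q < size G)%N -> exists a b, a * q + b * G = 1.
Proof.
move=> q0 sq; have : coprimep q G.
  rewrite coprimep_sym irreducible_poly_coprime //; apply/negP => /(dvdp_leq q0).
  by rewrite leqNgt sq.
by case/Bezout_eq1_coprimepP=> -[a b] /= E; exists a, b.
Qed.

Let residue_unit P q : Q P -> q != 0 -> (size q < size G)%N ->
  evT q != 0 /\ P (evT q) = 0.
Proof.
move=> QP q0 sq; have [a [b /(congr1 evT)]] := bezout q0 sq.
rewrite /evT evD !evM ev1 -/evT => E.
have gq x : regular_at P (evT x) := gen_regular QP (generated_poly theta x).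
have vb : vanishes_at P (evT b * evT G) by apply: vanishesMl => //; apply: QG.
have := unit_add_vanishes (oner_neq0 F) (place1 P) (vanishesN vb).
have -> : 1 - evT b * evT G = evT a * evT q by rewrite -E /evT; ring.
move=> [nz]; move: nz; rewrite mulf_eq0 negb_or => /andP[a0 nq0].
rewrite pvalM // => Es; split=> //.
by have := gq a; have := gq q; rewrite /regular_at; lia.
Qed.

Let gen_unit (u : F) := [/\ generated theta u, u != 0 & forall P, Q P -> P u = 0].

Let gen_unitM u v : gen_unit u -> gen_unit v -> gen_unit (u * v).
Proof.
move=> [gu u0 hu] [gv v0 hv]; split; rewrite ?mulf_neq0 //; first exact: generated_mul.
by move=> P QP; rewrite pvalM // hu // hv.
Qed.

Let gen_unit1 : gen_unit 1.
Proof.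
split; rewrite ?oner_neq0 //; first exact: (subring1 (generated_ring theta)).
by move=> P _; apply: place1.
Qed.

Variable P0 : place F.
Hypothesis QP0 : Q P0.

Let t_gt0 P : Q P -> 0 < P t.
Proof. by move=> /Qt [/eqP|//]; rewrite (negPf t0). Qed.

(** An element with non-zero residue is a unit by Bezout in Fq[T]; any other is divisible
    by t. The process stops because P0 takes finite values. *)
Let gen_factor r : generated theta r -> r != 0 ->
  exists j : nat, exists u v, [/\ gen_unit u, gen_unit v & r = t ^+ j * u / v].
Proof.
have [n] := ubnP `|P0 r|%N; elim: n r => // n IHn r nr gr r0.
have [q sq rq] := gen_residue gr.
have [q0|q0] := eqVneq q 0; last first.
  exists 0%N, r, 1; split=> //; last by rewrite expr0 divr1 mul1r.
  split=> // P QP; have [nz Pq] := residue_unit QP q0 sq.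
  have [_] := unit_add_vanishes nz Pq (gen_residue_vanishes QP rq).
  by rewrite addrC subrK.
have [s1 [s2 [h1 h2 rE]]] := rq.
(* r is in the ideal (1/x, G(theta)), so be * r = t * r' *)
pose r' := al1 * s1 + al2 * s2.
have gr' : generated theta r' by apply: generated_add; apply: generated_mul.
have E : r * be = t * r'.
  rewrite rE q0 /evT ev0 add0r -/evT.
  have eq2' : evT G * be = t * al2 := eq2.
  transitivity (pi * be * s1 + evT G * be * s2); first by ring.
  by rewrite eq1 eq2' /r'; ring.
have r'0 : r' != 0.
  by apply/eqP=> r'0; move/eqP: E; rewrite r'0 mulr0 mulf_eq0 (negPf r0) (negPf be0).
have [|||j [u [v [uu uv r'E]]]] := IHn r' => //.
  have /(congr1 P0) := E; rewrite !pvalM // (Qbe QP0) => EP.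
  have := t_gt0 QP0; have := gen_regular QP0 gr'; rewrite /regular_at.
  by move: (P0 r) (P0 r') (P0 t) EP nr => x x' y; clear; lia.
have ube : gen_unit be by split.
exists j.+1, u, (v * be); split=> //; first exact: gen_unitM.
have v0 : v != 0 by case: uv.
apply: (mulIf be0); rewrite E r'E exprS; field; rewrite v0 be0 //.
Qed.

Let factor z : z != 0 ->
  exists j : int, exists u v, [/\ gen_unit u, gen_unit v & z = t ^ j * u / v].
Proof.
have [r [s [gr gs s0 ->]]] := fracF z => z0.
have r0 : r != 0 by apply: contraNneq z0 => ->; rewrite mul0r.
have [j [u [v [uu uv ->]]]] := gen_factor gr r0.
have [l [u' [v' [uu' uv' ->]]]] := gen_factor gs s0.
exists (j%:Z - l%:Z), (u * v'), (v * u'); split; try exact: gen_unitM.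
rewrite expfzDr // -invr_expz -!exprnP.
have [[_ u0 _] [_ v0 _]] := (uu, uv); have [[_ u'0 _] [_ v'0 _]] := (uu', uv').
by field; rewrite v0 u'0 v'0 expf_neq0.
Qed.

Let factor_value P (j : int) u v : Q P -> gen_unit u -> gen_unit v ->
  P (t ^ j * u / v) = j * P t.
Proof.
move=> QP [_ u0 hu] [_ v0 hv].
rewrite pvalM ?mulf_neq0 ?invr_eq0 ?expfz_neq0 // pvalM ?expfz_neq0 // placeV //.
by rewrite placeXz // hu // hv // oppr0 !addr0.
Qed.

Let t_value P : Q P -> P t = 1.
Proof.
move=> QP; have [z [z0]] := pval_surj P.
have [j [u [v [uu uv ->]]]] := factor z0; rewrite factor_value // => E.
have := t_gt0 QP; move: (P t) E => x; clear => E x0.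
have j0 : 0 < j by rewrite -(pmulr_lgt0 j x0) E.
by have := ler_pM2r x0 1 j; rewrite E mul1r; lia.
Qed.

Let Q_unique P : Q P -> P = P0.
Proof.
move=> QP; apply: place_ext => z; have [->|z0] := eqVneq z 0; first by rewrite !pval0.
have [j [u [v [uu uv ->]]]] := factor z0.
by rewrite !factor_value // !t_value.
Qed.

Let residue_exists z : regular_at P0 z -> exists2 q : {poly Fq}, (size q < size G)%N &
  vanishes_at P0 (z - evT q).
Proof.
have [-> _|z0] := eqVneq z 0.
  by exists 0; [exact: s0G | rewrite /evT ev0 subr0; left].
have [j [u [v [uu uv zE]]]] := factor z0.
rewrite /regular_at zE (factor_value _ QP0 uu uv) t_value // mulr1 => j0.
have [j1|j1] := eqVneq j 0; last first.
  exists 0; [exact: s0G | rewrite /evT ev0 subr0; right].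
  by rewrite (factor_value _ QP0 uu uv) t_value //; lia.
rewrite j1 expr0z mul1r {zE j0 j1 z z0 j}.
have [[gu u0 hu] [gv v0 hv]] := (uu, uv).
have [qu squ ru] := gen_residue gu; have [qv sqv rv] := gen_residue gv.
have vu := gen_residue_vanishes QP0 ru; have vv := gen_residue_vanishes QP0 rv.
have qv0 : qv != 0.
  apply/eqP=> qv0; move: vv; rewrite qv0 /evT ev0 subr0 => -[/eqP|].
    by rewrite (negPf v0).
  by rewrite hv.
have [a [b /(congr1 evT)]] := bezout qv0 sqv.
rewrite /evT evD !evM ev1 -/evT => E.
exists ((qu * a) %% G); first by rewrite ltn_modp.
have gq x : regular_at P0 (evT x) := gen_regular QP0 (generated_poly theta x).
have gv' : regular_at P0 v^-1 by rewrite /regular_at placeV // hv.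
have vG : vanishes_at P0 (evT G) := QG QP0.
have e1 : evT qu * evT a = evT (qu * a %/ G) * evT G + evT ((qu * a) %% G).
  by rewrite -evM {1}(divp_eq (qu * a) G) evD evM.
have -> : u / v - evT ((qu * a) %% G) = v^-1 * (u - evT qu)
   + (evT qu * v^-1) * (evT b * evT G - evT a * (v - evT qv)) + evT (qu * a %/ G) * evT G.
  rewrite -[LHS](addrK (evT (qu * a %/ G) * evT G)).
  have -> : evT ((qu * a) %% G) = evT qu * evT a - evT (qu * a %/ G) * evT G by rewrite e1; ring.
  have -> : evT b * evT G = 1 - evT a * evT qv by rewrite -E; ring.
  by field.
apply: vanishesD; last exact: vanishesMl.
apply: vanishesD; first exact: vanishesMl.
apply: vanishesMl; first exact: (subringM (regular_ring P0)).
by apply: vanishesB; apply: vanishesMl.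
Qed.

Let theta_basis : residue_basis P0 (fun i : 'I_(size G).-1 => theta ^+ i).
Proof.
have sGE : size G = (size G).-1.+1 by rewrite prednK // ltnW.
have evE q : (size q < size G)%N ->
    evT q = \sum_(i < (size G).-1) cst F q`_i * theta ^+ i.
  move=> sq; rewrite /evT /ev (@horner_coef_wide _ (size G).-1); last first.
    by rewrite size_map_poly -ltnS -sGE.
  by apply: eq_bigr => i _; rewrite coef_map.
split; first by move=> i; apply: (subringX (regular_ring P0)); apply: Qtheta.
move=> z /residue_exists [q sq vq].
exists [ffun i : 'I_(size G).-1 => q`_i]; split.
  rewrite evE // in vq.
  by under eq_bigr do rewrite ffunE.
move=> c vc; apply/ffunP => i; rewrite ffunE.
pose q' := \poly_(i < (size G).-1) odflt 0 (omap c (insub i)).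
have q'E (i' : 'I_(size G).-1) : q'`_i' = c i'.
  by rewrite coef_poly ltn_ord valK.
have sq' : (size q' < size G)%N by rewrite sGE ltnS size_poly.
have vq' : vanishes_at P0 (z - evT q').
  by rewrite evE //; under eq_bigr do rewrite q'E.
have : vanishes_at P0 (evT (q' - q)).
  have -> : evT (q' - q) = (z - evT q) - (z - evT q') by rewrite /evT evB; ring.
  exact: vanishesB.
have [/eqP|nz] := eqVneq (q' - q) 0; first by rewrite subr_eq0 => /eqP qq _; rewrite -qq q'E.
have [|e0 Pe] := residue_unit QP0 nz.
  by apply: leq_ltn_trans (size_polyD _ _) _; rewrite size_polyN gtn_max sq sq'.
by case=> [/eqP|]; rewrite ?(negPf e0) // Pe.
Qed.

(** All the places of Q are proportional to the exponent of t, hence equal after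
    normalization, and the residue field is that of the point, Fq[T] / G. *)
Lemma regular_point_place : [/\ forall P, Q P -> P = P0, P0 t = 1 & pdeg P0 = (size G).-1].
Proof. by split; [exact: Q_unique | exact: t_value | exact: pdeg_residue_basis theta_basis]. Qed.

End RegularPoint.

(** * The infinite places of the cubic field *)

Section InfinitePlaces.

Variables (Fq : finFieldType) (F : fieldExtType {fraction {poly Fq}}).
Variables (A a B : {poly Fq}) (n1 : nat) (kappa : Fq) (y : F).
Implicit Types (P : place F) (z theta b : F) (f : {poly Fq}).
Hypotheses (two0 : (2%:R : Fq) != 0) (three0 : (3%:R : Fq) != 0).
Hypotheses (degA : size A = n1.+1) (n1_gt0 : (0 < n1)%N).
Hypotheses (a_neq0 : a != 0) (dega : ((size a).-1.*2 < n1)%N).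
Hypotheses (kappa0 : kappa != 0) (defB : B = a * (a ^+ 2 - A) + kappa%:P).
Hypothesis y_root : y ^+ 3 = pol F A * y - pol F B.
Hypothesis coord : forall z, exists u v w, z = cub (ratl F) y u v w.
Hypothesis coord_inj : forall u v w u' v' w',
  cub (ratl F) y u v w = cub (ratl F) y u' v' w' -> [/\ u = u', v = v' & w = w'].

Local Notation X := (pol F 'X).
Local Notation pi := ((pol F 'X)^-1).
Local Notation eps := (pol F a + y).
Local Notation C := (3%:R * a ^+ 2 - A).
Local Notation a3 := (3%:R * a).
Local Notation lA := (lead_coef A).

Let X0 : X != 0. Proof. by rewrite pol_eq0 polyX_eq0. Qed.
Let pi0 : pi != 0. Proof. by rewrite invr_eq0. Qed.
Let Xpi : X * pi = 1. Proof. exact: divff. Qed.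
Let kF0 : cst F kappa != 0. Proof. by rewrite cst_eq0. Qed.
Let size_a_gt0 : (0 < size a)%N. Proof. by rewrite size_poly_gt0. Qed.

Let size_a3 : size a3 = size a.
Proof. by rewrite -polyC_natr mul_polyC size_scale. Qed.

Let size_3a2 : (size (3%:R * a ^+ 2)%R <= n1)%N.
Proof.
rewrite -polyC_natr mul_polyC size_scale // expr2 size_mul //.
by move: (size a) size_a_gt0 dega => s; clear; lia.
Qed.

Let size_C : size C = n1.+1.
Proof. by rewrite addrC size_polyDl size_polyN degA. Qed.

Let C_lead : C`_n1 = - lA.
Proof. by rewrite coefB nth_default ?sub0r // /lead_coef degA. Qed.

Let C0 : C != 0. Proof. by rewrite -size_poly_eq0 size_C. Qed.
Let a30 : a3 != 0. Proof. by rewrite -size_poly_eq0 size_a3 size_poly_eq0. Qed.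

Lemma eps_root : eps ^+ 3 - pol F a3 * eps ^+ 2 + pol F C * eps + cst F kappa = 0.
Proof.
have BE : pol F B = pol F a * (pol F a ^+ 2 - pol F A) + cst F kappa.
  by rewrite defB rmorphD rmorphM rmorphB rmorphXn.
have aE : pol F a3 = 3%:R * pol F a by rewrite rmorphM rmorph_nat.
have CE : pol F C = 3%:R * pol F a ^+ 2 - pol F A.
  by rewrite rmorphB rmorphM rmorphXn rmorph_nat.
rewrite aE CE; move: y_root; rewrite BE.
move: (pol F a) (pol F A) (cst F kappa) => x z k yE.
transitivity (y ^+ 3 - z * y + (x * (x ^+ 2 - z) + k)); first by ring.
by rewrite yE; ring.
Qed.

Lemma eps_neq0 : eps != 0.
Proof.
apply/eqP => e0; have := eps_root; rewrite e0 !expr0n !mulr0 subrr !add0r => /eqP.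
by rewrite (negPf kF0).
Qed.

Let place_X P : infinite_place P -> P X < 0. Proof. by move/infinite_placeP. Qed.
Let place_pi P : P pi = - P X. Proof. exact: placeV. Qed.

(** The Newton polygon of the cubic equation of eps: its vertices are the terms of degree
    3, 1 and 0, and the slopes are those of the two alternatives. *)
Lemma eps_value P : infinite_place P ->
  P eps = - (n1%:Z * P X) \/ 2%:Z * P eps = n1%:Z * P X.
Proof.
move=> /place_X Px; have e0 := eps_neq0.
have pa0 : pol F a3 != 0 by rewrite pol_eq0.
have pC0 : pol F C != 0 by rewrite pol_eq0.
have VC : P (pol F C) = n1%:Z * P X.
  by rewrite place_pol // size_C -addn1 PoszD addrK.
have Va : P (pol F a3) = ((size a)%:Z - 1) * P X by rewrite place_pol // size_a3.
have M0 : P (pol F a3) <= 0 /\ n1%:Z * P X < 2%:Z * P (pol F a3).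
  rewrite Va; move: (size a) (P X) size_a_gt0 dega Px => s x; clear; nia.
have t1 : eps ^+ 3 != 0 by rewrite expf_neq0.
have t2 : - (pol F a3 * eps ^+ 2) != 0 by rewrite oppr_eq0 mulf_neq0 ?expf_neq0.
have t3 : pol F C * eps != 0 by rewrite mulf_neq0.
have V1 : P (eps ^+ 3) = 3%:Z * P eps by rewrite placeX.
have V2 : P (- (pol F a3 * eps ^+ 2)) = P (pol F a3) + 2%:Z * P eps.
  by rewrite placeN pvalM ?expf_neq0 // placeX.
have V3 : P (pol F C * eps) = P (pol F C) + P eps by rewrite pvalM.
have V4 : P (cst F kappa) = 0 by rewrite pval_cst.
have S := eps_root.
have four (b c d e : F) : b != 0 -> c != 0 -> d != 0 -> e != 0 -> b + c + d + e = 0 ->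
  [\/ P c <= P b, P d <= P b | P e <= P b] by exact: four_terms.
move: S t1 t2 t3 V1 V2 V3 kF0 V4.
move: (eps ^+ 3) (- (pol F a3 * eps ^+ 2)) (pol F C * eps) (cst F kappa) => b c d e.
move=> S b0 c0 d0 V1 V2 V3 ke0 V4.
have := four b c d e b0 c0 d0 ke0 S.
have := four c b d e c0 b0 d0 ke0; rewrite (addrC c b) => /(_ S).
have := four d b c e d0 b0 c0 ke0; rewrite addrC (addrC d) addrAC addrC => /(_ S).
have := four e b c d ke0 b0 c0 d0; rewrite (addrC e) (addrAC b) (addrAC _ e) => /(_ S).
rewrite V1 V2 V3 V4; rewrite VC in M0 *.
move: (n1%:Z * P X) (P (pol F a3)) (P eps) M0 => N M w; clear.
by case=> M1 M2 [] h1 [] h2 [] h3 [] h4; lia.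
Qed.

(** This expands a polynomial at infinity; the residues at infinity of the coefficients
    of the equations below are found in this way. *)
Lemma reciprocal_generated theta f N : (size f <= N.+1)%N ->
  exists2 r, generated theta r & pol F f * pi ^+ N = cst F f`_N + pi * r.
Proof.
move=> sf; exists (\sum_(i < N) cst F f`_i * pi ^+ (N - i.+1)).
  apply: (subring_sum (generated_ring theta)) => i _.
  apply: generated_mul; first exact: generated_cst.
  by apply: (subringX (generated_ring theta)); apply: generated_inf.
rewrite polE (@horner_coef_wide _ N.+1); last by rewrite size_map_poly.
rewrite big_ord_recr /= mulrDl addrC; congr (_ + _).
  by rewrite coef_map -mulrA expf_mulV // subnn expr0 mulr1.
rewrite mulr_suml mulr_sumr; apply: eq_bigr => i _.
rewrite coef_map -mulrA expf_mulV //; last exact: ltnW.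
have -> : (N - i = (N - i.+1).+1)%N by rewrite -subSn.
by rewrite exprS mulrCA.
Qed.

Let reciprocal_generated0 theta f N : (size f <= N)%N ->
  exists2 r, generated theta r & pol F f * pi ^+ N = pi * r.
Proof.
move=> sf; have [r gr rE] := reciprocal_generated theta (leqW sf).
by exists r => //; rewrite rE nth_default // rmorph0 add0r.
Qed.

(** Fractions form a field; it contains x and eps, hence y. *)
Lemma generated_fractions theta : theta != 0 ->
  (exists r s, [/\ generated theta r, generated theta s, s != 0 & eps = r / s]) ->
  forall z, exists r s, [/\ generated theta r, generated theta s, s != 0 & z = r / s].
Proof.
move=> th0; pose L z := exists r s, [/\ generated theta r, generated theta s, s != 0 & z = r / s].
rewrite -/(L eps) => Leps; rewrite -/(L _).
have ringG := generated_ring theta.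
have Lgen r : generated theta r -> L r.
  by move=> gr; exists r, 1; split; rewrite ?oner_neq0 ?divr1 //; apply: (subring1 ringG).
have LD u v : L u -> L v -> L (u + v).
  move=> [r [s [gr gs s0 ->]]] [r' [s' [gr' gs' s'0 ->]]].
  exists (r * s' + r' * s), (s * s'); split.
  - by apply: generated_add; apply: generated_mul.
  - exact: generated_mul.
  - exact: mulf_neq0.
  - exact: addf_div.
have LM u v : L u -> L v -> L (u * v).
  move=> [r [s [gr gs s0 ->]]] [r' [s' [gr' gs' s'0 ->]]].
  exists (r * r'), (s * s'); split; try exact: generated_mul.
  - exact: mulf_neq0.
  - exact: mulf_div.
have LV u : L u -> L u^-1.
  move=> [r [s [gr gs s0 ->]]]; have [->|r0] := eqVneq r 0.
    by rewrite mul0r invr0; apply: Lgen; apply: (subring0 ringG).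
  by exists s, r; rewrite invf_div.
have LX : L X by rewrite -[X]invrK; apply/LV/Lgen/generated_inf.
have Lpol f : L (pol F f).
  rewrite polE horner_coef; apply: big_ind => //; first by apply: Lgen; apply: (subring0 ringG).
  move=> i _; apply: (LM); first by rewrite coef_map; apply/Lgen/generated_cst.
  elim: (nat_of_ord i) => [|m IHm]; first by apply: Lgen; apply: (subring1 ringG).
  by rewrite exprS; apply: LM.
have Lratl h : L (ratl F h).
  by have [f [g [g0 ->]]] := ratlP F h; apply: (LM) => //; apply: LV.
have Ly : L y.
  have -> : y = eps + pol F (- a) by rewrite rmorphN addrC addKr.
  exact: LD.
have Ly2 : L (y ^+ 2) by have := LM _ _ Ly Ly; rewrite -expr2.
move=> z; have [u [v [w ->]]] := coord z; rewrite /cub.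
exact: LD _ _ (LD _ _ (Lratl u) (LM _ _ (Lratl v) Ly)) (LM _ _ (Lratl w) Ly2).
Qed.


Let genX theta n : generated theta (theta ^+ n).
Proof. by apply: (subringX (generated_ring theta)); apply: generated_gen. Qed.
Let genpi theta n : generated theta (pi ^+ n).
Proof. by apply: (subringX (generated_ring theta)); apply: generated_inf. Qed.
Let genN theta b : generated theta b -> generated theta (- b).
Proof. exact: (subringN (generated_ring theta)). Qed.

Let infinite_pi P : infinite_place P -> vanishes_at P pi.
Proof. by move=> /place_X Px; right; rewrite place_pi oppr_gt0. Qed.

Let ev_XsubC theta (c : Fq) : (map_poly (cst F) ('X - c%:P)).[theta] = theta - cst F c.
Proof. by rewrite rmorphB /= map_polyX map_polyC hornerXsubC. Qed.

Definition zero_of_eps P := infinite_place P /\ 0 < P eps.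
Definition pole_of_eps P := infinite_place P /\ P eps < 0.

Lemma infinite_place_zero_or_pole P : infinite_place P -> zero_of_eps P \/ pole_of_eps P.
Proof.
move=> iP; have Px := place_X iP; have := eps_value iP.
rewrite /zero_of_eps /pole_of_eps.
have : n1%:Z * P X < 0 by move: (P X) Px n1_gt0 => x; clear; nia.
move: (n1%:Z * P X) (P eps) => N w N0 [] h; [left | right]; split=> //.
  by move: h N0; clear; lia.
by move: h N0; clear; lia.
Qed.

(** theta = x^(-n1) / eps satisfies theta^2 (theta - lc(A)/kappa) = 0 modulo 1/x, and the
    places in question are centred at the simple root. *)
Lemma zero_of_eps_unique P0 : zero_of_eps P0 ->
  [/\ forall P, zero_of_eps P -> P = P0, P0 X = -1, P0 eps = n1 & pdeg P0 = 1%N].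
Proof.
move=> Q0; have e0 := eps_neq0.
pose theta : F := pi ^+ n1 / eps.
have th0 : theta != 0 by rewrite mulf_neq0 ?expf_neq0 ?invr_eq0.
have epsE : eps = pi ^+ n1 / theta by rewrite /theta invf_div mulrCA divff ?expf_neq0 // mulr1.
have [r1 g1 E1] := reciprocal_generated theta (eq_leq size_C).
have [|r2 g2 E2] := @reciprocal_generated0 theta a3 (n1 + n1)%N.
  by rewrite size_a3; move: (size a) size_a_gt0 dega => s; clear; lia.
have n1E : (n1 = n1.-1.+1)%N by rewrite prednK.
pose G : {poly Fq} := 'X - (lA / kappa)%:P.
have V P : zero_of_eps P -> P eps = - (n1%:Z * P X).
  move=> [iP]; have Px := place_X iP; have := eps_value iP.
  have : n1%:Z * P X < 0 by move: (P X) Px n1_gt0 => x; clear; nia.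
  by move: (n1%:Z * P X) (P eps) => N w; clear; lia.
have Vth P : zero_of_eps P -> P theta = 0.
  move=> QP; rewrite (pvalM P (expf_neq0 n1 pi0) (invr_neq0 e0)) (placeV P e0).
  by rewrite (placeX P n1 pi0) place_pi (V P QP) mulrN opprK addNr.
have E : cst F kappa * theta ^+ 3 = cst F lA * theta ^+ 2 + pi *
    (r2 * theta - r1 * theta ^+ 2 - pi ^+ (n1 + n1 + n1.-1)).
  have E3 : pi ^+ (n1 + n1 + n1.-1) * pi = pi ^+ n1 ^+ 3.
    by rewrite -exprSr -exprM; congr (_ ^+ _); move: n1_gt0; clear; lia.
  have := congr1 ( *%R^~ (theta ^+ 3)) eps_root; rewrite mul0r.
  rewrite exprD in E2; rewrite C_lead rmorphN in E1.
  have := mulfVK th0 (pi ^+ n1); rewrite -epsE.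
  move: (pol F a3) (pol F C) eps (pi ^+ n1) (pi ^+ (n1 + n1 + n1.-1)) E1 E2 E3.
  move=> s c e q p E1 E2 E3 qE R.
  have {}R : (e * theta) ^+ 3 - s * (e * theta * (e * theta)) * theta
    + c * (e * theta) * theta ^+ 2 + cst F kappa * theta ^+ 3 = 0 by rewrite -R; ring.
  rewrite qE -E3 E2 E1 in R; apply/eqP; rewrite -subr_eq0 -R; apply/eqP; ring.
pose al2 : F := (cst F kappa)^-1 * (r2 * theta - r1 * theta ^+ 2 - pi ^+ (n1 + n1 + n1.-1)).
have gal2 : generated theta al2.
  rewrite /al2 -fmorphV; apply: generated_mul; first exact: generated_cst.
  apply: (subringB (generated_ring theta)); last exact: genpi.
  apply: (subringB (generated_ring theta)).
    exact: generated_mul g2 (generated_gen _).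
  exact: generated_mul g1 (genX _ _).
have eq2 : (map_poly (cst F) G).[theta] * theta ^+ 2 = pi * al2.
  rewrite ev_XsubC fmorph_div; apply: (mulfI kF0); rewrite /al2.
  have -> : cst F kappa * ((theta - cst F lA / cst F kappa) * theta ^+ 2) =
      cst F kappa * theta ^+ 3 - cst F lA * theta ^+ 2 by field.
  by rewrite E addrC addKr [RHS]mulrCA (mulVKf kF0).
have irrG : irreducible_poly G := irredp_XsubC _.
have Hfrac : forall z, exists r s, [/\ generated theta r, generated theta s, s != 0 & z = r / s].
  apply: generated_fractions => //; exists (pi ^+ n1), theta; split=> //.
  exact: generated_gen.
have Qpi P : zero_of_eps P -> vanishes_at P pi by move=> [/infinite_pi].
have Qth P : zero_of_eps P -> regular_at P theta by move=> QP; rewrite /regular_at Vth.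
have Qbe P : zero_of_eps P -> P (theta ^+ 2) = 0 by move=> QP; rewrite placeX // Vth // mulr0.
have [P1 P2 P3] := regular_point_place irrG Hfrac (genX theta 2) gal2 (genX theta 2)
  (expf_neq0 2 th0) pi0 erefl eq2 Qpi Qth Qpi Qbe Q0.
have P0X : P0 X = -1 by rewrite -[P0 X]opprK -place_pi P2.
split; [exact: P1 | exact: P0X | | by rewrite P3 size_XsubC].
by rewrite (V _ Q0) P0X mulrN1 opprK.
Qed.

(** The slope of the Newton polygon being n1/2 with n1 = 2m + 1, the function
    theta = x^m / eps has half the value of 1/x: dividing the cubic equation by
    x eps^3 shows that 1/x is theta^2 up to a unit. So theta is the uniformizer. *)
Lemma pole_of_eps_unique_odd P0 : odd n1 -> pole_of_eps P0 ->
  [/\ forall P, pole_of_eps P -> P = P0, P0 X = -2, P0 eps = - n1%:Z & pdeg P0 = 1%N].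
Proof.
move=> odd_n1 Q0; have e0 := eps_neq0.
pose m := n1./2; have n1E : n1 = (m + m).+1.
  by rewrite -[LHS]odd_double_half odd_n1 addnn.
pose theta : F := X ^+ m / eps.
have th0 : theta != 0 by rewrite mulf_neq0 ?expf_neq0 ?invr_eq0.
have thE : theta * eps = X ^+ m by rewrite /theta mulfVK.
have V P : pole_of_eps P -> 2%:Z * P eps = n1%:Z * P X.
  move=> [iP]; have Px := place_X iP; have := eps_value iP.
  have : n1%:Z * P X < 0 by move: (P X) Px n1_gt0 => x; clear; nia.
  by move: (n1%:Z * P X) (P eps) => N w; clear; lia.
have Vth P : pole_of_eps P -> 2%:Z * P theta = - P X.
  move=> QP; rewrite (pvalM P (expf_neq0 m X0) (invr_neq0 e0)) (placeV P e0) (placeX P m X0).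
  by have := V P QP; rewrite n1E; move: (P eps) (P X) => w x; clear; lia.
have [r1 g1 E1] := reciprocal_generated theta (eq_leq size_C).
have [|r2 g2 E2] := @reciprocal_generated theta a3 m.
  by rewrite size_a3; move: (size a) size_a_gt0 dega; rewrite n1E => s; clear; lia.
have gring := generated_ring theta; have gth := generated_gen theta.
have gpi := generated_inf theta.
have gC : generated theta (pol F C * pi ^+ n1).
  rewrite E1; apply: generated_add; first exact: generated_cst.
  exact: generated_mul.
have ga : generated theta (pol F a3 * pi ^+ m).
  rewrite E2; apply: generated_add; first exact: generated_cst.
  exact: generated_mul.
pose al1 : F := - (pol F C * pi ^+ n1 * theta).
(* be is the cubic equation of eps divided by eps^3, without its term of degree 1 *)
pose b1 : F := cst F kappa * pi ^+ m ^+ 3 * theta ^+ 2 - pol F a3 * pi ^+ m.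
pose be : F := 1 + theta * b1.
have gb1 : generated theta b1.
  apply: (subringB gring) => //; apply: generated_mul; last exact: genX.
  apply: generated_mul; first exact: generated_cst.
  by rewrite -exprM; apply: genpi.
have gbe : generated theta be.
  by apply: generated_add; [apply: (subring1 gring) | apply: generated_mul].
have Xpim : X ^+ m * pi ^+ m = 1 by rewrite -exprMn Xpi expr1n.
have epsth : eps * (pi ^+ m * theta) = 1 by rewrite mulrCA (mulrC eps) thE mulrC.
have nz : pi ^+ m * theta != 0 by rewrite mulf_neq0 ?expf_neq0.
have eq1 : pi * be = theta * al1.
  have R : pol F C * pi ^+ m * pi ^+ m * theta ^+ 2 + be = 0.
    have := congr1 ( *%R^~ ((pi ^+ m * theta) ^+ 3)) eps_root; rewrite mul0r /be /b1.
    move: epsth; move: (pol F a3) (pol F C) eps (pi ^+ m) => s c e q E.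
    move=> R; rewrite -[RHS]R.
    transitivity ((e * (q * theta)) ^+ 3 - s * (e * (q * theta)) ^+ 2 * (q * theta)
      + c * (e * (q * theta)) * (q * theta) ^+ 2 + cst F kappa * (q * theta) ^+ 3).
      by rewrite E; ring.
    by ring.
  rewrite /al1; have -> : pi ^+ n1 = pi ^+ m * pi ^+ m * pi by rewrite -exprD -exprSr n1E.
  move/eqP: R; rewrite addrC addr_eq0 => /eqP ->; ring.
have eq2 : (map_poly (cst F) 'X).[theta] * be = theta * be by rewrite map_polyX hornerX.
have irrG : irreducible_poly ('X : {poly Fq}).
  by have := @irredp_XsubC Fq 0; rewrite polyC0 subr0.
have Hfrac : forall z, exists r s, [/\ generated theta r, generated theta s, s != 0 & z = r / s].
  apply: generated_fractions => //; exists 1, (pi ^+ m * theta); split.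
  - exact: (subring1 gring).
  - by apply: generated_mul.
  - exact: nz.
  - by rewrite -epsth (mulfK nz).
have Qpi P : pole_of_eps P -> vanishes_at P pi by move=> [/infinite_pi].
have Qt P : pole_of_eps P -> vanishes_at P theta.
  move=> QP; right; have := Vth P QP; have := place_X (proj1 QP).
  by move: (P X) (P theta) => x w; clear; lia.
have Qth P : pole_of_eps P -> regular_at P theta by move=> /Qt/vanishes_regular.
have Qbe' P : pole_of_eps P -> be != 0 /\ P be = 0.
  move=> QP; apply: unit_add_vanishes; [exact: oner_neq0 | exact: place1 |].
  apply: vanishesMr; first exact: Qt.
  have gr x : generated theta x -> regular_at P x.
    elim=> [c| | |b c _ hb _ hc|b c _ hb _ hc].
    - exact: regular_cst.
    - exact/vanishes_regular/Qpi.
    - exact: Qth.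
    - exact: (subringD (regular_ring P)).
    - exact: (subringM (regular_ring P)).
  exact: gr.
have gal1 : generated theta al1 by apply: genN; apply: generated_mul.
have [P1 P2 P3] := regular_point_place irrG Hfrac gal1 gbe gbe (proj1 (Qbe' _ Q0)) th0
  eq1 eq2 Qpi Qth Qt (fun P QP => proj2 (Qbe' P QP)) Q0.
have P0X : P0 X = -2 by have := Vth _ Q0; rewrite P2; move: (P0 X) => x; clear; lia.
split; [exact: P1 | exact: P0X | | by rewrite P3 size_polyX].
by have := V _ Q0; rewrite P0X; move: (P0 eps) => x; clear; lia.
Qed.

(** With n1 = 2m, theta = eps / x^m satisfies theta (theta^2 - lc(A)) = 0 modulo 1/x, and
    the quadratic factor is irreducible. *)
Lemma pole_of_eps_unique_even P0 : ~~ odd n1 -> ~ (exists c : Fq, lA = c ^+ 2) -> pole_of_eps P0 ->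
  [/\ forall P, pole_of_eps P -> P = P0, P0 X = -1, P0 eps = - (n1./2)%:Z & pdeg P0 = 2%N].
Proof.
move=> even_n1 nsq Q0; have e0 := eps_neq0.
pose m := n1./2; have n1E : n1 = (m + m)%N.
  by rewrite -[LHS]odd_double_half (negPf even_n1) addnn.
have m0 : (0 < m)%N by move: n1_gt0; rewrite n1E; clear; lia.
pose theta : F := eps * pi ^+ m.
have th0 : theta != 0 by rewrite mulf_neq0 ?expf_neq0.
have thE : eps = theta / pi ^+ m by rewrite /theta mulfK ?expf_neq0.
have V P : pole_of_eps P -> P eps = m%:Z * P X.
  move=> [iP]; have Px := place_X iP; have := eps_value iP.
  have : n1%:Z * P X < 0 by move: (P X) Px n1_gt0 => x; clear; nia.
  by rewrite n1E PoszD; move: (P eps) (P X) => w x; clear; lia.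
have Vth P : pole_of_eps P -> P theta = 0.
  move=> QP; rewrite (pvalM P e0 (expf_neq0 m pi0)) (placeX P m pi0) place_pi (V P QP).
  by rewrite mulrN subrr.
have [r1 g1 E1] := reciprocal_generated theta (eq_leq size_C).
have [|r2 g2 E2] := @reciprocal_generated0 theta a3 m.
  by rewrite size_a3; move: (size a) size_a_gt0 dega; rewrite n1E => s; clear; lia.
have gring := generated_ring theta; have gth := generated_gen theta.
have gpi := generated_inf theta.
pose G : {poly Fq} := 'X^2 - lA%:P.
have evG : (map_poly (cst F) G).[theta] = theta ^+ 2 - cst F lA.
  by rewrite rmorphB /= map_polyXn map_polyC hornerD hornerN hornerXn hornerC.
pose al2 : F := r2 * theta ^+ 2 - r1 * theta - cst F kappa * pi ^+ (m + m + m.-1).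
have eq2 : (map_poly (cst F) G).[theta] * theta = pi * al2.
  rewrite evG /al2.
  have E3 : pi ^+ (m + m + m.-1) * pi = pi ^+ m ^+ 3.
    by rewrite -exprSr -exprM; congr (_ ^+ _); move: m0; clear; lia.
  have := congr1 ( *%R^~ (pi ^+ m ^+ 3)) eps_root; rewrite mul0r.
  rewrite C_lead rmorphN n1E exprD in E1.
  have : theta = eps * pi ^+ m by [].
  move: (pol F a3) (pol F C) eps (pi ^+ m) (pi ^+ (m + m + m.-1)) E1 E2 E3.
  move=> s c e q p E1 E2 E3 qE R.
  have {}R : (e * q) ^+ 3 - s * q * (e * q) ^+ 2
    + c * (q * q) * (e * q) + cst F kappa * q ^+ 3 = 0 by rewrite -R; ring.
  rewrite -qE -E3 E2 E1 in R; apply/eqP; rewrite -subr_eq0 -[X in _ == X]R; apply/eqP; ring.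
have gal2 : generated theta al2.
  apply: (subringB gring); last exact: generated_mul (generated_cst _ _) (genpi _ _).
  apply: (subringB gring); first exact: generated_mul g2 (genX _ _).
  exact: generated_mul.
have sGE : size G = 3%N by rewrite size_XnsubC.
have irrG : irreducible_poly G.
  apply: cubic_irreducible; rewrite ?sGE // => x; apply/negP; rewrite rootE.
  by rewrite hornerD hornerN hornerXn hornerC subr_eq0 => /eqP E; apply: nsq; exists x.
have Hfrac : forall z, exists r s, [/\ generated theta r, generated theta s, s != 0 & z = r / s].
  apply: generated_fractions => //; exists theta, (pi ^+ m); split=> //.
  exact: expf_neq0.
have Qpi P : pole_of_eps P -> vanishes_at P pi by move=> [/infinite_pi].
have Qth P : pole_of_eps P -> regular_at P theta by move=> QP; rewrite /regular_at Vth.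
have [P1 P2 P3] := regular_point_place irrG Hfrac gth gal2 gth th0 pi0 erefl eq2
  Qpi Qth Qpi Vth Q0.
have P0X : P0 X = -1 by rewrite -[P0 X]opprK -place_pi P2.
split; [exact: P1 | exact: P0X | | by rewrite P3 sGE].
by rewrite (V _ Q0) P0X mulrN1.
Qed.

Let KF := {fraction {poly Fq}}.

Let two_frac : (2%:R : KF) = tofrac (2%:R)%:P.
Proof. by rewrite polyC_natr rmorph_nat. Qed.

Let two_frac0 : (2%:R : KF) != 0.
Proof. by rewrite two_frac tofrac_eq0 polyC_eq0. Qed.

Let two_fracV : (2%:R : KF)^-1 = tofrac (2%:R^-1)%:P.
Proof.
apply: (mulfI two_frac0); rewrite (divff two_frac0) two_frac -tofracM -polyCM.
by rewrite (divff two0) polyC1 tofrac1.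
Qed.

Lemma finite_charpoly u v w : Oint (cub (ratl F) y u v w) ->
  [/\ polyfrac (tr3 (tofrac A) u w), polyfrac (sm3 (tofrac A) (tofrac B) u v w)
    & polyfrac (nm3 (tofrac A) (tofrac B) u v w)].
Proof.
move=> [p mon_p pz].
have R2 : polyfrac (2%:R : KF)^-1 by rewrite two_fracV; exists (2%:R^-1)%:P.
apply: (integral_charpoly y_root coord coord_inj (polyfrac_ring Fq) two_frac0 R2
  (@polyfrac_denominator Fq) (@polyfrac_closed Fq)).
exists (map_poly (pol F) p); split=> //; first exact: monic_map.
by move=> i; rewrite coef_map; exists (tofrac p`_i) => //; exists p`_i.
Qed.

Lemma infinite_charpoly u v w :
  (forall P, infinite_place P -> regular_at P (cub (ratl F) y u v w)) ->
  [/\ proper_frac (tr3 (tofrac A) u w), proper_frac (sm3 (tofrac A) (tofrac B) u v w)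
    & proper_frac (nm3 (tofrac A) (tofrac B) u v w)].
Proof.
move=> /infinite_integral.
have R2 : proper_frac (2%:R : KF)^-1.
  rewrite two_fracV; right; rewrite fdeg_tofrac ?polyC_eq0 ?invr_eq0 //.
  by rewrite size_polyC invr_eq0 two0.
exact: (integral_charpoly y_root coord coord_inj (proper_frac_ring Fq) two_frac0 R2
  (@proper_frac_denominator Fq) (@proper_frac_closed Fq)).
Qed.

Let C_improper : ~ proper_frac (tofrac C).
Proof.
case=> [/eqP|]; first by rewrite tofrac_eq0 (negPf C0).
by rewrite fdeg_tofrac // size_C -addn1 PoszD addrK; move: n1_gt0; clear; lia.
Qed.

Let tofrac_C : tofrac C = 3%:R * tofrac a ^+ 2 - tofrac A.
Proof. by rewrite tofracB (tofracM 3%:R) tofracXn rmorph_nat. Qed.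

(** Without poles of eps at infinity, its characteristic polynomial would have proper
    coefficients, but one of them is 3a^2 - A. *)
Lemma pole_of_eps_exists : exists P, pole_of_eps P.
Proof.
apply: contrapT => nt2; have [|_ + _] := @infinite_charpoly (tofrac a) 1 0.
  move=> P iP; have -> : cub (ratl F) y (tofrac a) 1 0 = eps.
    by rewrite /cub rmorph1 rmorph0 mul1r mul0r addr0.
  by case: (infinite_place_zero_or_pole iP) => [[_ /ltW]|t2] //; case: nt2; exists P.
have -> : sm3 (tofrac A) (tofrac B) (tofrac a) 1 0 = tofrac C by rewrite tofrac_C /sm3; ring.
exact: C_improper.
Qed.

(** Same argument for z = - kappa / eps, whose trace is 3a^2 - A. *)
Lemma zero_of_eps_exists : exists P, zero_of_eps P.
Proof.
pose z := cub (ratl F) y (tofrac (a ^+ 2 - A)) (tofrac (- a)) 1.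
have zE : z * eps = - cst F kappa.
  have -> : z = pol F a ^+ 2 - pol F A - pol F a * y + y ^+ 2.
    have a2E : ratl F (tofrac (a ^+ 2 - A)) = pol F a ^+ 2 - pol F A.
      by rewrite -[LHS]/(pol F _) rmorphB rmorphXn.
    have NaE : ratl F (tofrac (- a)) = - pol F a by rewrite -[LHS]/(pol F _) rmorphN.
    transitivity (ratl F (tofrac (a ^+ 2 - A)) + ratl F (tofrac (- a)) * y
      + ratl F 1 * y ^+ 2); first by [].
    by rewrite a2E NaE rmorph1 mul1r mulNr.
  have := eps_root; rewrite -/(cst F kappa).
  have -> : pol F a3 = 3%:R * pol F a by rewrite rmorphM rmorph_nat.
  have -> : pol F C = 3%:R * pol F a ^+ 2 - pol F A.
    by rewrite rmorphB rmorphM rmorphXn rmorph_nat.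
  move: (pol F a) (pol F A) (cst F kappa) => x b k /eqP.
  by rewrite addr_eq0 => /eqP <-; ring.
have z0 : z != 0.
  by apply/eqP => z0; move/eqP: zE; rewrite z0 mul0r eq_sym oppr_eq0 (negPf kF0).
have Pz P : P z = - P eps.
  have := pvalM P z0 eps_neq0; rewrite zE placeN pval_cst // => h.
  by apply/eqP; rewrite -addr_eq0 -h.
apply: contrapT => nt1; have [|+ _ _] := @infinite_charpoly (tofrac (a ^+ 2 - A)) (tofrac (- a)) 1.
  move=> P iP; rewrite -/z /regular_at Pz.
  case: (infinite_place_zero_or_pole iP) => [t1|[_ neg]]; first by case: nt1; exists P.
  by rewrite oppr_ge0 ltW.
have -> : tr3 (tofrac A) (tofrac (a ^+ 2 - A)) 1 = tofrac C.
  by rewrite tofrac_C /tr3 tofracB tofracXn; ring.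
exact: C_improper.
Qed.

(** In the result e is the ramification index of P2. *)
Lemma infinite_places : odd n1 \/ ~~ odd n1 /\ ~ (exists c : Fq, lA = c ^+ 2) ->
  exists (P1 P2 : place F) (e : nat),
  [/\ forall P, infinite_place P <-> P = P1 \/ P = P2, P1 != P2,
      [/\ P1 X = -1, P1 eps = n1 & pdeg P1 = 1%N],
      [/\ P2 X = - e%:Z, 2%:Z * P2 eps = - (n1 * e)%:Z & (pdeg P2 * e)%N = 2%N]
    & e = (if odd n1 then 2 else 1)%N].
Proof.
move=> cases; have [P1 t1] := zero_of_eps_exists; have [P2 t2] := pole_of_eps_exists.
have [u1 X1 e1 d1] := zero_of_eps_unique t1.
have iff P : (forall P, pole_of_eps P -> P = P2) ->
    infinite_place P <-> P = P1 \/ P = P2.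
  move=> u2; split=> [/infinite_place_zero_or_pole[/u1|/u2] ->|[->|->]]; [by left|by right| |].
    by case: t1.
  by case: t2.
have P12 : P1 != P2.
  apply/eqP => E; move: t1 t2; rewrite E => -[_ h1] [_ h2].
  by move: h1; rewrite ltNge (ltW h2).
case: cases => [odd_n1|[even_n1 nsq]].
  have [u2 X2 e2 d2] := pole_of_eps_unique_odd odd_n1 t2.
  exists P1, P2, 2%N; rewrite odd_n1; split=> //; first by move=> P; apply: iff.
  by rewrite X2 e2 d2; split=> //; clear; lia.
have [u2 X2 e2 d2] := pole_of_eps_unique_even even_n1 nsq t2.
exists P1, P2, 1%N; rewrite (negPf even_n1); split=> //; first by move=> P; apply: iff.
rewrite X2 e2 d2 muln1; split=> //.
by rewrite -[n1 in RHS]odd_double_half (negPf even_n1) -muln2; clear; lia.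
Qed.

End InfinitePlaces.

(** * Units of the cubic field *)

Lemma cubic_integral (R : comNzRingType) (K : fieldType) (f : {rmorphism R -> K}) b c d z :
  z ^+ 3 + f b * z ^+ 2 + f c * z + f d = 0 -> integralOver f z.
Proof.
move=> E; exists ('X^3 + (b *: 'X^2 + c *: 'X + d%:P)).
  rewrite monicE lead_coefDl ?lead_coefXn // size_polyXn.
  apply: leq_ltn_trans (size_polyD _ _) _; rewrite gtn_max; apply/andP; split; last first.
    exact: leq_ltn_trans (size_polyC_leq1 _) _.
  apply: leq_ltn_trans (size_polyD _ _) _; rewrite gtn_max; apply/andP; split.
    by apply: leq_ltn_trans (size_scale_leq _ _) _; rewrite size_polyXn.
  by apply: leq_ltn_trans (size_scale_leq _ _) _; rewrite size_polyX.
rewrite rootE !rmorphD /= !map_polyZ map_polyC !map_polyXn map_polyX.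
rewrite !hornerD !hornerZ hornerC !hornerXn hornerX -E; apply/eqP; ring.
Qed.

Section Units.

Variables (Fq : finFieldType) (F : fieldExtType {fraction {poly Fq}}).
Variables (A a B : {poly Fq}) (n1 : nat) (kappa : Fq) (y : F).
Implicit Types (P : place F) (z : F) (f : {poly Fq}).
Hypotheses (two0 : (2%:R : Fq) != 0) (three0 : (3%:R : Fq) != 0).
Hypotheses (degA : size A = n1.+1) (n1_gt0 : (0 < n1)%N).
Hypotheses (a_neq0 : a != 0) (dega : ((size a).-1.*2 < n1)%N).
Hypotheses (kappa0 : kappa != 0) (defB : B = a * (a ^+ 2 - A) + kappa%:P).
Hypothesis y_root : y ^+ 3 = pol F A * y - pol F B.
Hypothesis coord : forall z, exists u v w, z = cub (ratl F) y u v w.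
Hypothesis coord_inj : forall u v w u' v' w',
  cub (ratl F) y u v w = cub (ratl F) y u' v' w' -> [/\ u = u', v = v' & w = w'].
Hypothesis Fq_closed : constants_closed F.
Hypothesis local_cond : forall p, irreducible_poly p ->
  ~~ (p ^+ 2 %| 4%:R * A ^+ 3 - 27%:R * B ^+ 2) \/ [/\ p %| A, p %| B & ~~ (p ^+ 2 %| B)].

Local Notation X := (pol F 'X).
Local Notation eps := (pol F a + y).
Local Notation C := (3%:R * a ^+ 2 - A).
Local Notation a3 := (3%:R * a).
Local Notation KF := {fraction {poly Fq}}.
Local Notation D := (4%:R * A ^+ 3 - 27%:R * B ^+ 2).

Variables (P1 P2 : place F) (e : nat).
Hypothesis infP : forall P, infinite_place P <-> P = P1 \/ P = P2.
Hypothesis P1_values : P1 X = -1 /\ P1 eps = n1.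
Hypothesis P2_values : P2 X = - e%:Z /\ 2%:Z * P2 eps = - (n1 * e)%:Z.
Hypothesis eE : e = (if odd n1 then 2 else 1)%N.

Let X0 : X != 0. Proof. by rewrite pol_eq0 polyX_eq0. Qed.

Let E_root : eps ^+ 3 - pol F a3 * eps ^+ 2 + pol F C * eps + cst F kappa = 0 :=
  eps_root defB y_root.

Let eps0 : eps != 0 := eps_neq0 kappa0 defB y_root.

Let constant_frac (h : KF) : polyfrac h -> proper_frac h -> exists c : Fq, h = tofrac c%:P.
Proof.
move=> [f ->]; have [->|f0] := eqVneq f 0; first by exists 0; rewrite polyC0.
case=> [/eqP|]; first by rewrite tofrac_eq0 (negPf f0).
rewrite fdeg_tofrac // => s1; have /size1_polyC -> : (size f <= 1)%N.
  by move: (size f) s1 => s; clear; lia.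
by exists f`_0.
Qed.

Let charpoly_root u v w (z := cub (ratl F) y u v w) :
  z ^+ 3 - ratl F (tr3 (tofrac A) u w) * z ^+ 2 + ratl F (sm3 (tofrac A) (tofrac B) u v w) * z
  - ratl F (nm3 (tofrac A) (tofrac B) u v w) = 0 := cub_root y_root u v w.

(** The characteristic polynomial of a function without poles has coefficients that are
    both polynomials and proper fractions, that is constants. *)
Lemma constant_of_regular z : (forall P, regular_at P z) -> exists c, z = cst F c.
Proof.
move=> regz; have [u [v [w zE]]] := coord z.
have [|F1 F2 F3] := finite_charpoly two0 y_root coord coord_inj (u := u) (v := v) (w := w).
  by rewrite -zE; apply: Oint_of_regular => P _.
have [|I1 I2 I3] := infinite_charpoly two0 y_root coord coord_inj (u := u) (v := v) (w := w).
  by rewrite -zE => P _.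
have := charpoly_root u v w; rewrite -zE.
have [c1 ->] := constant_frac F1 I1; have [c2 ->] := constant_frac F2 I2.
have [c3 ->] := constant_frac F3 I3; rewrite -!/(cst F _) => E.
apply: Fq_closed; have [p mon_p pz] : integralOver (cst F) z.
  apply: (@cubic_integral _ _ (cst F) (- c1) c2 (- c3)).
  by rewrite -[RHS]E !rmorphN !mulNr.
by exists p => //; apply: monic_neq0.
Qed.

Let Oint_pol f : Oint (pol F f).
Proof. exact: integral_id. Qed.

Let y_int : Oint y.
Proof.
apply: (@cubic_integral _ _ (pol F) 0 (- A) B).
by rewrite rmorph0 rmorphN mul0r addr0 y_root; ring.
Qed.

Lemma Oint_coordinates u v w : Oint (cub (ratl F) y u v w) ->
  [/\ polyfrac u, polyfrac v & polyfrac w].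
Proof.
apply: (integral_coordinates two0 three0
  (Int := fun u v w => Oint (cub (ratl F) y u v w))) => //.
- by move=> *; rewrite -cubD; apply: integral_add.
- by move=> *; rewrite -cubZ; apply: integral_mul => //; apply: Oint_pol.
- rewrite /cub rmorph1 rmorph0 !mul0r !addr0; exact: integral1.
- by rewrite /cub rmorph1 rmorph0 mul0r mul1r add0r addr0.
- by move=> *; apply: (finite_charpoly two0 y_root coord coord_inj).
- exact: local_cond.
Qed.

Let Ounit_finite u P : Ounit u -> ~ infinite_place P -> P u = 0.
Proof.
move=> [u0 iu iv] fP; have := Oint_regular iu fP; have := Oint_regular iv fP.
by rewrite /regular_at placeV //; move: (P u) => x; clear; lia.
Qed.

Lemma eps_unit : Ounit eps.
Proof.
split=> //.
  apply: (@cubic_integral _ _ (pol F) (- a3) C kappa%:P).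
  by rewrite rmorphN mulNr; apply: E_root.
have k0 : cst F kappa != 0 by rewrite cst_eq0.
apply: (@cubic_integral _ _ (pol F) ((kappa^-1)%:P * C) (- ((kappa^-1)%:P * a3)) (kappa^-1)%:P).
have kE : pol F (kappa^-1)%:P = (cst F kappa)^-1 by rewrite -[LHS]/(cst F _) fmorphV.
rewrite rmorphN !(rmorphM (pol F) (kappa^-1)%:P) /= !kE.
have := congr1 ( *%R^~ (cst F kappa * eps ^+ 3)^-1) E_root; rewrite mul0r => <-.
move: (pol F a3) (pol F C) (cst F kappa) eps k0 eps0 => s c k x k0 x0; field.
by rewrite k0 x0.
Qed.

Let OunitM (u v : F) : Ounit u -> Ounit v -> Ounit (u * v).
Proof.
move=> [u0 iu iu'] [v0 iv iv']; split; first by rewrite mulf_neq0.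
  exact: integral_mul.
by rewrite invfM; apply: integral_mul.
Qed.

Let OunitV (u : F) : Ounit u -> Ounit u^-1.
Proof. by move=> [u0 iu iu']; split; rewrite ?invr_eq0 ?invrK. Qed.

Let OunitX (u : F) n : Ounit u -> Ounit (u ^+ n).
Proof.
move=> hu; elim: n => [|n IHn]; last by rewrite exprS; apply: OunitM.
by split; rewrite ?invr1 ?oner_neq0 //; apply: integral1.
Qed.

Let OunitXz (u : F) (k : int) : Ounit u -> Ounit (u ^ k).
Proof.
by move=> hu; case: k => n; [apply: OunitX | rewrite NegzE -exprnN; apply/OunitV/OunitX].
Qed.

Lemma unit_constant (u : F) : Ounit u -> 0 <= P1 u -> 0 <= P2 u -> exists2 c, c != 0 & u = cst F c.
Proof.
move=> hu h1 h2; have [|c uE] := @constant_of_regular u.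
  move=> P; have [/infP[]-> //|fP] := pselect (infinite_place P).
  by rewrite /regular_at (Ounit_finite hu fP).
by exists c => //; case: hu; rewrite uE cst_eq0.
Qed.

(** The unit u^n1 / eps^(P1 u) has value 0 at P1. It or its inverse has no pole at P2, so
    it is constant, and its value at P2 is 0 as well. *)
Lemma unit_product_formula (u : F) : Ounit u -> 2%:Z * P2 u = - (P1 u * e%:Z).
Proof.
move=> hu; have u0 : u != 0 by case: hu.
have [_ P1e] := P1_values; have [_ P2e] := P2_values.
pose mu := u ^+ n1 * eps ^ (- P1 u).
have mu_unit : Ounit mu by apply: OunitM; [apply: OunitX | apply: OunitXz; apply: eps_unit].
have mu0 : mu != 0 by case: mu_unit.
have un0 : u ^+ n1 != 0 := expf_neq0 _ u0.
have ek0 : eps ^ (- P1 u) != 0 := expfz_neq0 _ eps0.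
have V P : P mu = n1%:Z * P u - P1 u * P eps.
  by rewrite (pvalM P un0 ek0) (placeX P n1 u0) (placeXz P _ eps0) mulNr.
have V1 : P1 mu = 0 by rewrite V P1e mulrC subrr.
have V2 : P2 mu = 0.
  have triv v : Ounit v -> P1 v = 0 -> 0 <= P2 v -> P2 v = 0.
    move=> hv v1 v2; have [|c c0 ->] := unit_constant hv _ v2; first by rewrite v1.
    exact: (pval_cst P2 c0).
  have [ge|lt] := leP 0 (P2 mu); first exact: triv.
  have := triv _ (OunitV mu_unit); rewrite !(placeV _ mu0) V1 oppr0 => /(_ erefl).
  rewrite oppr_ge0 => /(_ (ltW lt)) => h; by apply/eqP; rewrite -oppr_eq0 h.
have n1z : n1%:Z != 0 by move: n1_gt0; clear; lia.
apply: (mulfI n1z); move: V2; rewrite V => h.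
have -> : n1%:Z * (2%:Z * P2 u) = 2%:Z * (n1%:Z * P2 u - P1 u * P2 eps) + P1 u * (2%:Z * P2 eps).
  by ring.
by rewrite h P2e PoszM; ring.
Qed.

Let nm3_neq0 u v w : cub (ratl F) y u v w != 0 -> nm3 (tofrac A) (tofrac B) u v w != 0.
Proof.
move=> z0; have [u' [v' [w' E]]] := coord (cub (ratl F) y u v w)^-1.
have := divff z0; rewrite E (cubM y_root).
have -> : (1 : F) = cub (ratl F) y 1 0 0 by rewrite /cub rmorph1 rmorph0 !mul0r !addr0.
move=> /coord_inj[E1 E2 E3]; apply/eqP => N0.
have := nm3M (tofrac A) (tofrac B) u v w u' v' w'; rewrite E1 E2 E3 N0 mul0r.
have -> : nm3 (tofrac A) (tofrac B) 1 0 0 = 1 by rewrite /nm3; ring.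
by move/eqP; rewrite oner_eq0.
Qed.

Let size_D : size D = (3 * n1).+1.
Proof.
have four0 : (4%:R : Fq) != 0 by rewrite (natrM _ 2 2) mulf_neq0.
have A0 : A != 0 by rewrite -size_poly_eq0 degA.
have sA : size (4%:R * A ^+ 3 : {poly Fq}) = (3 * n1).+1.
  rewrite -polyC_natr mul_polyC size_scale //.
  have := size_exp A 3; have : (0 < size (A ^+ 3)%R)%N by rewrite size_poly_gt0 expf_neq0.
  by rewrite degA; move: (size (A ^+ 3)) => s; clear; lia.
rewrite size_polyDl sA // size_polyN ltnS -polyC_natr mul_polyC.
apply: leq_trans (size_scale_leq _ _) _.
have sa : (0 < size a)%N by rewrite size_poly_gt0.
have sB : (size B <= size a + n1)%N.
  rewrite defB; apply: leq_trans (size_polyD _ _) _; rewrite geq_max; apply/andP; split.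
    apply: leq_trans (size_polyMleq _ _) _.
    have : (size (a ^+ 2 - A)%R <= n1.+1)%N.
      apply: leq_trans (size_polyD _ _) _; rewrite size_polyN degA geq_max leqnn andbT.
      have := size_exp a 2; move: dega sa.
      by move: (size (a ^+ 2)) (size a) => s t; clear; lia.
    by move: (size (a ^+ 2 - A)) => s; move: (size a) sa => t; clear; lia.
  apply: leq_trans (size_polyC_leq1 _) _.
  by move: (size a) sa => t; clear; lia.
have := size_exp B 2; move: dega sa sB.
by move: (size (B ^+ 2)) (size B) (size a) => s t r; clear; lia.
Qed.

(** Let k = P1 u and let j be k/2 rounded up. Then u / x^j has no poles at infinity, so
    deg disc(u) <= 6j, whereas disc(u) is a non-zero multiple of D, of degree at least
    3 n1. Thus 2j >= n1; the rounding is harmless, since k is even when n1 is even (e = 1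
    in the product formula) and 2j >= n1 + 1 when n1 is odd. *)
Lemma unit_degree_lower_bound (u : F) : Ounit u -> 0 < P1 u -> n1%:Z <= P1 u.
Proof.
move=> hu k_gt0; have u0 : u != 0 by case: hu.
have [P1X _] := P1_values; have [P2X _] := P2_values.
have [x [v [w uE]]] := coord u.
have [[f xE] [g vE] [h wE]] : [/\ polyfrac x, polyfrac v & polyfrac w].
  by apply: Oint_coordinates; rewrite -uE; case: hu.
rewrite {}xE {}vE {}wE in uE; pose N := nm3 A B g (- h) 0.
have N0 : N != 0.
  rewrite -tofrac_eq0; have -> : tofrac N = nm3 (tofrac A) (tofrac B) (tofrac g) (- tofrac h) 0.
    by rewrite /N /nm3 !(tofracD, tofracB, tofracM, tofracN, tofracXn) tofrac0.
  apply: nm3_neq0; apply/eqP => z0.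
  have : cub (ratl F) y (tofrac g) (- tofrac h) 0 = cub (ratl F) y 0 0 0.
    by rewrite z0 /cub !rmorph0 !mul0r !addr0.
  move=> /coord_inj[g0 h0 _].
  have {h0} h0 : tofrac h = 0 by apply/eqP; rewrite -oppr_eq0 h0.
  move: u0 k_gt0; rewrite uE g0 h0 /cub rmorph0 !mul0r !addr0 ratl_eq0 tofrac_eq0 => f0.
  rewrite -/(pol F f) (place_pol _ f0) P1X //; have := size_poly_gt0 f; rewrite f0.
  by move: (size f) => s; clear; lia.
have P2u := unit_product_formula hu.
have [j [j1 j2]] : exists j : nat, P1 u <= 2%:Z * j%:Z /\ 2%:Z * j%:Z <= P1 u + 1.
  exists (`|P1 u|.+1)./2; move: (P1 u) k_gt0 => k; clear; lia.
pose c : KF := tofrac 'X ^ (- j%:Z).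
have cE : ratl F c = X ^ (- j%:Z) by rewrite fmorphXz.
have Xj0 : X ^ (- j%:Z) != 0 := expfz_neq0 _ X0.
have [] : [/\ proper_frac (tr3 (tofrac A) (c * tofrac f) (c * tofrac h)),
    proper_frac (sm3 (tofrac A) (tofrac B) (c * tofrac f) (c * tofrac g) (c * tofrac h))
  & proper_frac (nm3 (tofrac A) (tofrac B) (c * tofrac f) (c * tofrac g) (c * tofrac h))].
  apply: (infinite_charpoly two0 y_root coord coord_inj) => P /infP iP.
  rewrite -cubZ -uE; have -> : GRing.RMorphism.sort (ratl F) c = X ^ (- j%:Z) := cE.
  rewrite /regular_at (pvalM P Xj0 u0) (placeXz P _ X0).
  case: iP => ->; first by rewrite P1X; move: (P1 u) k_gt0 => k; clear; lia.
  move: P2u; rewrite P2X; move: (P1 u) (P2 u) k_gt0 j1 => k l; clear; nia.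
set s1 := tr3 _ _ _; set s2 := sm3 _ _ _ _ _; set s3 := nm3 _ _ _ _ _ => R1 R2 R3.
have := subring_disc3 (proper_frac_ring Fq) R1 R2 R3.
rewrite /s1 /s2 /s3 tr3Z sm3Z nm3Z disc3Z disc3_index_form.
have -> : nm3 (tofrac A) (tofrac B) (tofrac g) (- tofrac h) 0 = tofrac N.
  by rewrite /N /nm3 !(tofracD, tofracB, tofracM, tofracN, tofracXn) tofrac0.
set d := (X in _ * (_ * X)); have -> : d = tofrac D.
  by rewrite /d tofracB (tofracM 4%:R) (tofracM 27%:R) !tofracXn !rmorph_nat.
have c0 : c != 0 by rewrite -(ratl_eq0 F) cE.
have tN0 : tofrac N != 0 by rewrite tofrac_eq0.
have D0 : D != 0 by rewrite -size_poly_eq0 size_D.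
have tD0 : tofrac D != 0 by rewrite tofrac_eq0.
have N2 := expf_neq0 2 tN0; have c6 := expf_neq0 6 c0.
case=> [/eqP|]; first by rewrite (negPf (mulf_neq0 c6 (mulf_neq0 N2 tD0))).
rewrite (fdegM c6 (mulf_neq0 N2 tD0)) (fdegM N2 tD0) (fdegX _ c0) (fdegX _ tN0) fdegXz.
rewrite (fdeg_tofrac N0) (fdeg_tofrac D0) size_D.
have := size_poly_gt0 N; rewrite N0; move: eE P2u j1 j2 k_gt0; have := odd_double_half n1.
move: (P1 u) (P2 u) (size N) => k l s n1E -> E1 j1 j2 k0 s0.
by move: n1E E1 j1 j2 k0 s0; case: (odd n1); clear; lia.
Qed.

(** Division of P1 u by P1 eps = n1 leaves a unit u' with 0 <= P1 u' < n1, hence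
    P1 u' = 0, and u' is constant. *)
Lemma unit_decomposition (u : F) : Ounit u ->
  exists (c : Fq) (k : int), c != 0 /\ u = cst F c * eps ^ k.
Proof.
move=> hu; have u0 : u != 0 by case: hu.
have [_ P1e] := P1_values.
have n1z : n1%:Z != 0 by move: n1_gt0; clear; lia.
pose k := (P1 u %/ n1)%Z; pose u' := u * eps ^ (- k).
have ek0 : eps ^ (- k) != 0 := expfz_neq0 _ eps0.
have hu' : Ounit u' by apply: OunitM => //; apply: OunitXz; apply: eps_unit.
have V1 : P1 u' = (P1 u %% n1)%Z.
  rewrite (pvalM P1 u0 ek0) (placeXz P1 _ eps0) P1e {1}(divz_eq (P1 u) n1).
  by rewrite -/k; ring.
have r_ge0 := modz_ge0 (P1 u) n1z.
have r0 : P1 u' = 0.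
  move: r_ge0; rewrite -V1 le_eqVlt => /orP[/eqP<- //|gt].
  have := unit_degree_lower_bound hu' gt; rewrite V1 leNgt.
  by have := ltz_mod (P1 u) n1z; move: (P1 u %% n1)%Z => r; clear; lia.
have h1 : 0 <= P1 u' by rewrite r0.
have h2 : 0 <= P2 u'.
  by have := unit_product_formula hu'; rewrite r0; move: (P2 u') => x; clear; lia.
have [c c0 uE] := unit_constant hu' h1 h2.
exists c, k; split=> //; rewrite -uE /u' -mulrA -expfzDr // addNr expr0z mulr1 //.
Qed.

End Units.

(** * Unit rank and regulator with two infinite places *)

Section Divisors.

Variables (Fq : finFieldType) (F : fieldExtType {fraction {poly Fq}}).
Implicit Types (P : place F) (D : divisor F).

Definition point (k : int) P : divisor F := Freeg [:: (k, P)].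

Lemma mult_point P k P' : mult P (point k P') = k * (P' == P)%:R.
Proof. exact: coeffU. Qed.

Lemma multD P D D' : mult P (D + D') = mult P D + mult P D'.
Proof. exact: coeffD. Qed.

Lemma divisor_ext D D' : (forall P, mult P D = mult P D') -> D = D'.
Proof. by move=> h; apply/eqP/freeg_eqP => P; apply: h. Qed.

Lemma divdeg_point k P : divdeg (point k P) = k * (pdeg P)%:Z.
Proof. by rewrite /divdeg liftU. Qed.

Lemma divdegD D D' : divdeg (D + D') = divdeg D + divdeg D'.
Proof.
have divdegB (x z : divisor F) : divdeg (x - z) = divdeg x - divdeg z.
  exact: (@lift_is_additive _ _ int^o (fun P : place F => (pdeg P)%:Z : int^o)).
have div0 : divdeg (0 : divisor F) = 0 by rewrite -(subrr 0) divdegB subrr.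
by rewrite -{1}[D']opprK -(sub0r D') !divdegB div0 sub0r opprK.
Qed.

End Divisors.

(** Representatives of the cosets are delta 0, ..., delta (N - 1). *)
Lemma group_index_zmultiples (V : zmodType) (delta : int -> V) (N : nat) :
  {morph delta : i j / i + j} -> injective delta -> (0 < N)%N ->
  group_index (range delta) (range (fun j : int => delta (N%:Z * j))) = N.
Proof.
move=> dD dinj N0; apply: card_fset_set.
pose H := range (fun j : int => delta (N%:Z * j)).
pose coset (i : nat) : set V := [set delta i%:Z + h | h in H]%classic.
have -> : ([set [set g + h | h in H] | g in range delta] = coset @` `I_N)%classic.
  have cosetE (i j : int) : ([set delta (i + N%:Z * j) + h | h in H] =
      [set delta i + h | h in H])%classic.
    apply/seteqP; split=> _ [_ [l _ <-] <-].
      exists (delta (N%:Z * (j + l))); first by exists (j + l).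
      by rewrite -!dD; congr delta; ring.
    exists (delta (N%:Z * (l - j))); first by exists (l - j).
    by rewrite -!dD; congr delta; ring.
  apply/seteqP; split=> [_ [_ [i _ <-] <-]|_ [i iN <-]]; last first.
    by exists (delta i%:Z) => //; exists i%:Z.
  have Nz : N%:Z != 0 by move: N0; clear; lia.
  exists `|(i %% N)%Z|%N.
    have := modz_ge0 i Nz; have := ltz_mod i Nz; rewrite /=.
    by move: (i %% N)%Z N0 => r; clear; lia.
  rewrite /coset gez0_abs ?modz_ge0 //.
  by rewrite [in RHS](divz_eq i N) addrC (mulrC _ N%:Z) cosetE.
apply: inj_card_eq => i j /set_mem iN /set_mem jN E.
have : coset i (delta i%:Z).
  by exists (delta (N%:Z * 0)); [exists 0 | rewrite -dD mulr0 addr0].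
rewrite E => -[_ [l _ <-]]; rewrite -dD => /dinj.
move: iN jN => /= iN jN; move: N0 iN jN; clear => N0 iN jN h.
have l0 : l = 0 by nia.
by move: h; rewrite l0; lia.
Qed.

Section UnitRankOne.

Variables (Fq : finFieldType) (F : fieldExtType {fraction {poly Fq}}).
Implicit Types (P : place F) (D : divisor F).
Variables (eps : F) (P1 P2 : place F) (N : nat).
Hypothesis eps_unit : Ounit eps.
Hypothesis decomposition : forall u : F, Ounit u ->
  exists (c : Fq) (k : int), c != 0 /\ u = cst F c * eps ^ k.
Hypothesis infP : forall P, infinite_place P <-> P = P1 \/ P = P2.
Hypotheses (P12 : P1 != P2) (N0 : (0 < N)%N) (deg1 : pdeg P1 = 1%N).
Hypotheses (deg2 : (0 < pdeg P2)%N) (P1eps : P1 eps = (pdeg P2 * N)%:Z) (P2eps : P2 eps = - N%:Z).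

Let eps0 : eps != 0. Proof. by case: eps_unit. Qed.

Let P1_unit c k : c != 0 -> P1 (cst F c * eps ^ k) = k * (pdeg P2 * N)%:Z.
Proof.
move=> c0; have cF : cst F c != 0 by rewrite cst_eq0.
by rewrite (pvalM P1 cF (expfz_neq0 k eps0)) pval_cst // (placeXz P1 k eps0) P1eps add0r.
Qed.

Let dN0 : (pdeg P2 * N)%:Z != 0.
Proof. by rewrite -[_ == _]/((pdeg P2 * N)%N == 0%N) -lt0n muln_gt0 deg2. Qed.

Let unit_injective c k c' k' : c != 0 -> c' != 0 ->
  cst F c * eps ^ k = cst F c' * eps ^ k' -> c = c' /\ k = k'.
Proof.
move=> c0 c'0 E; have kk : k = k'.
  by have := congr1 P1 E; rewrite !P1_unit // => /(mulIf dN0).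
split=> //; move: E; rewrite kk => /(mulIf (expfz_neq0 k' eps0)); exact: fmorph_inj.
Qed.

Lemma unit_rank_one : has_unit_rank F 1.
Proof.
exists (fun=> eps); split=> // u /decomposition[c [k [c0 ->]]].
exists (c, [ffun=> k]); split=> [|[c' k'] /= [c'0]].
  by rewrite big_ord1 ffunE.
rewrite big_ord1 => /(unit_injective c0 c'0)[-> ->].
by congr pair; apply/ffunP => i; rewrite ffunE !ord1.
Qed.

Lemma fundamental_unit_eps : fundamental_unit eps.
Proof.
split; last first.
  move=> u /decomposition[c [k [c0 ->]]]; exists c, (fun=> k).
  by rewrite big_ord1.
split=> // k; rewrite big_ord1 => E i; rewrite !ord1.
have := @unit_injective 1 (k ord0) 1 0 (oner_neq0 _) (oner_neq0 _).
by rewrite rmorph1 !mul1r E expr0z => /(_ erefl)[].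
Qed.

(** The coefficients are those for which the degree vanishes, as P1 has degree 1. *)
Let delta (z : int) : divisor F := point (z * (pdeg P2)%:Z) P1 + point (- z) P2.

Let mult_delta P z :
  mult P (delta z) = z * (pdeg P2)%:Z * (P1 == P)%:R - z * (P2 == P)%:R.
Proof. by rewrite multD !mult_point mulNr. Qed.

Let mult1 z : mult P1 (delta z) = z * (pdeg P2)%:Z.
Proof. by rewrite mult_delta eqxx eq_sym (negPf P12) mulr1 mulr0 subr0. Qed.

Let mult2 z : mult P2 (delta z) = - z.
Proof. by rewrite mult_delta eqxx (negPf P12) mulr1 mulr0 sub0r. Qed.

Let U0E : @U0 Fq F = range delta.
Proof.
apply/seteqP; split=> [D [degD supp]|_ [z _ <-]]; last first.
  split.
    rewrite divdegD !divdeg_point deg1 mulr1 mulNr subrr //.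
  move=> P nz; apply/infP; apply: contrapT => nP; case/eqP: nz.
  have [n1 n2] : (P1 == P) = false /\ (P2 == P) = false.
    by split; apply/eqP => E; apply: nP; rewrite -E; [left|right].
  by rewrite mult_delta n1 n2 !mulr0 subr0.
exists (- mult P2 D) => //.
have DE : D = point (mult P1 D) P1 + point (mult P2 D) P2.
  apply: divisor_ext => P; rewrite multD !mult_point.
  have [<-|n1] := eqVneq P1 P.
    by rewrite eq_sym (negPf P12) mulr1 mulr0 addr0.
  have [<-|n2] := eqVneq P2 P; first by rewrite mulr1 mulr0 add0r.
  rewrite !mulr0 addr0; apply/eqP; apply: contraT => /supp /infP [] E.
    by rewrite E eqxx in n1.
  by rewrite E eqxx in n2.
rewrite [RHS]DE /delta opprK; congr (point _ _ + _).
move: degD; rewrite {1}DE divdegD !divdeg_point deg1 mulr1.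
by move=> /eqP; rewrite addr_eq0 mulNr => /eqP ->.
Qed.

(** A function whose divisor is supported at infinity is integral along with its inverse,
    so the divisors in question are those of the powers of eps. *)
Let principalE : (@principal Fq F `&` @U0 Fq F)%classic = range (fun j : int => delta (N%:Z * j)).
Proof.
apply/seteqP; split=> [D [[f f0 fD] UD]|_ [j _ <-]].
  have fin P : ~ infinite_place P -> P f = 0.
    move=> nP; rewrite -fD; apply/eqP; apply: contraT => nz.
    by case: nP; case: UD => _; apply.
  have unit_f : Ounit f.
    split=> //; apply: Oint_of_regular => P /fin fP; rewrite /regular_at ?fP //.
    by rewrite placeV // fP.
  have [c [k [c0 fE]]] := decomposition unit_f.
  move: (UD); rewrite U0E => -[z _ zD]; exists k => //.
  rewrite -zD; congr delta; have := fD P1; rewrite -zD mult1 fE P1_unit // PoszM.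
  have dz : (pdeg P2)%:Z != 0 by rewrite -[_ == _]/(pdeg P2 == 0%N) -lt0n.
  by move=> h; apply: (mulIf dz); rewrite h; ring.
split; last by rewrite U0E; exists (N%:Z * j).
exists (eps ^ j); first exact: expfz_neq0.
move=> P; rewrite (placeXz P j eps0) mult_delta.
have [<-|n1] := eqVneq P1 P.
  by rewrite eq_sym (negPf P12) P1eps PoszM mulr1 mulr0; ring.
have [<-|n2] := eqVneq P2 P; first by rewrite P2eps mulr1 mulr0; ring.
have nP : ~ infinite_place P by move/infP => [] E; [rewrite E eqxx in n1 | rewrite E eqxx in n2].
have [_ i1 i2] := eps_unit; have := Oint_regular i1 nP; have := Oint_regular i2 nP.
rewrite /regular_at placeV // !mulr0 subr0.
move: (P eps) => x h1 h2; have -> : x = 0 by move: h1 h2; clear; lia.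
by rewrite mulr0.
Qed.

Lemma regulator_eq : regulator F = N.
Proof.
rewrite /regulator principalE U0E; apply: group_index_zmultiples => //.
  move=> i j; apply: divisor_ext => P; rewrite multD !mult_delta; ring.
by move=> i j /(congr1 (mult P2)); rewrite !mult2 => /oppr_inj.
Qed.

End UnitRankOne.

(** * The squarefree factorization of the discriminant *)

(** If p divides D2, then it divides B, hence A, as 4 is invertible. If p^2 divided B, then
    p^3 would divide D = D1 D2^2, which it does not, since D1 is prime to D2 and D2 is
    squarefree. *)
Lemma squarefree_discriminant_cases (k : fieldType) (A B D1 D2 p : {poly k}) :
  (2%:R : k) != 0 -> 4%:R * A ^+ 3 - 27%:R * B ^+ 2 = D1 * D2 ^+ 2 ->
  squarefree_poly D1 -> squarefree_poly D2 -> coprimep D1 D2 -> D2 %| B ->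
  irreducible_poly p ->
  ~~ (p ^+ 2 %| 4%:R * A ^+ 3 - 27%:R * B ^+ 2) \/ [/\ p %| A, p %| B & ~~ (p ^+ 2 %| B)].
Proof.
move=> two0 DE sqf1 sqf2 cop D2B irr; have [sp _] := irr.
have p0 : p != 0 by rewrite -size_poly_gt0 ltnW.
have nsq q : squarefree_poly q -> ~~ (p ^+ 2 %| q).
  by move=> sqf; apply/negP => /sqf s1; rewrite s1 in sp.
rewrite DE; have [pD2|npD2] := boolP (p %| D2); last first.
  left; apply: contraNN (nsq _ sqf1) => h.
  have cp : coprimep (p ^+ 2) (D2 ^+ 2).
    by apply/coprimep_expl/coprimep_expr; rewrite irreducible_poly_coprime.
  by rewrite -(Gauss_dvdpl _ cp).
right; have pB : p %| B := dvdp_trans pD2 D2B.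
have four0 : (4%:R : k) != 0 by rewrite (natrM _ 2 2) mulf_neq0.
have [E D2E] := dvdpP _ _ pD2.
have pA : p %| A.
  apply: (irreducible_dvdX (n := 3) irr); rewrite -(dvdp_natl _ _ four0).
  have -> : 4%:R * A ^+ 3 = D1 * D2 ^+ 2 + 27%:R * B ^+ 2 by rewrite -DE; ring.
  by apply: dvdp_add; rewrite dvdp_mull // expr2 dvdp_mulr.
split=> //; apply/negP => p2B.
have npD1 : ~~ (p %| D1).
  apply/negP => pD1; move: cop; rewrite /coprimep size_poly_eq1 => /eqp_dvdr E1.
  have := E1 p; rewrite dvdp_gcd pD1 pD2 dvdp1 => /esym/eqP s1.
  by rewrite s1 in sp.
have npE : ~~ (p %| E).
  apply: contraNN (nsq _ sqf2) => /dvdpP [E' EE]; rewrite D2E EE -mulrA -expr2.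
  exact: dvdp_mull.
have : p ^+ 3 %| D1 * D2 ^+ 2.
  rewrite -DE; apply: dvdp_sub; apply: dvdp_mull; first exact: dvdp_exp2r.
  by apply: dvdp_trans (dvdp_exp2r 2 p2B); rewrite -exprM dvdp_exp2l.
rewrite D2E exprMn mulrA [p ^+ 3]exprS dvdp_mul2r ?expf_neq0 //.
case/(irreducible_dvdM irr) => [|/(irreducible_dvdX irr)]; first by rewrite (negPf npD1).
by rewrite (negPf npE).
Qed.

Theorem theorem2p4p5 (Fq : finFieldType) (p : nat)
    (charFq : p \in [pchar Fq]) (p_ge5 : (5 <= p)%N)
    (A : {poly Fq}) (n1 : nat) (degA : size A = n1.+1) (n1_gt0 : (0 < n1)%N)
    (caseA : odd n1 \/
             ~~ odd n1 /\ ~ (exists c : Fq, lead_coef A = c ^+ 2))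
    (a : {poly Fq}) (a_neq0 : a != 0) (dega : ((size a).-1.*2 < n1)%N)
    (kappa : Fq) (kappa_neq0 : kappa != 0)
    (B : {poly Fq}) (defB : B = a * (a ^+ 2 - A) + kappa%:P)
    (D D1 D2 : {poly Fq}) (defD : D = 4%:R * A ^+ 3 - 27%:R * B ^+ 2)
    (D1_sqf : squarefree_poly D1) (D2_sqf : squarefree_poly D2)
    (D12_coprime : coprimep D1 D2) (factD : D = D1 * D2 ^+ 2)
    (D2_dvdB : D2 %| B)
    (T_irr : irreducible_poly
       ('X^3 - (tofrac A)%:P * 'X + (tofrac B)%:P : {poly {fraction {poly Fq}}}))
    (F : fieldExtType {fraction {poly Fq}}) (y : F)
    (y_root : y ^+ 3 = pol F A * y - pol F B)
    (F_gen : <<1%VS; y>>%VS = fullv)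
    (Fq_closed : constants_closed F) :
  [/\ has_unit_rank F 1,
      fundamental_unit (pol F a + y),
      odd n1 -> regulator F = n1
    & ~~ odd n1 -> regulator F = n1./2].
Proof.
have small m : (0 < m < 5)%N -> (m%:R : Fq) != 0.
  move=> /andP[m0 m5]; rewrite -(dvdn_pcharf charFq); apply/negP => /(dvdn_leq m0).
  by rewrite leqNgt (leq_trans m5 p_ge5).
have two0 := small 2 isT; have three0 := small 3 isT.
have coord := coordinates_exist y_root F_gen.
have coord_inj := coordinates_unique T_irr y_root.
have [P1 [P2 [e [infP P12 [P1X P1e d1] [P2X P2e d2] eE]]]] := infinite_places two0 three0
  degA n1_gt0 a_neq0 dega kappa_neq0 defB y_root coord coord_inj caseA.
have local_cond q := squarefree_discriminant_cases (p := q) two0 (etrans (esym defD) factD)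
  D1_sqf D2_sqf D12_coprime D2_dvdB.
have unitE := eps_unit kappa_neq0 defB y_root.
have decomp := unit_decomposition two0 three0 degA n1_gt0 a_neq0 dega kappa_neq0 defB y_root
  coord coord_inj Fq_closed local_cond infP (conj P1X P1e) (conj P2X P2e) eE.
have d2_gt0 : (0 < pdeg P2)%N by move: d2; case: (pdeg P2).
(* the valuation of a + y at P2 is - N, where e deg(P2) = 2 *)
have [N NE [P2E N_odd N_even]] : exists2 N, n1 = (pdeg P2 * N)%N &
    [/\ P2 (pol F a + y) = - N%:Z, odd n1 -> N = n1 & ~~ odd n1 -> N = n1./2].
  have n1E := odd_double_half n1; move: P2e d2; rewrite eE.
  move: n1E; move: (P2 (pol F a + y)) (pdeg P2) => x d; case: (odd n1) => n1E xE dE.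
    by exists n1; [|split=> //]; move: n1E xE dE; clear; lia.
  by exists n1./2; [|split=> //]; move: n1E xE dE; clear; lia.
have N_gt0 : (0 < N)%N by move: n1_gt0; rewrite NE muln_gt0 => /andP[].
have P1E : P1 (pol F a + y) = (pdeg P2 * N)%:Z by rewrite P1e -NE.
have regE := regulator_eq unitE decomp infP P12 N_gt0 d1 d2_gt0 P1E P2E.
split; rewrite ?regE //.
  exact: unit_rank_one unitE decomp N_gt0 d2_gt0 P1E.
exact: fundamental_unit_eps unitE decomp N_gt0 d2_gt0 P1E.
Qed.
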